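(* Let $p_1,p_2,q_1,q_2>0$, $\lambda>0$, and let $A,B\in C(\mathbb{R}_+\times\mathbb{R}_+;\mathbb{R}_+)$. For a bounded domain $\Omega\subset\mathbb{R}^N$ with $C^2$ boundary consider the overdetermined problem $$(P_\Omega)\quad\begin{cases}-A\left(\|u\|_{L^{p_1}(\Omega)},\|\nabla u\|_{L^{q_1}(\Omega)}\right)\Delta u=\lambda B\left(\|u\|_{L^{p_2}(\Omega)},\|\nabla u\|_{L^{q_2}(\Omega)}\right) & \text{in }\Omega,\\ u=0 & \text{on }\partial\Omega,\\ \frac{\partial u}{\partial\nu}=c & \text{on }\partial\Omega,\end{cases}$$ where $c$ is an unknown constant. (1) If $(P_\Omega)$ admits a solution $u\in C^2(\overline{\Omega})$, then $\Omega$ must be a ball and $u$ must be radially symmetric (about the center of the ball). (2) Let $R>0$, $x_0\in\mathbb{R}^N$, and write $U=U_{R,x_0}$ and $\|\cdot\|_p=\|\cdot\|_{L^p(B_R(x_0))}$, where $U_{R,x_0}(x)=\frac{R^2-|x-x_0|^2}{2N}$. Then the number of solutions of $(P_\Omega)$ with $\Omega=B_R(x_0)$ is equal to the number of solutions $(s_1,s_2,t_1,t_2)\in(\mathbb{R}_+)^4$ of the system $$\begin{cases} s_1=\lambda\dfrac{B(s_2,t_2)}{A(s_1,t_1)}\|U\|_{p_1},\\[2mm] s_2=\lambda\dfrac{B(s_2,t_2)}{A(s_1,t_1)}\|U\|_{p_2},\\[2mm] t_1=\lambda\dfrac{B(s_2,t_2)}{A(s_1,t_1)}\|\nabla U\|_{q_1},\\[2mm]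 t_2=\lambda\dfrac{B(s_2,t_2)}{A(s_1,t_1)}\|\nabla U\|_{q_2},\end{cases}$$ and the number of solutions of this system is equal to the number of solutions $s>0$ of the single equation $$g(s)=\lambda\|U\|_{p_1},\qquad\text{where}\qquad g(s)=\frac{s\,A\left(s,\dfrac{\|\nabla U\|_{q_1}}{\|U\|_{p_1}}s\right)}{B\left(\dfrac{\|U\|_{p_2}}{\|U\|_{p_1}}s,\dfrac{\|\nabla U\|_{q_2}}{\|U\|_{p_1}}s\right)}.$$ (3) Moreover, any solution $u_\lambda$ of $(P_\Omega)$ with $\Omega=B_R(x_0)$ is of the form $$u_\lambda(x)=s_1\frac{U_{R,x_0}(x)}{\|U_{R,x_0}\|_{L^{p_1}(B_R(x_0))}},$$ where $s_1>0$ is a solution of $g(s)=\lambda\|U_{R,x_0}\|_{L^{p_1}(B_R(x_0))}$.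
   Context: $\mathbb{R}_+=(0,\infty)$. $B_R(x_0)\subset\mathbb{R}^N$ is the open ball of radius $R$ centered at $x_0$; $\nu$ is the outer unit normal to $\partial\Omega$. For $p>0$ (possibly $p<1$), $\|f\|_{L^p(\Omega)}=\left(\int_\Omega|f|^p\,dx\right)^{1/p}$, and $\|\nabla u\|_{L^q(\Omega)}$ is the $L^q$ (quasi-)norm of $|\nabla u|$. A solution of the problem is a function $u\in C^2(\overline{\Omega})$, with $\|u\|$ and $\|\nabla u\|$ norms in $\mathbb{R}_+$ (so that $A$ and $B$ are evaluated in their domain; in particular $u\not\equiv0$), satisfying the three conditions for some constant $c\in\mathbb{R}$; $c$ is not prescribed, and solutions are counted as functions $u$. ''Number of solutions'' means cardinality of the solution set. The function $U_{R,x_0}$ is the unique solution of $-\Delta U=1$ in $B_R(x_0)$, $U=0$ on $\partial B_R(x_0)$ (with constant normal derivative on the boundary). *)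

(* Defs.v *)
From HB Require Import structures.
From mathcomp Require Import all_boot all_order all_algebra.
From mathcomp Require Import all_classical all_reals all_analysis.

Set Implicit Arguments.
Unset Strict Implicit.
Unset Printing Implicit Defensive.

Import Order.TTheory GRing.Theory Num.Theory.
Import numFieldNormedType.Exports.

Local Open Scope classical_set_scope.
Local Open Scope ring_scope.

(* N-dimensional Lebesgue measure, on the Borel sets of N.-tuple R (the library
   puts no measurable structure on 'rV[R]_N): the iterated product of the
   one-dimensional one. *)
Section lebesgue_measure_tuple.
Variable R : realType.

Definition cons_pair n (z : n.-tuple R * R) : n.+1.-tuple R :=
  [the n.+1.-tuple R of z.2 :: z.1].

Lemma measurable_cons_pair n : measurable_fun [set: n.-tuple R * R] (@cons_pair n).
Proof.
by apply: measurable_cons; [exact: measurable_snd | exact: measurable_fst].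
Qed.

Definition lebesgue_tuple_succ n (mu : {measure set (n.-tuple R) -> \bar R}) :
    {measure set (n.+1.-tuple R) -> \bar R} :=
  measure_function_pushforward__canonical__measure_function_Measure
    (mu \x (@lebesgue_measure R))%E (@measurable_cons_pair n).

Fixpoint lebesgue_tuple n : {measure set (n.-tuple R) -> \bar R} :=
  if n is m.+1 then lebesgue_tuple_succ (lebesgue_tuple m)
  else dirac [tuple].

End lebesgue_measure_tuple.

Section analysis_on_rV.
Variables (R : realType) (N : nat).
Implicit Types (Omega V : set 'rV[R]_N) (u f phi : 'rV[R]_N -> R).

Definition row_of_tuple (t : N.-tuple R) : 'rV[R]_N := \row_i tnth t i.

Definition dot (v w : 'rV[R]_N) : R := \sum_i v 0 i * w 0 i.

(* The library's norm `|v| on 'rV[R]_N is the max norm (it induces the same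
   topology and the same bounded sets). *)
Definition enorm (v : 'rV[R]_N) : R := Num.sqrt (dot v v).

Definition eball (x0 : 'rV[R]_N) (r : R) : set 'rV[R]_N :=
  [set x | enorm (x - x0) < r].

Definition boundary Omega : set 'rV[R]_N := closure Omega `\` Omega°.

Definition partial (i : 'I_N) f : 'rV[R]_N -> R := 'D_(delta_mx 0 i) f.

Definition grad f (x : 'rV[R]_N) : 'rV[R]_N := \row_i partial i f x.

Definition laplacian f (x : 'rV[R]_N) : R :=
  \sum_i partial i (partial i f) x.

(* Meant for p > 0, and for functions with |f|^p integrable on Omega:
   the real-valued integral of a function with infinite integral is 0. *)
Definition lpnorm (p : R) Omega f : R :=
  (\int[lebesgue_tuple R N]_(t in row_of_tuple @^-1` Omega)
     (`|f (row_of_tuple t)| `^ p)) `^ p^-1.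

Definition grad_lpnorm (p : R) Omega f : R :=
  lpnorm p Omega (fun x => enorm (grad f x)).

(* For V open. *)
Definition C2_on V f : Prop :=
  {in V, continuous f} /\
  forall i,
    (forall x, V x -> derivable f x (delta_mx 0 i)) /\
    {in V, continuous (partial i f)} /\
    forall j,
      (forall x, V x -> derivable (partial i f) x (delta_mx 0 j)) /\
      {in V, continuous (partial j (partial i f))}.

Definition extends_to_closure Omega f : Prop :=
  exists g : 'rV[R]_N -> R,
    {within closure Omega, continuous g} /\ {in Omega, f =1 g}.

(* C^2 of the closure of an open set Omega: all the derivatives of order at most
   2 extend continuously to the closure; only the values of u on the closure
   matter. *)
Definition C2_closure Omega u : Prop :=
  [/\ C2_on Omega u,
      {within closure Omega, continuous u},
      forall i, extends_to_closure Omega (partial i u)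
    & forall i j, extends_to_closure Omega (partial j (partial i u))].

Definition bounded_domain Omega : Prop :=
  [/\ Omega !=set0, open Omega, connected Omega & bounded_set Omega].

(* phi is a C^2 function on a neighbourhood V of x with nonzero gradient at x,
   and Omega is the sublevel set phi < 0 inside V. *)
Definition defining_function Omega (x : 'rV[R]_N) V phi : Prop :=
  [/\ open V, V x, C2_on V phi, grad phi x != 0
    & Omega `&` V = [set y | phi y < 0] `&` V].

Definition C2_boundary Omega : Prop :=
  forall x, boundary Omega x -> exists V phi, defining_function Omega x V phi.

Definition outer_unit_normal Omega (x nu : 'rV[R]_N) : Prop :=
  exists V phi, defining_function Omega x V phi /\
    nu = (enorm (grad phi x))^-1 *: grad phi x.

(* On the boundary, the gradient of u is that of its C^1 extension to the
   closure, i.e. the limit of the gradient from inside Omega. *)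
Definition has_normal_derivative Omega u (x nu : 'rV[R]_N) (c : R) : Prop :=
  dot (grad u y) nu @[y --> within Omega (nbhs x)] --> c.

Definition radially_symmetric Omega (x0 : 'rV[R]_N) u : Prop :=
  forall x y, closure Omega x -> closure Omega y ->
    enorm (x - x0) = enorm (y - x0) -> u x = u y.

Definition quadrant : set (R * R) := [set z | 0 < z.1 /\ 0 < z.2].

Section problem.
Variables (p1 p2 q1 q2 lambda : R) (A B : R * R -> R).

Definition is_solution Omega u : Prop :=
  [/\ C2_closure Omega u,
      quadrant (lpnorm p1 Omega u, grad_lpnorm q1 Omega u) /\
      quadrant (lpnorm p2 Omega u, grad_lpnorm q2 Omega u),
      forall x, Omega x ->
        - A (lpnorm p1 Omega u, grad_lpnorm q1 Omega u) * laplacian u x =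
        lambda * B (lpnorm p2 Omega u, grad_lpnorm q2 Omega u),
      forall x, boundary Omega x -> u x = 0
    & exists c : R, forall x nu, boundary Omega x ->
        outer_unit_normal Omega x nu -> has_normal_derivative Omega u x nu c].

(* The solutions as functions on the closure of Omega. *)
Definition solution_set Omega : set (closure Omega -> R) :=
  sigL (closure Omega) @` is_solution Omega.

Variables (x0 : 'rV[R]_N) (r : R).

Definition torsion (x : 'rV[R]_N) : R :=
  (r ^+ 2 - enorm (x - x0) ^+ 2) / (2 * N%:R).

Local Notation normU p := (lpnorm p (eball x0 r) torsion).
Local Notation normDU q := (grad_lpnorm q (eball x0 r) torsion).

Definition system_set : set (R * R * R * R) :=
  [set z | let: (s1, s2, t1, t2) := z in
    [/\ 0 < s1, 0 < s2, 0 < t1 & 0 < t2] /\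
    [/\ s1 = lambda * (B (s2, t2) / A (s1, t1)) * normU p1,
        s2 = lambda * (B (s2, t2) / A (s1, t1)) * normU p2,
        t1 = lambda * (B (s2, t2) / A (s1, t1)) * normDU q1
      & t2 = lambda * (B (s2, t2) / A (s1, t1)) * normDU q2]].

Definition g_fun (s : R) : R :=
  s * A (s, normDU q1 / normU p1 * s) /
  B (normU p2 / normU p1 * s, normDU q2 / normU p1 * s).

Definition g_set : set R := [set s | 0 < s /\ g_fun s = lambda * normU p1].

End problem.
End analysis_on_rV.

Arguments solution_set {R N} p1 p2 q1 q2 lambda A B Omega.

(* Main.v *)
(* Weinberger's argument, arranged so that no boundary integral, no trace and no
   interior regularity beyond C^2 is needed.  Normalise to [- Delta u = N a] and
   put [P = |grad u|^2 + 2 a u].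

   Since [u >= 0] vanishes on the boundary, its boundary gradient is normal there
   (its derivatives along all inward directions are nonnegative), so [P] tends to
   [c^2] at the boundary.  With [h = u + a |x|^2 / 2] harmonic, [P x] is the
   maximum over [y] of [2 a (h x + (y - x) . grad h x) - a^2 |y|^2], and each of
   these functions is a uniform limit of exactly harmonic dilation quotients of
   [h]; hence [P <= c^2].  The Pohozaev identity, tested against a cutoff of [u]
   itself, gives [int (c^2 - P) <= 0], so that [P = c^2].  The equality case
   forces [D^2 h = 0]: [u] is a quadratic and [Omega] a ball.

   On a ball, the maximum principle shows that every solution is a positive
   multiple of the torsion function, and the norms determine the multiple. *)
From HB Require Import structures.
Require Import Defs.
From mathcomp Require Import all_boot all_order all_algebra.
From mathcomp Require Import all_classical all_reals all_analysis.
From mathcomp Require Import measurable_realfun ring lra.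

Set Implicit Arguments.
Unset Strict Implicit.
Unset Printing Implicit Defensive.

Import Order.TTheory GRing.Theory Num.Theory.
Import numFieldNormedType.Exports.

Local Open Scope classical_set_scope.
Local Open Scope card_scope.
Local Open Scope ring_scope.

(** * Calculus on row vectors *)

(** Classically [P <= c^2] follows from Delta P = 2 |D^2 h|^2 >= 0, a computation that involves
    third derivatives of [u]. The Laplacian of [euler_mean h y] meets the same obstacle, but this
    function is linear in [h], so difference quotients of [h] approximate it by functions that the
    maximum principle accepts. This is the reason for writing the nonlinear [P] as a maximum of such
    functions.

    In the Pohozaev step the boundary integral is replaced by the weight [cutoff e (u x)].
    Integrating the divergence of the weighted field X leaves a term that lives where [u] is between
    e and 2 e and has the sign of grad u . X. For the plain Pohozaev field this product vanishes
    where u = 0 and |grad u|^2 = c^2, so its sign near the boundary is unknown. Adding delta * grad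
    u makes the product nonnegative near the boundary; the price is an error proportional to delta,
    and delta is fixed before e. *)

Section calculus.
Variables (R : realType) (N : nat).
Implicit Types (f : 'rV[R]_N -> R) (x y z v w : 'rV[R]_N).

Local Notation e_ i := (delta_mx (0 : 'I_1) i : 'rV[R]_N).

(** Directional derivatives become derivatives of one real variable along a line, where the chain
    rule and the mean value theorem are available. *)
Lemma is_derive_lineP f x v (s d : R) :
  is_derive (s *: v + x) v f d <-> is_derive s (1 : R) (fun t : R => f (t *: v + x)) d.
Proof.
have E : (fun h : R => h^-1 *: (f (h *: v + (s *: v + x)) - f (s *: v + x))) =
         (fun h : R => h^-1 *: (f ((h *: 1 + s) *: v + x) - f (s *: v + x))).
  by apply/funext => h; rewrite scalerDl addrA [_%:A]mulr1.
by split; case => dv dE; split; move: dv dE;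
  rewrite /derivable /derive /= E.
Qed.

Lemma is_derive_line0P f x v (d : R) :
  is_derive x v f d <-> is_derive (0 : R) (1 : R) (fun t : R => f (t *: v + x)) d.
Proof. by rewrite -(is_derive_lineP f x v 0) scale0r add0r. Qed.

Lemma is_derive_chain (g : R -> R) f x v (dg df : R) :
  is_derive x v f df -> is_derive (f x) (1 : R) g dg ->
  is_derive x v (g \o f) (dg * df).
Proof.
move=> /is_derive_line0P hf hg; apply/is_derive_line0P.
have hg' : is_derive ((fun t : R => f (t *: v + x)) 0) (1 : R) g dg.
  by rewrite /= scale0r add0r.
exact: (@is_derive1_comp _ g (fun t : R => f (t *: v + x)) 0).
Qed.

(** The parameter runs over [0, 1] and is scaled by [d], so that positive, negative and zero
    increments are treated alike. *)
Lemma mean_value_bound (g dg : R -> R) (L eta d : R) :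
  (forall t : R, 0 <= t <= 1 -> is_derive (t * d) (1 : R) g (dg (t * d))) ->
  (forall t : R, 0 <= t <= 1 -> `|dg (t * d) - L| <= eta) ->
  `|g d - g 0 - L * d| <= eta * `|d|.
Proof.
move=> hg hb.
have hG (t : R) : 0 <= t <= 1 ->
    is_derive t (1 : R) (fun t : R => g (t * d)) (dg (t * d) * d).
  move=> t01.
  apply: (@is_derive1_comp R g (fun s : R => s * d) t (dg (t * d)) d) (hg _ t01) _.
  have -> : (fun s : R => s * d) = d \*: (id : R -> R).
    by apply/funext => s /=; rewrite mulrC.
  by rewrite -[X in is_derive _ _ _ X]mulr1; exact: is_deriveZ.
have [||c] := @MVT R (fun t : R => g (t * d)) (fun t => dg (t * d) * d) 0 1 ltr01.
- by move=> t; rewrite in_itv/= => /andP[a b]; apply: hG; rewrite !ltW.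
- apply: derivable_within_continuous => t; rewrite in_itv/= => t01.
  by case: (hG t t01).
rewrite in_itv/= mul1r mul0r subr0 mulr1 => /andP[c0 c1] ->.
rewrite -mulrBl normrM ler_wpM2r// hb// !ltW//.
Qed.

Lemma ball_rVP x (r : R) y :
  0 < r -> (ball x r y <-> forall i, `|x 0 i - y 0 i| < r).
Proof.
move=> r0; split => [[_ h] i|h]; first exact: h.
by split => // i j; rewrite ord1; exact: h.
Qed.

(** The path from [y] to [z] changes one coordinate at a time and the increments telescope. Balls of
    the max norm are boxes, so the whole path stays in the ball. *)
Lemma box_mean_value f x (r : R) (L : 'rV[R]_N) (eta : R) y z :
  (forall w i, ball x r w -> derivable f w (e_ i)) ->
  (forall w i, ball x r w -> `|partial i f w - L 0 i| <= eta) ->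
  ball x r y -> ball x r z ->
  `|f z - f y - dot L (z - y)| <= eta * \sum_i `|z 0 i - y 0 i|.
Proof.
move=> df bf yB zB; have r0 : 0 < r by case: yB.
pose p (k : nat) : 'rV[R]_N := \row_i (if (i < k)%N then z 0 i else y 0 i).
have p0 : p 0 = y by apply/rowP => i; rewrite mxE.
have pN : p N = z by apply/rowP => i; rewrite mxE ltn_ord.
have -> : f z - f y = \sum_(k < N) (f (p k.+1) - f (p k)).
  by rewrite -(big_mkord predT (fun k => f (p k.+1) - f (p k))) telescope_sumr// p0 pN.
rewrite /dot -sumrB mulr_sumr; apply: le_trans (ler_norm_sum _ _ _) _.
apply: ler_sum => k _; rewrite !mxE.
have pS (t : R) : t *: e_ k + p k =
    \row_i (if i == k then y 0 k + t else p k 0 i).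
  apply/rowP => i; rewrite !mxE eqxx/=.
  by case: eqP => [->|_]; rewrite ?ltnn ?mulr1 ?mulr0 ?add0r// addrC.
have pk0 : f (p k) = f (0 *: e_ k + p k) by rewrite scale0r add0r.
have pk1 : f (p k.+1) = f ((z 0 k - y 0 k) *: e_ k + p k).
  rewrite pS; congr f; apply/rowP => i; rewrite !mxE.
  rewrite ltnS leq_eqVlt; case: (eqVneq i k) => [->|nik].
    by rewrite eqxx/= addrC subrK.
  by rewrite (_ : (i == k :> nat) = false)//; apply/negbTE.
rewrite pk0 pk1.
have inB (t : R) : 0 <= t <= 1 -> ball x r ((t * (z 0 k - y 0 k)) *: e_ k + p k).
  move=> /andP[t0 t1]; rewrite pS; apply/(ball_rVP x _ r0) => i; rewrite !mxE.
  have := (ball_rVP x _ r0).1 yB i; have := (ball_rVP x _ r0).1 zB i.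
  case: eqP => [->|_ ? ?]; last by case: ifP.
  set A := x 0 k - y 0 k; set B := x 0 k - z 0 k => hB hA.
  have -> : x 0 k - (y 0 k + t * (z 0 k - y 0 k)) = (1 - t) * A - t * - B.
    by rewrite /A /B; ring.
  apply: le_lt_trans (ler_normB _ _) _; rewrite !normrM normrN.
  rewrite (ger0_norm t0) ger0_norm ?subr_ge0//.
  have [AB|AB] := leP `|A| `|B|.
    by apply: le_lt_trans hB; nra.
  by apply: le_lt_trans hA; nra.
apply: (@mean_value_bound (fun t : R => f (t *: e_ k + p k))
  (fun t : R => partial k f (t *: e_ k + p k))) => t t01; last exact: bf (inB _ t01).
apply/is_derive_lineP; apply: derivableP; exact: df (inB _ t01).
Qed.

End calculus.

(** * The Euclidean inner product *)

Section euclidean.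
Variables (R : realType) (N : nat).
Implicit Types (x y z v w nu : 'rV[R]_N).

Local Notation e_ i := (delta_mx (0 : 'I_1) i : 'rV[R]_N).

Lemma dotC v w : dot v w = dot w v.
Proof. by apply: eq_bigr => i _; rewrite mulrC. Qed.

Lemma dotDl v w z : dot (v + w) z = dot v z + dot w z.
Proof. by rewrite -big_split; apply: eq_bigr => i _; rewrite mxE mulrDl. Qed.

Lemma dotZl (k : R) v w : dot (k *: v) w = k * dot v w.
Proof. by rewrite mulr_sumr; apply: eq_bigr => i _; rewrite mxE mulrA. Qed.

Lemma dotNl v w : dot (- v) w = - dot v w.
Proof. by rewrite -scaleN1r dotZl mulN1r. Qed.

Lemma dotBl v w z : dot (v - w) z = dot v z - dot w z.
Proof. by rewrite dotDl dotNl. Qed.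

Lemma dotDr v w z : dot z (v + w) = dot z v + dot z w.
Proof. by rewrite dotC dotDl !(dotC _ z). Qed.

Lemma dotZr (k : R) v w : dot w (k *: v) = k * dot w v.
Proof. by rewrite dotC dotZl dotC. Qed.

Lemma dotNr v w : dot v (- w) = - dot v w.
Proof. by rewrite dotC dotNl dotC. Qed.

Lemma dotBr v w z : dot z (v - w) = dot z v - dot z w.
Proof. by rewrite dotDr dotNr. Qed.

Definition dotE := (dotDl, dotDr, dotBl, dotBr, dotNl, dotNr, dotZl, dotZr).

Lemma dot0l v : dot 0 v = 0.
Proof. by rewrite -(scale0r v) dotZl mul0r. Qed.

Lemma dot_ge0 v : 0 <= dot v v.
Proof. by apply: sumr_ge0 => i _; rewrite -expr2 sqr_ge0. Qed.

Lemma dot_coord_le v i : (v 0 i) ^+ 2 <= dot v v.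
Proof.
rewrite /dot (bigD1 i)//= -expr2 lerDl; apply: sumr_ge0 => j _.
by rewrite -expr2 sqr_ge0.
Qed.

Lemma dot_eq0 v : dot v v = 0 -> v = 0.
Proof.
move=> v0; apply/rowP => i; rewrite mxE; apply/eqP.
by rewrite -sqrf_eq0 eq_le sqr_ge0 -v0 dot_coord_le.
Qed.

Lemma dot_gt0 v : v != 0 -> 0 < dot v v.
Proof. by rewrite lt_def dot_ge0 andbT; apply: contra => /eqP/dot_eq0 ->. Qed.

Lemma enorm_sqr v : enorm v ^+ 2 = dot v v.
Proof. by rewrite sqr_sqrtr// dot_ge0. Qed.

Lemma enorm_ge0 v : 0 <= enorm v. Proof. exact: sqrtr_ge0. Qed.

Lemma eballE x0 (r : R) x : 0 < r -> eball x0 r x <-> dot (x - x0) (x - x0) < r ^+ 2.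
Proof.
by move=> r0; rewrite /eball/= -enorm_sqr ltr_pXn2r ?nnegrE ?enorm_ge0 ?ltW.
Qed.

Lemma dot_delta v i : dot v (e_ i) = v 0 i.
Proof.
rewrite /dot (bigD1 i)//= mxE !eqxx mulr1 big1 ?addr0// => j ji.
by rewrite mxE eqxx/= (negbTE ji) mulr0.
Qed.

Lemma cvg_sum_ord (T : Type) (F : set_system T) (FF : Filter F) n
    (f : 'I_n -> T -> R) (l : 'I_n -> R) :
  (forall i, f i t @[t --> F] --> l i) ->
  \sum_i f i t @[t --> F] --> \sum_i l i.
Proof.
elim: n f l => [|n IH] f l fl.
  rewrite big_ord0; under eq_fun do rewrite big_ord0; exact: cvg_cst.
rewrite big_ord_recl; under eq_fun do rewrite big_ord_recl.
by apply: cvgD; [exact: fl|apply: IH => i; exact: fl].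
Qed.

Lemma continuous_sum_ord (T : topologicalType) n (f : 'I_n -> T -> R) (t : T) :
  (forall i, {for t, continuous (f i)}) ->
  {for t, continuous (fun s => \sum_i f i s)}.
Proof. by move=> cf; apply: cvg_sum_ord. Qed.

Lemma continuous_dot (T : topologicalType) (f g : T -> 'rV[R]_N) (t : T) :
  (forall i, {for t, continuous (fun s => f s 0 i)}) ->
  (forall i, {for t, continuous (fun s => g s 0 i)}) ->
  {for t, continuous (fun s => dot (f s) (g s))}.
Proof.
by move=> cf cg; apply: continuous_sum_ord => i; apply: continuousM; auto.
Qed.

(** This identifies normals: a vector whose product with every direction of an open half-space is
    nonpositive has no tangential part. *)
Lemma halfspace_parallel nu z : dot nu nu = 1 ->
  (forall w, dot w nu < 0 -> dot w z <= 0) ->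
  z = dot z nu *: nu /\ 0 <= dot z nu.
Proof.
move=> nu1 h; split; last first.
  have := h (- nu); rewrite !dotE nu1 (dotC nu z) => h1; have := h1 (ltrN10 R); lra.
apply/eqP; rewrite -subr_eq0; apply/eqP.
have [z' z'E] : exists z', z' = z - dot z nu *: nu by eexists.
rewrite -z'E; apply: dot_eq0.
have z'nu : dot z' nu = 0 by rewrite z'E !dotE nu1 mulr1 subrr.
have z'z : dot z' z' = dot z' z by rewrite {2}z'E !dotE z'nu mulr0 subr0.
apply/eqP; rewrite eq_le dot_ge0 andbT.
apply/ler_addgt0Pl => e e0.
have D0 : 0 < 1 + `|dot nu z| by rewrite ltr_pwDl.
(* The tangential part [z'] lies only on the edge of the half-space, so it is tilted inwards; the
   tilt is scaled to change the product with [z] by at most [e]. *)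
have := h (z' - (e / (1 + `|dot nu z|)) *: nu).
rewrite !dotE z'nu nu1 mulr1 sub0r oppr_lt0 -z'z divr_gt0// => /(_ isT).
rewrite subr_le0 => /le_trans; rewrite addr0; apply.
rewrite -mulrA ler_piMr ?ltW//.
by rewrite ltr_pdivrMl// mulr1 (le_lt_trans (ler_norm _))// ltrDr.
Qed.

End euclidean.

(** * First-order expansions of C^1 functions *)

Section C1.
Variables (R : realType) (N : nat).
Implicit Types (f : 'rV[R]_N -> R) (x y z v w nu : 'rV[R]_N) (V Omega : set 'rV[R]_N).

Local Notation e_ i := (delta_mx (0 : 'I_1) i : 'rV[R]_N).

(** Continuity of the partial derivatives at the single point [x] already gives strict
    differentiability there. *)
Definition C1_at f x : Prop :=
  (\forall z \near x, forall i, derivable f z (e_ i)) /\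
  forall i, {for x, continuous (partial i f)}.

Lemma near_ball_rV x (P : set 'rV[R]_N) :
  (\forall z \near x, P z) -> exists2 r : R, 0 < r & forall z, ball x r z -> P z.
Proof. by move=> /nbhs_ballP[r /= r0 h]; exists r. Qed.

(** Strict differentiability: both end points vary while the gradient is frozen at [x]. Second
    differences and dilation quotients move both ends, so an expansion based at [x] would not do. *)
Lemma C1_expansion f x (eps : R) : C1_at f x -> 0 < eps ->
  exists2 r : R, 0 < r & forall y z, ball x r y -> ball x r z ->
    `|f z - f y - dot (grad f x) (z - y)| <= eps * \sum_i `|z 0 i - y 0 i|.
Proof.
move=> [df cf] e0.
have near_df : \forall z \near x, forall i,
    derivable f z (e_ i) /\ `|partial i f z - partial i f x| <= eps.
  apply: (@filter_forall _ 'I_N (fun i z => derivable f z (e_ i) /\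
    `|partial i f z - partial i f x| <= eps) (nbhs x) (nbhs_filter x)) => i.
  have /cvgr_dist_le/(_ _ e0) ci := cf i.
  by apply: filterS2 df ci => z dz; rewrite distrC.
have [r r0 hr] := near_ball_rV near_df; exists r => // y z yB zB.
apply: (@box_mean_value _ _ f x r) => // w i /hr/(_ i)[]//.
by rewrite mxE.
Qed.

Lemma C2_on_C1_at V f x : open V -> C2_on V f -> V x -> C1_at f x.
Proof.
move=> oV [_ h] Vx; split; last by move=> i; have [_ [+ _]] := h i; apply; rewrite inE.
have : \forall z \near x, V z by exact: open_nbhs_nbhs.
by apply: filterS => z Vz i; have [+ _] := h i; exact.
Qed.

Lemma C2_on_C1_at_partial V f x i :
  open V -> C2_on V f -> V x -> C1_at (partial i f) x.
Proof.
move=> oV [_ h] Vx; have {h}[_ [_ h]] := h i; split.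
  have : \forall z \near x, V z by exact: open_nbhs_nbhs.
  by apply: filterS => z Vz j; have [+ _] := h j; exact.
by move=> j; have [_] := h j; apply; rewrite inE.
Qed.

Lemma sum_abs_scale (t : R) w :
  \sum_i `|(t *: w) 0 i| = `|t| * \sum_i `|w 0 i|.
Proof. by rewrite mulr_sumr; apply: eq_bigr => i _; rewrite mxE normrM. Qed.

Lemma near_line x w (P : set 'rV[R]_N) : (\forall z \near x, P z) ->
  exists2 d : R, 0 < d & forall t : R, `|t| < d -> P (t *: w + x).
Proof.
have : {for (0 : R), continuous (fun t : R => t *: w + x)}.
  apply: cvgD; last exact: cvg_cst.
  exact: scalel_continuous.
move=> c Px; have : \forall t \near (0 : R), P (t *: w + x).
  by apply: c; rewrite /= scale0r add0r.
move=> /nbhs_ballP[d /= d0 h]; exists d => // t td.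
by apply: h; rewrite /ball/= sub0r normrN.
Qed.

Lemma C1_is_derive f x w : C1_at f x -> is_derive x w f (dot (grad f x) w).
Proof.
move=> fC1.
suff cvgq : t^-1 *: (f (t *: w + x) - f x) @[t --> (0 : R)^'] -->
    dot (grad f x) w.
  by split; [exact: cvgP cvgq|exact: cvg_lim cvgq].
apply/cvgrPdist_le => eps eps0.
set S := \sum_i `|w 0 i|; have S0 : 0 <= S by exact: sumr_ge0.
have e0 : 0 < eps / (1 + S) by rewrite divr_gt0// ltr_pwDl.
have [r r0 hr] := C1_expansion fC1 e0.
have [d d0 hd] := near_line w (nbhsx_ballx x r r0).
near=> t.
have t0 : t != 0 by near: t; exact: nbhs_dnbhs_neq.
have td : `|t| < d by near: t; apply: dnbhs0_lt.
have := hr x (t *: w + x) (ballxx x r0) (hd _ td).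
rewrite addrK dotZr -/(_ 0 _).
under eq_bigr => i _ do rewrite mxE addrK.
rewrite sum_abs_scale -/S => h.
rewrite distrC -[X in _ - X](mulKf t0) -[_ *: _]/(_ * _) -mulrBr normrM normfV.
rewrite ler_pdivrMl ?normr_gt0//; apply: le_trans h _.
rewrite mulrCA ler_wpM2l// mulrAC -mulrA ler_piMr ?ltW//.
by rewrite ltr_pdivrMr ?ltr_pwDl// mul1r ltrDr.
Unshelve. all: by end_near. Qed.

Lemma C1_continuous f x : C1_at f x -> {for x, continuous f}.
Proof.
move=> fC1; suff : f y @[y --> x] --> f x by [].
apply/(@cvgrPdist_le _ _ _ (nbhs x) (nbhs_filter x)) => eps eps0.
set L := \sum_i `|partial i f x|.
have [r r0 hr] := C1_expansion fC1 ltr01.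
have D0 : 0 < 1 + N%:R * (1 + L) :> R.
  by rewrite ltr_pwDl// mulr_ge0// addr_ge0// sumr_ge0.
have D1 : 0 < eps / (1 + N%:R * (1 + L)) by exact: divr_gt0.
apply: filterS2 (nbhsx_ballx x r r0) (nbhsx_ballx x _ D1) => y yB yB'.
have := hr x y (ballxx x r0) yB.
rewrite mul1r => h; rewrite distrC.
have -> : f y - f x = (f y - f x - dot (grad f x) (y - x)) + dot (grad f x) (y - x).
  by rewrite subrK.
apply: le_trans (ler_normD _ _) _; apply: le_trans (lerD h (lexx _)) _.
have hi i : `|y 0 i - x 0 i| <= eps / (1 + N%:R * (1 + L)).
  by rewrite distrC ltW//; have := (ball_rVP x y D1).1 yB' i.
have h1 : \sum_i `|y 0 i - x 0 i| <= N%:R * (eps / (1 + N%:R * (1 + L))).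
  apply: (@le_trans _ _ (\sum_(i < N) eps / (1 + N%:R * (1 + L)))).
    by apply: ler_sum => i _; exact: hi.
  by rewrite sumr_const card_ord [leRHS]mulr_natl.
have h2 : `|dot (grad f x) (y - x)| <=
    N%:R * (L * (eps / (1 + N%:R * (1 + L)))).
  rewrite /dot; apply: le_trans (ler_norm_sum _ _ _) _.
  apply: le_trans (_ : \sum_(i < N) L * (eps / (1 + N%:R * (1 + L))) <= _);
    last by rewrite sumr_const card_ord [leRHS]mulr_natl.
  apply: ler_sum => i _; rewrite !mxE normrM ler_pM// /L (bigD1 i)//= lerDl.
  exact: sumr_ge0.
apply: le_trans (lerD h1 h2) _.
have := divfK (lt0r_neq0 D0) eps; have := ltW D1.
set E := eps / _ => E0 ED; rewrite -[leRHS]ED; nra.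
Qed.

End C1.

(** * Symmetry of second derivatives *)

Section schwarz.
Variables (R : realType) (N : nat).
Implicit Types (f : 'rV[R]_N -> R) (x y z v w nu : 'rV[R]_N) (V Omega : set 'rV[R]_N).

Local Notation e_ i := (delta_mx (0 : 'I_1) i : 'rV[R]_N).

Lemma open_near V x : open V -> V x -> \forall z \near x, V z.
Proof. by move=> oV Vx; apply: open_nbhs_nbhs. Qed.

Lemma sum_abs_delta i : \sum_k `|(e_ i) 0 k| = 1 :> R.
Proof.
rewrite (bigD1 i)//= mxE !eqxx normr1 big1 ?addr0// => j ji.
by rewrite mxE (negbTE ji) andbF normr0.
Qed.

Lemma ball_two_steps x i j (r s t : R) : `|s| < r / 2 -> `|t| < r / 2 ->
  ball x r (s *: e_ i + (t *: e_ j + x)).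
Proof.
move=> sr tr; have r0 : 0 < r by have := le_lt_trans (normr_ge0 s) sr; lra.
apply/(ball_rVP _ _ r0) => k; rewrite !mxE eqxx/=.
set a := ((k == i)%:R : R); set b := ((k == j)%:R : R).
have -> : x 0 k - (s * a + (t * b + x 0 k)) = - (s * a) - t * b by ring.
apply: le_lt_trans (ler_normB _ _) _; rewrite normrN !normrM.
have a1 : `|a| <= 1 by rewrite /a; case: (_ == _); rewrite ?normr1 ?normr0.
have b1 : `|b| <= 1 by rewrite /b; case: (_ == _); rewrite ?normr1 ?normr0.
have := ler_wpM2l (normr_ge0 s) a1; have := ler_wpM2l (normr_ge0 t) b1; lra.
Qed.

(** The mean value theorem in direction [i] is applied to an increment in direction [j]; the
    derivative of that increment is then controlled by the expansion of [partial i f]. *)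
Lemma second_difference V f x i j (eps : R) :
  open V -> C2_on V f -> V x -> 0 < eps ->
  exists2 r : R, 0 < r & forall s : R, `|s| < r ->
    `|f (s *: e_ i + (s *: e_ j + x)) - f (s *: e_ i + x) - f (s *: e_ j + x)
      + f x - partial j (partial i f) x * s ^+ 2| <= eps * s ^+ 2.
Proof.
move=> oV C2 Vx e0.
have [r1 r10 h1] := C1_expansion (C2_on_C1_at_partial i oV C2 Vx) e0.
have [r2 r20 h2] := near_ball_rV (open_near oV Vx).
have r0 : 0 < Num.min r1 r2 by rewrite lt_min r10.
have rr1 : Num.min r1 r2 <= r1 by rewrite ge_min lexx.
have rr2 : Num.min r1 r2 <= r2 by rewrite ge_min lexx orbT.
exists (Num.min r1 r2 / 2) => [|s sr]; first by rewrite divr_gt0.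
have ts (t : R) : 0 <= t <= 1 -> `|t * s| < Num.min r1 r2 / 2.
  move=> /andP[t0 t1]; apply: le_lt_trans sr.
  by rewrite normrM ger0_norm// ler_piMl.
have zr : `|0 : R| < Num.min r1 r2 / 2 by rewrite normr0 divr_gt0.
have inB (t : R) k : `|t| < Num.min r1 r2 / 2 -> k = s \/ k = 0 ->
    ball x (Num.min r1 r2) (t *: e_ i + (k *: e_ j + x)).
  by move=> tr [] ->; apply: ball_two_steps.
have inV (t : R) k : `|t| < Num.min r1 r2 / 2 -> k = s \/ k = 0 ->
    V (t *: e_ i + (k *: e_ j + x)).
  by move=> tr kk; apply: h2; apply: le_ball (inB _ _ tr kk).
have inB1 (t : R) k : `|t| < Num.min r1 r2 / 2 -> k = s \/ k = 0 ->
    ball x r1 (t *: e_ i + (k *: e_ j + x)).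
  by move=> tr kk; apply: le_ball (inB _ _ tr kk).
set D := partial j (partial i f) x.
have key : `|(f (s *: e_ i + (s *: e_ j + x)) - f (s *: e_ i + (0 *: e_ j + x)))
    - (f (0 *: e_ i + (s *: e_ j + x)) - f (0 *: e_ i + (0 *: e_ j + x)))
    - (s * D) * s| <= (eps * `|s|) * `|s|.
  apply: (@mean_value_bound R
    (fun t : R => f (t *: e_ i + (s *: e_ j + x)) - f (t *: e_ i + (0 *: e_ j + x)))
    (fun t : R => partial i f (t *: e_ i + (s *: e_ j + x)) -
                partial i f (t *: e_ i + (0 *: e_ j + x)))) => t t01.
    apply: is_deriveB; apply/is_derive_lineP/derivableP;
      by have [_ /(_ i)[+ _]] := C2; apply; apply: inV; auto.
  have := h1 _ _ (inB1 (t * s) 0 (ts _ t01) (or_intror erefl))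
    (inB1 (t * s) s (ts _ t01) (or_introl erefl)).
  have -> : (t * s) *: e_ i + (s *: e_ j + x) - ((t * s) *: e_ i + (0 *: e_ j + x))
     = s *: e_ j by rewrite scale0r add0r opprD addrACA subrr add0r addrK.
  rewrite dotZr dot_delta mxE => /le_trans; apply.
  rewrite le_eqVlt; apply/orP; left; apply/eqP.
  rewrite -[in RHS](mulr1 `|s|) -(sum_abs_delta j) -sum_abs_scale; congr (_ * _).
  apply: eq_bigr => k _; congr `|_|; rewrite !mxE; ring.
move: key; rewrite !scale0r !add0r -[leRHS]mulrA -normrM -expr2 ger0_norm ?sqr_ge0//.
move=> /(le_trans _); apply.
rewrite le_eqVlt; apply/orP; left; apply/eqP; congr `|_|; ring.
Qed.

(** Both mixed derivatives are limits of one second difference, which is symmetric in [i] and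
    [j]. *)
Lemma partialC V f x i j : open V -> C2_on V f -> V x ->
  partial j (partial i f) x = partial i (partial j f) x.
Proof.
move=> oV C2 Vx; apply/eqP; rewrite -subr_eq0 -normr_le0.
apply/ler_addgt0Pr => e e0; rewrite add0r.
have e20 : 0 < e / 2 by rewrite divr_gt0.
have [r1 r10 h1] := second_difference i j oV C2 Vx e20.
have [r2 r20 h2] := second_difference j i oV C2 Vx e20.
have r0 : 0 < Num.min r1 r2 by rewrite lt_min r10.
pose s := Num.min r1 r2 / 2.
have s0 : 0 < s by rewrite divr_gt0.
have sr1 : `|s| < r1.
  rewrite gtr0_norm// /s; have : Num.min r1 r2 <= r1 by rewrite ge_min lexx.
  lra.
have sr2 : `|s| < r2.
  rewrite gtr0_norm// /s.
  have : Num.min r1 r2 <= r2 by rewrite ge_min lexx orbT.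
  lra.
have := h1 s sr1; have := h2 s sr2.
rewrite (_ : s *: e_ j + (s *: e_ i + x) = s *: e_ i + (s *: e_ j + x)); last first.
  by rewrite addrCA.
set a := f _; set b := f _; set c := f _; set d := f _.
set D1 := partial i _ _; set D2 := partial j _ _ => H2 H1. clearbody a b c d D1 D2.
rewrite -(ler_pM2r (exprn_gt0 2 s0)) -[X in _ * X]ger0_norm ?sqr_ge0// -normrM.
rewrite (_ : (D2 - D1) * s ^+ 2 = (a - b - c + d - D1 * s ^+ 2) -
  (a - c - b + d - D2 * s ^+ 2)); last by ring.
apply: le_trans (ler_normB _ _) _; lra.
Qed.



End schwarz.

(** * The maximum principle *)

Section max_principle.
Variables (R : realType) (N : nat).
Implicit Types (f g : 'rV[R]_N -> R) (x y z v w p : 'rV[R]_N) (V : set 'rV[R]_N).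

Local Notation e_ i := (delta_mx (0 : 'I_1) i : 'rV[R]_N).

(** A relational Laplacian: the second derivatives are required only at [x], and sums, multiples and
    affine substitutions act on the witnesses without any computation of [partial]. *)
Definition has_laplacian f x (l : R) : Prop :=
  exists (F : 'I_N -> 'rV[R]_N -> R) (D : 'I_N -> R),
    [/\ \forall z \near x, forall i, is_derive z (e_ i) f (F i z),
        forall i, is_derive x (e_ i) (F i) (D i)
      & l = \sum_i D i].

Lemma near_rVW x (P : set 'rV[R]_N) : (forall z, P z) -> \forall z \near x, P z.
Proof. by move=> h; apply: filterS (open_near openT I) => z _. Qed.

Lemma C2_on_has_laplacian V f x : open V -> C2_on V f -> V x ->
  has_laplacian f x (laplacian f x).
Proof.
move=> oV [_ h] Vx.
exists (fun i => partial i f), (fun i => partial i (partial i f) x); split=> //.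
  apply: filterS (open_near oV Vx) => z Vz i; apply: derivableP.
  by have [+ _] := h i; apply.
by move=> i; apply: derivableP; have [_ [_ /(_ i)[+ _]]] := h i; apply.
Qed.

Lemma has_laplacianD f g x l m : has_laplacian f x l -> has_laplacian g x m ->
  has_laplacian (fun z => f z + g z) x (l + m).
Proof.
move=> [F [D [nF dF ->]]] [G [E [nG dG ->]]].
exists (fun i z => F i z + G i z), (fun i => D i + E i); split.
- by apply: filterS2 nF nG => z zF zG i; apply: is_deriveD.
- by move=> i; apply: is_deriveD.
- by rewrite big_split.
Qed.

Lemma has_laplacianZ (k : R) f x l : has_laplacian f x l ->
  has_laplacian (fun z => k * f z) x (k * l).
Proof.
move=> [F [D [nF dF ->]]].
exists (fun i z => k * F i z), (fun i => k * D i); split.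
- by apply: filterS nF => z zF i; apply: is_deriveZ.
- by move=> i; apply: is_deriveZ.
- by rewrite mulr_sumr.
Qed.

Lemma has_laplacian_cst (k : R) x : has_laplacian (fun=> k) x 0.
Proof.
exists (fun _ _ => 0), (fun=> 0); split.
- by apply: near_rVW => z i; apply: is_derive_cst.
- by move=> i; apply: is_derive_cst.
- by rewrite big1.
Qed.

Lemma continuous_affine (a : R) p x : {for x, continuous (fun z => a *: z + p)}.
Proof.
apply: (@continuousD _ _ _ (fun z => a *: z) (cst p) x).
  exact: scaler_continuous.
exact: cst_continuous.
Qed.

Lemma is_derive_affine f (a : R) p x v (d : R) : is_derive (a *: x + p) v f d ->
  is_derive x v (fun y => f (a *: y + p)) (a * d).
Proof.
move=> /is_derive_line0P df; apply/is_derive_line0P.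
have -> : (fun t : R => f (a *: (t *: v + x) + p)) =
    (fun s : R => f (s *: v + (a *: x + p))) \o (a \*: (id : R -> R)).
  by apply/funext => t /=; rewrite scalerDr scalerA addrA.
rewrite mulrC; apply: is_derive1_comp; first by rewrite /= scaler0.
rewrite -[X in is_derive _ _ _ X]mulr1; exact: is_deriveZ.
Qed.

Lemma has_laplacian_affine f (a : R) p x l : has_laplacian f (a *: x + p) l ->
  has_laplacian (fun y => f (a *: y + p)) x (a ^+ 2 * l).
Proof.
move=> [F [D [nF dF ->]]].
exists (fun i z => a * F i (a *: z + p)), (fun i => a * (a * D i)); split.
- have nF' : \forall z \near x,
      forall i, is_derive (a *: z + p) (e_ i) f (F i (a *: z + p)) :=
    @continuous_affine a p x _ nF.
  by apply: filterS nF' => z zF i; exact: is_derive_affine.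
- by move=> i; apply: is_deriveZ; apply: is_derive_affine.
- by rewrite mulr_sumr; apply: eq_bigr => i _; rewrite expr2 mulrA.
Qed.

(** Every polynomial differentiated in this development is at most quadratic along lines, so its
    derivative can be read off as a coefficient. *)
Lemma is_derive_quadratic f x v (a b c : R) :
  (forall t : R, f (t *: v + x) = a * t ^+ 2 + b * t + c) -> is_derive x v f b.
Proof.
move=> fE; apply/is_derive_line0P.
have -> : (fun t : R => f (t *: v + x)) =
    (a \*: ((id : R -> R) ^+ 2)) + (b \*: (id : R -> R)) + cst c.
  by apply/funext => t; rewrite fE.
apply: is_derive_eq; rewrite /= expr1 !(mulr0, scaler0, scale0r, add0r, addr0).
exact: mulr1.
Qed.

Lemma is_derive_dot p x v : is_derive x v (dot p) (dot p v).
Proof.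
by apply: (@is_derive_quadratic _ _ _ 0 _ (dot p x)) => t; rewrite !dotE; ring.
Qed.

Lemma is_derive_sqdist p x v :
  is_derive x v (fun y => dot (y - p) (y - p)) (2 * dot (x - p) v).
Proof.
apply: (@is_derive_quadratic _ _ _ (dot v v) _ (dot (x - p) (x - p))) => t.
by rewrite -addrA !dotE (dotC v) (dotC v p) (dotC p x); ring.
Qed.

Lemma has_laplacian_sqdist p x :
  has_laplacian (fun y => dot (y - p) (y - p)) x (2 * N%:R).
Proof.
exists (fun i z => 2 * dot (z - p) (e_ i)), (fun i => 2); split.
- by apply: near_rVW => z i; exact: is_derive_sqdist.
- move=> i; apply: (@is_derive_quadratic _ _ _ 0 _ (2 * dot (x - p) (e_ i))) => t.
  by rewrite -addrA !dotE (dot_delta (e_ i)) mxE !eqxx /=; ring.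
- by rewrite sumr_const card_ord mulr_natr.
Qed.

Lemma has_laplacian_sqdot m p x :
  has_laplacian (fun y => dot m (y - p) ^+ 2) x (2 * dot m m).
Proof.
exists (fun i z => 2 * dot m (z - p) * dot m (e_ i)),
  (fun i => 2 * dot m (e_ i) ^+ 2); split.
- apply: near_rVW => z i.
  apply: (@is_derive_quadratic _ _ _ (dot m (e_ i) ^+ 2) _ (dot m (z - p) ^+ 2)) => t.
  by rewrite -addrA !dotE; ring.
- move=> i; apply: (@is_derive_quadratic _ _ _ 0 _
    (2 * dot m (x - p) * dot m (e_ i))) => t.
  by rewrite -addrA !dotE; ring.
- by rewrite mulr_sumr; apply: eq_bigr => i _; rewrite dot_delta expr2.
Qed.

(** At a maximum [dg 0 = 0]. If [D] were positive, [dg] would be positive just to the right of 0 and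
    [g] would increase strictly there. Only [dg] has to be differentiable, and only at 0. *)
Lemma second_derivative_le0 (g dg : R -> R) (D : R) :
  (\forall t \near (0 : R), is_derive t (1 : R) g (dg t)) ->
  is_derive (0 : R) (1 : R) dg D -> (\forall t \near (0 : R), g t <= g 0) -> D <= 0.
Proof.
move=> ndg dD nmax; rewrite leNgt; apply/negP => D0.
have dg0 : dg 0 = 0.
  have [r /= r0 hr] : exists2 r : R, 0 < r & forall t, ball (0 : R) r t ->
      is_derive t (1 : R) g (dg t) /\ g t <= g 0.
    have : \forall t \near (0 : R), is_derive t (1 : R) g (dg t) /\ g t <= g 0.
      by apply: filterS2 ndg nmax.
    by move=> /nbhs_ballP[r r0 h]; exists r.
  have B t : t \in `](- r), r[%R -> ball (0 : R) r t.
    by rewrite in_itv/= /ball/= sub0r normrN ltr_norml.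
  have hd := @derive1_at_max R g (- r) r 0 _ _ _ _.
  have [_ <-] : is_derive (0 : R) (1 : R) g (dg 0) by apply hr; exact: ballxx.
  have [||||_ ->//] := hd.
  - by rewrite ltW// gtrN.
  - by move=> t /B/hr[[]].
  - by rewrite in_itv/= oppr_lt0 r0.
  - by move=> t /B/hr[].
have [dgd dgE] := dD.
have cq : (fun t : R => t^-1 *: (dg (t *: 1 + 0) - dg 0)) @ (0 : R)^' --> D.
  by rewrite -dgE; exact: dgd.
have /cvgr_gt/(_ _ D0) posq := cq.
have : \forall t \near (0 : R), t != 0 ->
    0 < t^-1 * dg t /\ is_derive t (1 : R) g (dg t) /\ g t <= g 0.
  have : \forall t \near (0 : R), t != 0 -> 0 < t^-1 * dg t.
    have posq' : \forall t \near (0 : R), t != 0 ->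
      0 < t^-1 *: (dg (t *: 1 + 0) - dg 0) := posq.
    apply: filterS posq' => t h t0; have := h t0.
    by rewrite dg0 subr0 addr0 [_%:A]mulr1.
  by move=> nq; apply: filterS3 nq ndg nmax => t h1 h2 h3 t0; split; [exact: h1|].
move=> /nbhs_ballP[r /= r0 hr].
have B t : 0 < t < r -> ball (0 : R) r t /\ t != 0.
  by move=> /andP[t0 tr]; rewrite /ball/= sub0r normrN gtr0_norm// gt_eqF.
have r20 : 0 < r / 2 by rewrite divr_gt0.
have rr : r / 2 < r by rewrite ltr_pdivrMr// ltr_pMr// ltr1n.
have dgt t : 0 <= t < r -> is_derive t (1 : R) g (dg t).
  move=> /andP[]; rewrite le_eqVlt => /predU1P[<- _|t0 tr].
    exact: nbhs_singleton ndg.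
  have /B[b tn0] : 0 < t < r by rewrite t0.
  by have [_ []] := hr t b tn0.
have [||c] := @MVT R g dg 0 (r / 2) r20.
- move=> t; rewrite in_itv/= => /andP[t0 tr]; apply: dgt.
  by rewrite ltW//= (lt_trans tr).
- apply: derivable_within_continuous => t; rewrite in_itv/= => /andP[t0 tr].
  by case: (dgt t) => //; rewrite t0/= (le_lt_trans tr).
rewrite in_itv/= => /andP[c0 cr] E.
have /B[b b0] : 0 < r / 2 < r by rewrite r20.
have [_ [_]] := hr _ b b0; rewrite -subr_le0 E subr0 leNgt => /negP; apply.
have /B[b' c0'] : 0 < c < r by rewrite c0 (lt_trans cr).
rewrite mulr_gt0//.
by have [+ _] := hr c b' c0'; rewrite pmulr_rgt0// invr_gt0.
Qed.

Lemma laplacian_at_max f x l :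
  has_laplacian f x l -> (\forall z \near x, f z <= f x) -> l <= 0.
Proof.
move=> [F [D [nF dF ->]]] nmax; apply: sumr_le0 => i _.
apply: (@second_derivative_le0 (fun t : R => f (t *: e_ i + x))
  (fun t : R => F i (t *: e_ i + x))); last 2 first.
- exact/is_derive_line0P.
- rewrite scale0r add0r; have [d d0 hd] := near_line (e_ i) nmax.
  apply/nbhs_ballP; exists d => // t; rewrite /ball/= sub0r normrN; exact: hd.
have [d d0 hd] := near_line (e_ i) nF.
apply/nbhs_ballP; exists d => // t; rewrite /ball/= sub0r normrN => /hd/(_ i) h.
exact/is_derive_lineP.
Qed.

Lemma compact_dot_bounded (K : set 'rV[R]_N) : compact K ->
  exists2 B : R, 0 < B & forall x, K x -> dot x x <= B.
Proof.
move=> /compact_bounded/ex_strict_bound_gt0[b b0 hb].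
exists (N%:R * b ^+ 2 + 1) => [|x Kx].
  by rewrite ltr_wpDl// mulr_ge0// sqr_ge0.
apply: (@le_trans _ _ (N%:R * b ^+ 2)); last by rewrite lerDl.
rewrite /dot; apply: (@le_trans _ _ (\sum_(i < N) b ^+ 2)); last first.
  by rewrite sumr_const card_ord [leRHS]mulr_natl.
apply: ler_sum => i _; rewrite -expr2 -[x 0 i ^+ 2]real_normK ?num_real//.
rewrite ler_pXn2r ?nnegrE ?(ltW b0)//; apply: ltW; apply: le_lt_trans (hb _ Kx).
by rewrite /Num.Def.normr/= mx_normrE; apply/bigmax_geP; right => /=; exists (0, i).
Qed.

(** A small multiple of |x|^2 makes the Laplacian strictly positive, which excludes an interior
    maximum. The alternative is posed point by point, so no description of the boundary of [K] is
    needed. *)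
Lemma maximum_principle (K : set 'rV[R]_N) f (M : R) : (0 < N)%N ->
  compact K -> {within K, continuous f} ->
  (forall x, K x -> f x <= M \/
    K° x /\ exists2 l, 0 <= l & has_laplacian f x l) ->
  forall x, K x -> f x <= M.
Proof.
move=> N0 cK cf h x0 Kx0; rewrite leNgt; apply/negP => Mx0.
have [B B0 hB] := compact_dot_bounded cK.
(* With this [e] the perturbation is at most half of the excess [f x0 - M] on [K], so the maximum of
   [g] cannot sit where [f <= M]. *)
pose e := (f x0 - M) / (2 * B).
have e0 : 0 < e by rewrite divr_gt0 ?subr_gt0// mulr_gt0.
have eB : e * B = (f x0 - M) / 2 by rewrite /e; field; rewrite gt_eqF.
pose g x := f x + e * dot (x - 0) (x - 0).
have cg : {within K, continuous g}.
  move=> x; apply: cvgD; first exact: cf.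
  apply: cvgM; first exact: cvg_cst.
  apply: continuous_subspaceT => y; rewrite /continuous_at.
  under eq_fun do rewrite subr0; rewrite subr0.
  by apply: continuous_dot => i; exact: coord_continuous.
have [c cK' maxc] := EVT_max_rV (ex_intro _ _ Kx0) cK cg.
rewrite inE in cK'.
have gc : f x0 <= g c.
  apply: (@le_trans _ _ (g x0)); last by apply: maxc; rewrite inE.
  by rewrite /g lerDl mulr_ge0 ?dot_ge0// ltW.
have [fcM|[cin [l l0 fl]]] := h c cK'.
  have : g c <= M + e * B.
    rewrite /g subr0; apply: lerD => //.
    by apply: ler_wpM2l; [exact: ltW|exact: hB].
  by rewrite eB; lra.
have gl := has_laplacianD fl (has_laplacianZ e (has_laplacian_sqdist 0 c)).
have : l + e * (2 * N%:R) <= 0.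
  apply: laplacian_at_max gl _; apply: filterS cin => z Kz; apply: maxc.
  by rewrite inE.
have N1 : 0 < N%:R :> R by rewrite ltr0n.
have := mulr_gt0 e0 N1; lra.
Qed.

End max_principle.

(** * Harmonic dilation quotients and their limit *)

Section harmonic_dilation.
Variables (R : realType) (N : nat).
Implicit Types (f h : 'rV[R]_N -> R) (x y z v w p : 'rV[R]_N) (V Omega K : set 'rV[R]_N).

Local Notation e_ i := (delta_mx (0 : 'I_1) i : 'rV[R]_N).

(** The value at [y] of the tangent plane of [h] at [x]. It is formally harmonic in [x] when [h] is
    harmonic. *)
Definition euler_mean h y x : R := h x + dot (grad h x) (y - x).

(* As a function of [x], [h ((1 - t) *: x + t *: y)] is again harmonic, so this
   quotient makes the maximum principle available for its limit [euler_mean],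
   which is only C^1. *)
Definition dilation_quotient h y (t : R) x : R :=
  h x + t^-1 * (h ((1 - t) *: x + t *: y) - h x).

Lemma continuous_sum_abs y x :
  {for x, continuous (fun z => \sum_i `|y 0 i - z 0 i|)}.
Proof.
apply: continuous_sum_ord => i.
suff : `|y 0 i - z 0 i| @[z --> x] --> `|y 0 i - x 0 i| by [].
by apply: cvg_norm; apply: cvgB; [exact: cvg_cst|exact: coord_continuous].
Qed.

Lemma continuous_grad_dot h y x : C1_at h x ->
  {for x, continuous (fun z => dot (grad h z) (y - z))}.
Proof.
move=> [_ ch]; apply: continuous_dot => i.
  have -> : (fun z => grad h z 0 i) = partial i h by apply/funext => z; rewrite mxE.
  exact: ch.
have -> : (fun z => (y - z) 0 i) = (fun z => y 0 i - z 0 i).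
  by apply/funext => z; rewrite !mxE.
suff : y 0 i - z 0 i @[z --> x] --> y 0 i - x 0 i by [].
by apply: cvgB; [exact: cvg_cst|exact: coord_continuous].
Qed.

Lemma continuous_dot_sub c y x : {for x, continuous (fun z => dot c (y - z))}.
Proof.
apply: continuous_dot => i; first exact: cst_continuous.
have -> : (fun z => (y - z) 0 i) = (fun z => y 0 i - z 0 i).
  by apply/funext => z; rewrite !mxE.
suff : y 0 i - z 0 i @[z --> x] --> y 0 i - x 0 i by [].
by apply: cvgB; [exact: cvg_cst|exact: coord_continuous].
Qed.

Lemma near_le_of_continuous f x (e : R) : {for x, continuous f} -> 0 < e ->
  \forall z \near x, `|f x - f z| <= e.
Proof. by move=> cf e0; have /cvgrPdist_le/(_ _ e0) := cf. Qed.

(** Convergence is stated jointly in [z] near [x] and [t] near 0 from the right, the form from which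
    compactness extracts a single [t] for all points of [K]. *)
Lemma dilation_quotient_near Omega h y x (eta : R) :
  open Omega -> C2_on Omega h -> Omega x -> 0 < eta ->
  \forall z \near x & t \near (0 : R)^'+,
    Omega ((1 - t) *: z + t *: y) /\
    `|dilation_quotient h y t z - euler_mean h y z| <= eta.
Proof.
move=> oO C2 Ox eta0; have hC1 := C2_on_C1_at oO C2 Ox.
(* The added 1 makes [S] bound the l^1 distance to [y] for all [z] near [x] and keeps it positive.
   The budget [eta] is split into 1/2 for the expansion and 1/4 for each of the two changes of base
   point. *)
set S := \sum_i `|y 0 i - x 0 i| + 1.
have S0 : 0 < S by rewrite ltr_wpDl// sumr_ge0.
have e0 : 0 < eta / 2 / S by rewrite !divr_gt0.
have [r1 r10 h1] := C1_expansion hC1 e0.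
have [r2 r20 h2] := near_ball_rV (open_near oO Ox).
have r0 : 0 < Num.min r1 r2 by rewrite lt_min r10.
have rr1 : Num.min r1 r2 <= r1 by rewrite ge_min lexx.
have rr2 : Num.min r1 r2 <= r2 by rewrite ge_min lexx orbT.
set r := Num.min r1 r2 in r0 rr1 rr2.
have r'0 : 0 < r / 2 by rewrite divr_gt0.
have d0 : 0 < r / 2 / S by rewrite divr_gt0.
have eta20 : 0 < eta / 2 / 2 by rewrite !divr_gt0.
have nS := near_le_of_continuous (@continuous_sum_abs y x) ltr01.
have nG := near_le_of_continuous (@continuous_grad_dot h y x hC1) eta20.
have nL := near_le_of_continuous (@continuous_dot_sub (grad h x) y x) eta20.
exists ([set z | [/\ ball x (r / 2) z,
    `|\sum_i `|y 0 i - x 0 i| - \sum_i `|y 0 i - z 0 i| | <= 1,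
    `|dot (grad h x) (y - x) - dot (grad h z) (y - z)| <= eta / 2 / 2
  & `|dot (grad h x) (y - x) - dot (grad h x) (y - z)| <= eta / 2 / 2]],
  [set t : R | 0 < t < r / 2 / S]) => /=.
  split; first apply: filterS2 (filterI (nbhsx_ballx x _ r'0) nS) (filterI nG nL).
    by move=> z [? ?] [? ?].
  by apply: filterS2 (nbhs_right_gt 0) (nbhs_right_lt d0) => t /= -> ->.
move=> [z t] /= [[zB zS zG zL] /andP[t0 td]].
have zSS : \sum_i `|y 0 i - z 0 i| <= S.
  move: zS; rewrite ler_norml /S; set s1 := \sum_i _; set s2 := \sum_i _.
  clearbody s1 s2; lra.
have tS : t * S < r / 2 by rewrite -ltr_pdivlMr.
have zr : ball x r z by apply: le_ball zB; lra.
have wB : ball x r ((1 - t) *: z + t *: y).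
  apply/(ball_rVP _ _ r0) => i; rewrite !mxE.
  have -> : x 0 i - ((1 - t) * z 0 i + t * y 0 i) =
    (x 0 i - z 0 i) - t * (y 0 i - z 0 i) by ring.
  apply: le_lt_trans (ler_normB _ _) _; rewrite normrM (gtr0_norm t0).
  have zi := (ball_rVP _ _ r'0).1 zB i.
  have : t * `|y 0 i - z 0 i| <= t * S.
    apply: ler_wpM2l; first exact: ltW.
    apply: le_trans zSS; rewrite (bigD1 i)//= lerDl; exact: sumr_ge0.
  by move: zi; lra.
split; first by apply: h2; apply: le_ball wB.
have /= := h1 z _ (le_ball rr1 zr) (le_ball rr1 wB).
have -> : (1 - t) *: z + t *: y - z = t *: (y - z).
  by rewrite scalerBl scale1r scalerBr addrAC [z - _]addrC addrK addrC.
have -> : \sum_i `|((1 - t) *: z + t *: y) 0 i - z 0 i| =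
    t * \sum_i `|y 0 i - z 0 i|.
  rewrite mulr_sumr; apply: eq_bigr => i _.
  by rewrite -[t in RHS]gtr0_norm// -normrM !mxE; congr `|_|; ring.
rewrite dotZr /dilation_quotient /euler_mean.
move: zG zL zSS; set hw := h (_ + _); set hz := h z.
set G0 := dot _ (y - x); set G1 := dot _ (y - z); set G2 := dot _ (y - z).
set s := \sum_i _; clearbody hw hz G0 G1 G2 s => zG zL sS hexp.
have -> : hz + t^-1 * (hw - hz) - (hz + G2) =
  t^-1 * (hw - hz - t * G1) + (G0 - G2) - (G0 - G1).
  by field; rewrite gt_eqF.
apply: le_trans (ler_normB _ _) _.
apply: le_trans (lerD (ler_normD _ _) (lexx _)) _.
suff : `|t^-1 * (hw - hz - t * G1)| <= eta / 2 by lra.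
rewrite normrM normfV (gtr0_norm t0) ler_pdivrMl//.
apply: le_trans hexp _; rewrite mulrCA ler_pM2l//.
by rewrite -[leRHS](divfK (lt0r_neq0 S0)); apply: ler_wpM2l sS; exact: ltW.
Qed.

(** For one small [t] the quotient is within e / 2 of [euler_mean] on all of [K]. The error is paid
    once on the points where the bound is known and once at [x]. The subharmonic term [W] serves the
    equality case. *)
Lemma euler_mean_maximum Omega h y K W (M : R) : (0 < N)%N ->
  open Omega -> C2_on Omega h -> (forall x, Omega x -> laplacian h x = 0) ->
  compact K -> K `<=` Omega ->
  continuous W -> (forall x, exists2 m, 0 <= m & has_laplacian W x m) ->
  (forall x, K x -> euler_mean h y x + W x <= M \/ K° x) ->
  forall x, K x -> euler_mean h y x + W x <= M.
Proof.
move=> N0 oO C2 hl cK KO cW Wl hK x Kx; apply/ler_addgt0Pr => e e0.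
have e20 : 0 < e / 2 by rewrite divr_gt0.
have : \forall t \near (0 : R)^'+, K `<=` (fun z =>
    Omega ((1 - t) *: z + t *: y) /\
    `|dilation_quotient h y t z - euler_mean h y z| <= e / 2).
  apply: ((compact_near_coveringP K).1 cK) => z /KO Oz.
  exact: dilation_quotient_near.
move=> /(filterI (nbhs_right_gt 0))/filter_ex[t [/= t0 ht]].
have hq : forall z, K z -> dilation_quotient h y t z + W z <= M + e / 2.
  apply: (@maximum_principle R N K (fun z => dilation_quotient h y t z + W z) _ N0 cK).
    apply: continuous_in_subspaceT => z; rewrite inE => Kz.
    have c1 : {for z, continuous h}.
      by apply: C1_continuous; exact: C2_on_C1_at (KO _ Kz).
    have c2 : {for (1 - t) *: z + t *: y, continuous h}.
      by apply: C1_continuous; have [Oz _] := ht _ Kz; exact: C2_on_C1_at Oz.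
    have c3 : {for z, continuous (h \o (fun x => (1 - t) *: x + t *: y))}.
      by apply: continuous_comp => //; exact: continuous_affine.
    apply: (@continuousD _ _ _ (dilation_quotient h y t) W z); last exact: cW.
    apply: (@continuousD _ _ _ h); first exact: c1.
    apply: (@continuousM _ _ (cst t^-1)); first exact: cst_continuous.
    by apply: (@continuousB _ _ _ (h \o (fun x => (1 - t) *: x + t *: y)) h).
  move=> z Kz; have [Oz hz] := ht _ Kz.
  have [zM|Kz'] := hK z Kz; [left|right; split=> //].
    by move: hz; rewrite ler_norml => /andP[_]; lra.
  have [m m0 Wm] := Wl z; exists m => //.
  have l1 := C2_on_has_laplacian oO C2 (KO _ Kz); rewrite hl in l1; last exact: KO.
  have l2 := C2_on_has_laplacian oO C2 Oz; rewrite hl// in l2.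
  have := has_laplacianD (has_laplacianD l1 (has_laplacianZ t^-1
    (has_laplacianD (has_laplacian_affine l2) (has_laplacianZ (-1) l1)))) Wm.
  rewrite !(mulr0, addr0) add0r; congr (has_laplacian _ _ _).
  by apply/funext => w; rewrite /dilation_quotient mulN1r.
have := hq x Kx; have [_] := ht _ Kx; rewrite ler_norml => /andP[+ _]; lra.
Qed.

End harmonic_dilation.

(** * Bounded domains and their boundaries *)

Section domains.
Variables (R : realType) (N : nat).
Implicit Types (f u phi : 'rV[R]_N -> R) (x y z v w nu : 'rV[R]_N)
  (V Omega K : set 'rV[R]_N).

Local Notation e_ i := (delta_mx (0 : 'I_1) i : 'rV[R]_N).

Lemma within_continuous_near K f x (e : R) : {within K, continuous f} -> K x ->
  0 < e -> \forall y \near x, K y -> `|f x - f y| <= e.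
Proof.
move=> cf Kx e0; have cfx : f @ within K (nbhs x) --> f x.
  by rewrite (nbhs_subspace_in Kx); exact: cf.
by have /cvgrPdist_le/(_ _ e0) := cfx.
Qed.

Lemma bounded_closure Omega : bounded_set Omega -> compact (closure Omega).
Proof.
move=> /ex_strict_bound_gt0[b b0 hb].
apply: bounded_closed_compact; last exact: closed_closure.
apply: filterS (nbhs_pinfty_gt (num_real (b + 1))) => M bM x xO.
have [y [Oy yB]] := xO _ (nbhsx_ballx x 1 ltr01).
rewrite -(subrK y x); apply: le_trans (ler_normD _ _) _.
have := hb y Oy; move: yB; rewrite mx_norm_ball /ball_/=; lra.
Qed.

Lemma open_boundaryE Omega x : open Omega ->
  boundary Omega x <-> closure Omega x /\ ~ Omega x.
Proof. by move=> /interior_id OE; rewrite /boundary OE. Qed.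

Lemma closure_cases Omega x : open Omega -> closure Omega x ->
  Omega x \/ boundary Omega x.
Proof.
move=> oO xO; have [Ox|nOx] := pselect (Omega x); first by left.
by right; apply/open_boundaryE.
Qed.

Lemma subset_interior_closure Omega x : open Omega -> Omega x ->
  (closure Omega)° x.
Proof.
move=> oO Ox; apply: filterS (open_near oO Ox); exact: subset_closure.
Qed.

(** As a limit of points of [Omega], [x] satisfies [phi x <= 0], and [phi] decreases strictly along
    [w]. *)
Lemma boundary_cone Omega x V phi w : open Omega -> boundary Omega x ->
  defining_function Omega x V phi -> dot w (grad phi x) < 0 ->
  exists2 d : R, 0 < d & forall t : R, 0 < t < d -> Omega (t *: w + x).
Proof.
move=> oO /(open_boundaryE _ oO)[xO nOx] [oV Vx C2 _ OV] wphi.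
have phiC1 := C2_on_C1_at oV C2 Vx.
have phix : phi x <= 0.
  rewrite leNgt; apply/negP => phi0.
  have /cvgr_gt/(_ _ phi0) nphi : phi y @[y --> x] --> phi x.
    exact: C1_continuous.
  have [y [Oy [Vy py]]] := xO _ (filterI (open_near oV Vx) nphi).
  have : (Omega `&` V) y by [].
  by rewrite OV => -[/= + _]; move: py => /=; lra.
have [_ dE] := C1_is_derive w phiC1; have [dphi _] := C1_is_derive w phiC1.
have cq : (fun t : R => t^-1 *: (phi (t *: w + x) - phi x)) @ (0 : R)^' -->
    dot (grad phi x) w by rewrite -dE; exact: dphi.
have wphi' : dot (grad phi x) w < 0 by rewrite dotC.
have /cvgr_lt/(_ _ wphi') nq := cq.
have [d1 d10 h1] := near_line w (open_near oV Vx).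
have nq' : \forall t \near (0 : R), t != 0 ->
  t^-1 *: (phi (t *: w + x) - phi x) < 0 := nq.
have /nbhs_ballP[d2 /= d20 h2] := nq'.
exists (Num.min d1 d2) => [|t]; first by rewrite lt_min d10.
rewrite lt_min => /andP[t0 /andP[td1 td2]].
suff : ([set y | phi y < 0] `&` V) (t *: w + x) by rewrite -OV => -[].
split; last by apply: h1; rewrite gtr0_norm.
have := h2 t; rewrite /ball/= sub0r normrN gtr0_norm// => /(_ td2).
rewrite gt_eqF// => /(_ isT); rewrite /GRing.scale/= pmulr_rlt0 ?invr_gt0//.
by rewrite subr_lt0 => /lt_le_trans; apply.
Qed.

(** A nonnegative function that vanishes at [x] cannot have slopes below [- k] on the segment
    entering [Omega] along [w]. No derivative exists at [x] itself, so two interior points of the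
    segment are compared and continuity of [u] at [x] does the rest. *)
Lemma boundary_gradient_sign Omega u x V phi w (G : 'rV[R]_N) : open Omega ->
  boundary Omega x -> defining_function Omega x V phi -> C2_on Omega u ->
  {within closure Omega, continuous u} -> (forall y, Omega y -> 0 <= u y) ->
  u x = 0 -> dot (grad u y) w @[y --> within Omega (nbhs x)] --> dot G w ->
  dot w (grad phi x) < 0 -> 0 <= dot G w.
Proof.
move=> oO bx dphi C2 cu u0 ux cG wphi; rewrite leNgt; apply/negP => G0.
have [d1 d10 h1] := boundary_cone oO bx dphi wphi.
pose k := - dot G w / 2; have k0 : 0 < k by rewrite divr_gt0// oppr_gt0.
have Gk : dot G w < - k by rewrite /k; move: G0; lra.
have nG : \forall y \near x, Omega y -> dot (grad u y) w < - k.
  by have /cvgr_lt/(_ _ Gk) := cG.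
have [d2 d20 h2] := near_line w nG.
have d0 : 0 < Num.min d1 d2 by rewrite lt_min d10.
have dd1 : Num.min d1 d2 <= d1 by rewrite ge_min lexx.
have dd2 : Num.min d1 d2 <= d2 by rewrite ge_min lexx orbT.
pose s := Num.min d1 d2 / 2; have s0 : 0 < s by rewrite divr_gt0.
have sd : s < Num.min d1 d2 by rewrite ltr_pdivrMr// ltr_pMr// ltr1n.
have inO (t : R) : 0 < t <= s -> Omega (t *: w + x).
  by move=> /andP[t0 ts]; apply: h1; rewrite t0 (le_lt_trans ts)// (lt_le_trans sd).
have dle (t : R) : 0 < t <= s -> dot (grad u (t *: w + x)) w < - k.
  move=> /[dup] /inO Ot /andP[t0 ts]; apply: h2 => //.
  by rewrite gtr0_norm// (le_lt_trans ts)// (lt_le_trans sd).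
have du (t : R) : 0 < t <= s ->
    is_derive t (1 : R) (fun t : R => u (t *: w + x)) (dot (grad u (t *: w + x)) w).
  move=> /inO Ot; apply/is_derive_lineP; apply: C1_is_derive.
  exact: C2_on_C1_at Ot.
have xO : closure Omega x by have [] := (open_boundaryE x oO).1 bx.
have e0 : 0 < k * s / 4 by apply: divr_gt0 => //; apply: mulr_gt0.
have [d3 d30 h3] := near_line w (within_continuous_near cu xO e0).
(* Since t <= s / 4, the descent from [t] to [s] is at least 3 k s / 4, while the choice of [d3]
   keeps u at parameter [t] below k s / 4. *)
pose t := Num.min (s / 4) (d3 / 2).
have t0 : 0 < t by rewrite lt_min; apply/andP; split; apply: divr_gt0.
have ts4 : t <= s / 4 by rewrite ge_min lexx.
have td3 : t < d3.
  have : t <= d3 / 2 by rewrite ge_min lexx orbT.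
  by move: d30; lra.
have ts : t < s by move: ts4 s0; clearbody s t; lra.
have [||c] := @MVT R (fun t : R => u (t *: w + x))
   (fun t : R => dot (grad u (t *: w + x)) w) t s ts.
- move=> r; rewrite in_itv/= => /andP[tr rs]; apply: du.
  by rewrite (lt_trans t0)//= ltW.
- apply: derivable_within_continuous => r; rewrite in_itv/= => /andP[tr rs].
  by case: (du r) => //; rewrite (lt_le_trans t0).
rewrite in_itv/= => /andP[tc cs] E.
have ck : dot (grad u (c *: w + x)) w < - k.
  by apply: dle; rewrite (lt_trans t0)//= ltW.
have us : 0 <= u (s *: w + x) by apply: u0; apply: inO; rewrite s0 lexx.
have ut : `|u x - u (t *: w + x)| <= k * s / 4.
  apply: h3; first by rewrite gtr0_norm.
  by apply: subset_closure; apply: inO; rewrite t0 ltW.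
move: ut; rewrite ux sub0r normrN ler_norml => /andP[_ ut].
move: E us ut ck ts4 s0 k0; set us := u (s *: w + x).
set ut := u (t *: w + x); set D := dot _ _.
clearbody us ut D s t k => E us0 ut0 Dk ts4 s0 k0; nra.
Qed.

End domains.

(** * C^2 functions given by explicit formulas *)

Section C2_explicit.
Variables (R : realType) (N : nat).
Implicit Types (f u : 'rV[R]_N -> R) (x y z v w p : 'rV[R]_N) (V Omega : set 'rV[R]_N).

Local Notation e_ i := (delta_mx (0 : 'I_1) i : 'rV[R]_N).

Lemma continuous_near_eq f g x : (\forall z \near x, g z = f z) ->
  {for x, continuous g} -> {for x, continuous f}.
Proof.
move=> fg cg; suff : f y @[y --> x] --> f x by [].
rewrite -(nbhs_singleton fg); apply: cvg_trans cg.
exact: (@near_eq_cvg _ _ (nbhs x) (nbhs_filter x) g f fg).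
Qed.

(** The formulas agree with the partial derivatives on the open set [V] only; this local equality
    suffices to transfer derivatives and continuity. *)
Lemma C2_on_explicit V f (F : 'I_N -> 'rV[R]_N -> R)
    (D : 'I_N -> 'I_N -> 'rV[R]_N -> R) : open V ->
  (forall x, V x -> forall i, is_derive x (e_ i) f (F i x)) ->
  (forall x, V x -> forall i j, is_derive x (e_ j) (F i) (D i j x)) ->
  (forall x, V x -> {for x, continuous f}) ->
  (forall x, V x -> forall i, {for x, continuous (F i)}) ->
  (forall x, V x -> forall i j, {for x, continuous (D i j)}) ->
  [/\ C2_on V f, forall x, V x -> forall i, partial i f x = F i x
    & forall x, V x -> forall i j, partial j (partial i f) x = D i j x].
Proof.
move=> oV dF dD cf cF cD.
have pF x : V x -> forall i, partial i f x = F i x.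
  by move=> Vx i; have [_] := dF x Vx i.
have nF x i : V x -> \forall z \near x, F i z = partial i f z.
  by move=> Vx; apply: filterS (open_near oV Vx) => z Vz; rewrite pF.
have dD' x i j : V x -> is_derive x (e_ j) (partial i f) (D i j x).
  by move=> Vx; apply: near_eq_is_derive (nF x i Vx) (dD x Vx i j).
have pD x : V x -> forall i j, partial j (partial i f) x = D i j x.
  by move=> Vx i j; have [_] := dD' x i j Vx.
split=> //; split; first by move=> x; rewrite inE; exact: cf.
move=> i; split; first by move=> x Vx; have [] := dF x Vx i.
split.
  by move=> x; rewrite inE => Vx; apply: continuous_near_eq (nF x i Vx) (cF x Vx i).
move=> j; split; first by move=> x Vx; have [] := dD' x i j Vx.
move=> x; rewrite inE => Vx; apply: continuous_near_eq (cD x Vx i j).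
by apply: filterS (open_near oV Vx) => z Vz; rewrite pD.
Qed.

Lemma C2_onP V f x i : C2_on V f -> V x ->
  [/\ {for x, continuous f}, is_derive x (e_ i) f (partial i f x),
      {for x, continuous (partial i f)} &
      forall j, is_derive x (e_ j) (partial i f) (partial j (partial i f) x) /\
        {for x, continuous (partial j (partial i f))}].
Proof.
move=> [cf /(_ i)[df [cdf h]]] Vx; split.
- by apply: cf; rewrite inE.
- exact/derivableP/df.
- by apply: cdf; rewrite inE.
- move=> j; have [dd cd] := h j; split; first exact/derivableP/dd.
  by apply: cd; rewrite inE.
Qed.

End C2_explicit.

(** * Lebesgue measure on tuples *)

Section tuple_measurability.
Variables (R : realType) (N : nat).
Implicit Types (f : 'rV[R]_N -> R) (U : set 'rV[R]_N) (t : N.-tuple R).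

Lemma measurable_tuple_box (a b : 'I_N -> R) :
  measurable [set t : N.-tuple R | forall i, a i < tnth t i < b i].
Proof.
have -> : [set t : N.-tuple R | forall i, a i < tnth t i < b i] =
    \bigcap_(i in [set: 'I_N]) ((@tnth N R ^~ i) @^-1` `]a i, b i[).
  apply/seteqP; split=> [t /= h i _|t /= h i]; rewrite ?in_itv/=.
    by rewrite in_itv/=; exact: h.
  by have := h i I; rewrite /= in_itv.
apply: fin_bigcap_measurable; first exact: finite_finset.
move=> i _; rewrite -[X in measurable X]setTI; apply: measurable_tnth => //.

Qed.

(** An open set is a countable union of boxes with rational centre and half-width 1 / (k + 1). A box
    that leaves [U] is replaced by the empty set, so the index set stays countable by its type. *)
Lemma measurable_row_open U : open U -> measurable (@row_of_tuple R N @^-1` U).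
Proof.
move=> oU.
pose box (qk : {ffun 'I_N -> rat} * nat) : set (N.-tuple R) :=
  [set t | forall i, ratr (qk.1 i) - qk.2.+1%:R^-1 < tnth t i <
                     ratr (qk.1 i) + qk.2.+1%:R^-1].
pose B qk := if `[< box qk `<=` @row_of_tuple R N @^-1` U >] then box qk else set0.
have -> : @row_of_tuple R N @^-1` U = \bigcup_qk B qk.
  apply/seteqP; split=> [t /= tU|t [qk _]]; last first.
    by rewrite /B; case: ifPn => [/asboolP h|//]; exact: h.
  have [r r0 hr] := near_ball_rV (open_near oU tU).
  (* The centre is not [t] but a rational point near it, so two points of the box differ by up to
     two half-widths in each coordinate. *)
  have [k kr] : exists k : nat, k.+1%:R^-1 < r / 2.
    have r20 : 0 < r / 2 by rewrite divr_gt0.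
    exists (Num.trunc (r / 2)^-1).
    by rewrite invf_plt ?posrE// truncnS_gt.
  have e0 : 0 < k.+1%:R^-1 :> R by [].
  have qi i : exists q : rat,
      ratr q - k.+1%:R^-1 < tnth t i < ratr q + k.+1%:R^-1.
    have [|q] := @rat_in_itvoo R (tnth t i - k.+1%:R^-1) (tnth t i + k.+1%:R^-1).
      by rewrite ltrBlDr -addrA ltrDl addr_gt0.
    rewrite in_itv/= => /andP[q1 q2]; exists q.
    by rewrite ltrBlDr q2/= -ltrBlDr.
  have [q hq] := choice qi.
  have bt : box ([ffun i => q i], k) t by move=> i /=; rewrite ffunE.
  exists ([ffun i => q i], k) => //; rewrite /B; case: ifPn => // /asboolP[].
  move=> s bs /=; apply: hr; apply/(ball_rVP _ _ r0) => i; rewrite !mxE.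
  move: (bs i) (bt i) => /= /andP[s1 s2] /andP[t1 t2].
  move: kr s1 s2 t1 t2; set e := k.+1%:R^-1; set w := ratr _.
  clearbody e w => kr s1 s2 t1 t2.
  rewrite ltr_norml; apply/andP; split; lra.
apply: countable_bigcupT_measurable => // qk; rewrite /B; case: ifPn => // _.
exact: measurable_tuple_box.
Qed.

Lemma measurable_row_continuous f : continuous f ->
  measurable_fun setT (f \o @row_of_tuple R N).
Proof.
move=> cf; apply: (measurability _ (RGenOpens.measurableE R)).
move=> _ [_ [a [b ->] <-]]; rewrite setTI comp_preimage.
apply: measurable_row_open; move/continuousP : cf; apply; exact: interval_open.
Qed.

End tuple_measurability.

(** * Measure of boxes and sigma-finiteness *)

Section lebesgue_tuple_box.
Variable (R : realType).

Lemma integral_lebesgue_tuple_succ n (f : n.+1.-tuple R -> \bar R) :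
  measurable_fun setT f ->
  (lebesgue_tuple R n \x (@lebesgue_measure R))%E.-integrable setT
    (f \o @cons_pair R n) ->
  (\int[lebesgue_tuple R n.+1]_t f t =
   \int[lebesgue_tuple R n \x @lebesgue_measure R]_z f (cons_pair z))%E.
Proof.
move=> mf intf.
exact: (@integral_pushforward _ _ (n.-tuple R * measurableTypeR R)%type _ _ _
  (@measurable_cons_pair R n) _ setT f mf intf measurableT).
Qed.

Lemma lebesgue_tuple_boxE n (a b : 'I_n -> R) : (forall i, a i < b i) ->
  lebesgue_tuple R n [set t | forall i, a i < tnth t i < b i] =
  (\prod_(i < n) (b i - a i))%:E.
Proof.
elim: n a b => [|n IH] a b ab.
  rewrite big_ord0 /= diracE mem_set//= => -[]//.
rewrite /= /pushforward.
have -> : @cons_pair R n @^-1` [set t | forall i, a i < tnth t i < b i] =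
    [set t | forall i, a (lift ord0 i) < tnth t i < b (lift ord0 i)] `*`
    `]a ord0, b ord0[.
  apply/seteqP; split=> [[z x] /= h|[z x] /= [h1 h2] i].
    split=> [i|]; first by have := h (lift ord0 i); rewrite tnthS.
    by rewrite in_itv/=; have := h ord0; rewrite tnth0.
  case: (unliftP ord0 i) => [j ->|->]; first by rewrite tnthS; exact: h1.
  by move: h2; rewrite in_itv/= tnth0.
rewrite product_measure1E//; last exact: measurable_tuple_box.
have lab := @lebesgue_measure_itv R `]a ord0, b ord0[.
rewrite /= lte_fin ab in lab.
rewrite IH// big_ord_recl mulrC EFinM; congr (_ * _)%E; exact: lab.
Qed.

Lemma tuple_norm_bounded n (t : n.-tuple R) :
  exists k : nat, forall i, `|tnth t i| < k.+1%:R.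
Proof.
exists (Num.trunc (\sum_i `|tnth t i|)) => i.
apply: le_lt_trans (truncnS_gt _); rewrite (bigD1 i)//= lerDl; exact: sumr_ge0.
Qed.

Lemma sigma_finite_lebesgue_tuple n : sigma_finite setT (lebesgue_tuple R n).
Proof.
exists (fun k => [set t : n.-tuple R |
    forall i, - k.+1%:R < tnth t i < k.+1%:R]) => [|k].
  apply/esym; rewrite -subTset => t _; have [k tk] := tuple_norm_bounded t.
  by exists k => //= i; rewrite -ltr_norml.
split; first exact: (measurable_tuple_box (fun=> - k.+1%:R) (fun=> k.+1%:R)).
by rewrite (@lebesgue_tuple_boxE n (fun=> - k.+1%:R) (fun=> k.+1%:R)) ?ltry// => i;
  rewrite gtrN.
Qed.

(* A named copy, because a term headed by the coercion [Measure.sort] cannot be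
   the subject of a canonical sigma-finite instance. *)
Definition lebesgue_tuple_fun n : set (n.-tuple R) -> \bar R := lebesgue_tuple R n.

HB.instance Definition _ n := Measure.copy (@lebesgue_tuple_fun n) (lebesgue_tuple R n).

HB.instance Definition _ n := @Measure_isSigmaFinite.Build _ _ R
  (@lebesgue_tuple_fun n) (sigma_finite_lebesgue_tuple n).


End lebesgue_tuple_box.

(** * The integral of a compactly supported partial derivative *)

Section integral_partial.
Variable R : realType.

Lemma bounded_support_integrable d (T : measurableType d)
    (mu : {measure set T -> \bar R}) (D : set T) (f : T -> R) (M : R) :
  measurable D -> (mu D < +oo)%E -> measurable_fun setT f ->
  (forall t, `|f t| <= M) -> (forall t, ~ D t -> f t = 0) ->
  mu.-integrable setT (EFin \o f).
Proof.
move=> mD muD mf fM f0.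
have -> : EFin \o f = (EFin \o f) \_ D.
  apply/funext => t; rewrite patchE; case: ifPn => // tD /=.
  by move: tD; rewrite notin_setE => /f0 ->.
apply/(integrable_restrict mu mD measurableT); rewrite setTI.
apply: measurable_bounded_integrable => //; first exact: measurable_funTS.
exists M; split; first exact: num_real.
by move=> r Mr t _; apply: le_trans (ltW Mr).
Qed.

Definition tuple_set n (t : n.-tuple R) (i : 'I_n) (r : R) : n.-tuple R :=
  [tuple if j == i then r else tnth t j | j < n].

Lemma tnth_tuple_set n (t : n.-tuple R) i r j :
  tnth (tuple_set t i r) j = if j == i then r else tnth t j.
Proof. by rewrite tnth_mktuple. Qed.

Lemma tuple_set_cons0 n (z : n.-tuple R) x r :
  tuple_set (cons_pair (z, x)) ord0 r = cons_pair (z, r).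
Proof.
apply: eq_from_tnth => j; rewrite tnth_tuple_set.
by case: (unliftP ord0 j) => [k ->|->]; rewrite ?tnthS ?tnth0.
Qed.

Lemma tuple_set_consS n (z : n.-tuple R) x i r :
  tuple_set (cons_pair (z, x)) (lift ord0 i) r = cons_pair (tuple_set z i r, x).
Proof.
apply: eq_from_tnth => j; rewrite tnth_tuple_set.
case: (unliftP ord0 j) => [k ->|->]; last by rewrite (negbTE (neq_lift _ _)) !tnth0.
by rewrite !tnthS tnth_tuple_set (inj_eq lift_inj).
Qed.

Lemma integral_derivative_eq0 (F dF : R -> R) (L : R) : 0 < L ->
  (forall s, is_derive s (1 : R) F (dF s)) -> continuous dF ->
  (forall s, L <= `|s| -> F s = 0 /\ dF s = 0) ->
  (\int[@lebesgue_measure R]_s (dF s)%:E = 0)%E.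
Proof.
move=> L0 dFF cdF supp; have LL : - L < L by rewrite gtrN.
transitivity (\int[@lebesgue_measure R]_(s in [set` `[- L, L]%R]) (dF s)%:E)%E.
  rewrite [RHS]integral_mkcond; apply: eq_integral => s _.
  rewrite patchE; case: ifPn => //; rewrite notin_setE/= in_itv/= -ler_norml.
  by move=> /negP; rewrite -ltNge => /ltW/supp[_ ->].
rewrite (@continuous_FTC2 _ dF F)//.
- have hL : L <= `|L| by rewrite gtr0_norm.
  have hNL : L <= `|- L| by rewrite normrN gtr0_norm.
  by have [-> _] := supp L hL; have [-> _] := supp (- L) hNL; rewrite sube0.
- exact: continuous_subspaceT.
- have cF : continuous F.
    move=> s; apply/differentiable_continuous/derivable1_diffP.
    by case: (dFF s).
  split; first by move=> s _; case: (dFF s).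
    exact/cvg_at_right_filter/cF.
  exact/cvg_at_left_filter/cF.
- by move=> s _; rewrite derive1E; case: (dFF s).
Qed.

(** Fubini, with induction on the dimension. If [i] is the head coordinate, it is integrated first
    and the one-variable case applies; otherwise the head is frozen and the induction hypothesis
    handles the tail. *)
Lemma integral_tuple_derivative_eq0 n (i : 'I_n) (F dF : n.-tuple R -> R) (L M : R) :
  0 < L -> measurable_fun setT dF -> (forall t, `|dF t| <= M) ->
  (forall t, (exists j, L <= `|tnth t j|) -> F t = 0 /\ dF t = 0) ->
  (forall t s, is_derive s (1 : R) (fun r => F (tuple_set t i r)) (dF (tuple_set t i s))) ->
  (forall t, continuous (fun r => dF (tuple_set t i r))) ->
  (\int[lebesgue_tuple R n]_t (dF t)%:E = 0)%E.
Proof.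
elim: n i F dF => [[]//|n IH] i F dF L0 mdF bdF supp dFF cdF.
pose B : set (n.-tuple R) := [set z | forall j, - L < tnth z j < L].
have LL : - L < L by rewrite gtrN.
have mB : measurable B by exact: (measurable_tuple_box (fun=> - L) (fun=> L)).
pose I : set R := [set` `]- L, L[%R].
have muB : ((lebesgue_tuple R n \x (@lebesgue_measure R)) (B `*` I)
    < +oo)%E.
  have lL : (@lebesgue_measure R I < +oo)%E.
    by rewrite /I lebesgue_measure_itv/= lte_fin LL -EFinB ltry.
  have -> : ((lebesgue_tuple R n \x (@lebesgue_measure R)) (B `*` I) =
     lebesgue_tuple R n B * @lebesgue_measure R I)%E.
    by apply: product_measure1E => //; exact: measurable_itv.
  rewrite lte_mul_pinfty// /B (@lebesgue_tuple_boxE R n (fun=> - L) (fun=> L))//.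
have intf : (lebesgue_tuple R n \x (@lebesgue_measure R))%E.-integrable setT
    (EFin \o (dF \o @cons_pair R n)).
  apply: (@bounded_support_integrable _ (n.-tuple R * measurableTypeR R)%type _
    (B `*` I) (dF \o @cons_pair R n) M).
  - by apply: measurableX => //; exact: measurable_itv.
  - exact: muB.
  - exact: measurableT_comp mdF (@measurable_cons_pair R n).
  - by move=> z; exact: bdF.
  - move=> [z x] nD.
    suff /supp[] : exists j, L <= `|tnth (cons_pair (z, x)) j| by [].
    apply: contrapT => /forallNP h; apply: nD; split => [j|].
      have /negP := h (lift ord0 j).
      by rewrite tnthS -ltNge ltr_norml.
    have /negP := h ord0.
    by rewrite tnth0 -ltNge ltr_norml /I /= in_itv.
rewrite integral_lebesgue_tuple_succ//; last exact/measurable_EFinP.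
case: (unliftP ord0 i) dFF cdF => [j ->|->] dFF cdF.
  rewrite -(@integral21_prod_meas1 _ _ _ _ R (@lebesgue_tuple_fun R n)
    (@lebesgue_measure R) (fun z => (dF (cons_pair z))%:E) intf).
  rewrite [X in _ = X](_ : 0%E = \int[@lebesgue_measure R]_y (cst 0%E y))%E;
    last by rewrite integral0.
  apply: eq_integral => x _; rewrite /fubini_G.
  apply: (IH j (fun z => F (cons_pair (z, x))) (fun z => dF (cons_pair (z, x)))) => //.
  - apply: (measurableT_comp mdF (f := dF)
      (g := fun z : n.-tuple R => [the n.+1.-tuple R of x :: z])).
    by apply: measurable_cons.
  - move=> z [k Lk]; apply: supp; exists (lift ord0 k); by rewrite tnthS.
  - move=> z s; have := dFF (cons_pair (z, x)) s; rewrite tuple_set_consS.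
    have -> // : (fun r => F (tuple_set (cons_pair (z, x)) (lift ord0 j) r)) =
      (fun r => F (cons_pair (tuple_set z j r, x))).
    by apply/funext => r; rewrite tuple_set_consS.
  - move=> z; have := cdF (cons_pair (z, x)).
    have -> // : (fun r => dF (tuple_set (cons_pair (z, x)) (lift ord0 j) r)) =
      (fun r => dF (cons_pair (tuple_set z j r, x))).
    by apply/funext => r; rewrite tuple_set_consS.
rewrite -(@integral12_prod_meas1 _ _ _ _ R (@lebesgue_tuple_fun R n)
    (@lebesgue_measure R) (fun z => (dF (cons_pair z))%:E) intf).
rewrite [X in _ = X](_ : 0%E = \int[@lebesgue_tuple_fun R n]_y (cst 0%E y))%E;
  last by rewrite integral0.
apply: eq_integral => z _; rewrite /fubini_F.
apply: (@integral_derivative_eq0 (fun x => F (cons_pair (z, x)))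
  (fun x => dF (cons_pair (z, x))) L) => //.
- move=> s; have := dFF (cons_pair (z, 0)) s; rewrite tuple_set_cons0.
  have -> // : (fun r => F (tuple_set (cons_pair (z, 0)) ord0 r)) =
    (fun r => F (cons_pair (z, r))).
  by apply/funext => r; rewrite tuple_set_cons0.
- have := cdF (cons_pair (z, 0)).
  have -> // : (fun r => dF (tuple_set (cons_pair (z, 0)) ord0 r)) =
    (fun r => dF (cons_pair (z, r))).
  by apply/funext => r; rewrite tuple_set_cons0.
- move=> s Ls; apply: supp; exists ord0; by rewrite tnth0.
Qed.

End integral_partial.

(** * A C^1 cutoff function *)

Section cutoff.
Variable R : realType.
Implicit Types (s t h e : R).

(** With this criterion the square of the positive part is differentiated in the same way on both
    sides of 0 and at 0. *)
Lemma is_derive_quadratic_bound (f : R -> R) s (d C : R) :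
  (forall h, `|f (h + s) - f s - d * h| <= C * h ^+ 2) -> is_derive s (1 : R) f d.
Proof.
move=> hf; have C0 : 0 <= C by have := le_trans (normr_ge0 _) (hf 1); rewrite expr1n mulr1.
suff cq : h^-1 *: (f (h *: 1 + s) - f s) @[h --> (0 : R)^'] --> d.
  by split; [exact: cvgP cq|exact: cvg_lim cq].
apply/cvgrPdist_le => e e0.
have e1 : 0 < e / (1 + C) by rewrite divr_gt0// ltr_pwDl.
near=> h.
have h0 : h != 0 by near: h; exact: nbhs_dnbhs_neq.
have he : `|h| < e / (1 + C) by near: h; exact: dnbhs0_lt.
have := hf h; rewrite [_%:A]mulr1 distrC => hb.
rewrite /GRing.scale/=; set A := f _ - f s in hb *.
have -> : d - h^-1 * A = h^-1 * (d * h - A) by field.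
rewrite normrM normfV ler_pdivrMl ?normr_gt0//; apply: le_trans hb _.
rewrite -real_normK ?num_real// expr2 mulrCA ler_wpM2l//.
apply: (@le_trans _ _ (C * (e / (1 + C)))); first by rewrite ler_wpM2l// ltW.
have := divfK (lt0r_neq0 (ltr_pwDl ltr01 C0)) e; have := ltW e1.
set E := e / _ => E0 EC; rewrite -[leRHS]EC; nra.
Unshelve. all: by end_near. Qed.

Definition pospart s : R := Num.max s 0.

Lemma pospart_cases s : (s <= 0 /\ pospart s = 0) \/ (0 <= s /\ pospart s = s).
Proof.
by rewrite /pospart; have [s0|s0] := leP s 0; [left|right]; rewrite ?ltW.
Qed.

Lemma is_derive_pospart_sqr s :
  is_derive s (1 : R) (fun t => pospart t ^+ 2) (2 * pospart s).
Proof.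
apply: (@is_derive_quadratic_bound _ _ _ 1) => h.
have [[a ->]|[a ->]] := pospart_cases (h + s);
  have [[b ->]|[b ->]] := pospart_cases s; rewrite ler_norml; apply/andP; split; nra.
Qed.

Lemma continuous_pospart : continuous pospart.
Proof.
move=> s; apply: (@continuous_max _ _ (id : R -> R) (cst 0)).
  exact: cvg_id.
exact: cst_continuous.
Qed.

(* A C^1 quadratic spline going from 0 on [s <= e] to 1 on [2 e <= s]. *)
Definition cutoff e s : R :=
  2 * pospart (s / e - 1) ^+ 2 - 4 * pospart (s / e - 3 / 2) ^+ 2
  + 2 * pospart (s / e - 2) ^+ 2.

(** For e > 0, a hat supported on [e, 2 e] with peak 2 / e at 3 e / 2; this is why it is continuous
    and nonnegative. *)
Definition dcutoff e s : R :=
  e^-1 * (4 * pospart (s / e - 1) - 8 * pospart (s / e - 3 / 2)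
  + 4 * pospart (s / e - 2)).

Lemma is_derive_cutoff e s : is_derive s (1 : R) (cutoff e) (dcutoff e s).
Proof.
have dp (c : R) :
    is_derive s (1 : R) (fun t => pospart (t / e - c) ^+ 2) (2 * pospart (s / e - c) * e^-1).
  apply: (@is_derive1_comp R (fun t => pospart t ^+ 2) (fun t => t / e - c)).
    exact: is_derive_pospart_sqr.
  rewrite -[X in is_derive _ _ _ X]subr0; apply: is_deriveB.
  have -> : (fun t : R => t / e) = e^-1 \*: (id : R -> R).
    by apply/funext => t /=; rewrite mulrC.
  by rewrite -[X in is_derive _ _ _ X]mulr1; exact: is_deriveZ.
have d1 := is_deriveZ 2 (dp 1).
have d2 := is_deriveZ 4 (dp (3 / 2)).
have d3 := is_deriveZ 2 (dp 2).
have -> : dcutoff e s = 2 *: (2 * pospart (s / e - 1) * e^-1) -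
    4 *: (2 * pospart (s / e - 3 / 2) * e^-1) + 2 *: (2 * pospart (s / e - 2) * e^-1).
  by rewrite /dcutoff /GRing.scale/=; ring.
exact: is_deriveD (is_deriveB d1 d2) d3.
Qed.

Lemma continuous_dcutoff e : continuous (dcutoff e).
Proof.
have cp (c : R) : continuous (fun s => pospart (s / e - c)).
  move=> s; apply: (@continuous_comp _ _ _ (fun s => s / e - c) pospart).
    suff : t / e - c @[t --> s] --> s / e - c by [].
    by apply: cvgB; [apply: cvgMl; exact: cvg_id|exact: cvg_cst].
  exact: continuous_pospart.
move=> s; suff : dcutoff e t @[t --> s] --> dcutoff e s by [].
apply: cvgMr; apply: cvgD; [apply: cvgB|]; apply: cvgMr; exact: cp.
Qed.

Lemma cutoff_eq0 e s : 0 < e -> s <= e -> cutoff e s = 0 /\ dcutoff e s = 0.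
Proof.
move=> e0 se1; have se : s / e <= 1 by rewrite ler_pdivrMr// mul1r.
rewrite /cutoff /dcutoff.
have p0 (c : R) : 1 <= c -> pospart (s / e - c) = 0.
  by move=> c1; have [[_ ->]//|[h ->]] := pospart_cases (s / e - c); lra.
have -> := p0 1 (lexx 1).
have -> : pospart (s / e - 3 / 2) = 0 by apply: p0; lra.
have -> : pospart (s / e - 2) = 0 by apply: p0; lra.
by split; ring.
Qed.

Lemma cutoff_eq1 e s : 0 < e -> 2 * e <= s -> cutoff e s = 1 /\ dcutoff e s = 0.
Proof.
move=> e0; rewrite -ler_pdivlMr// => se; rewrite /cutoff /dcutoff.
have p0 (c : R) : c <= 2 -> pospart (s / e - c) = s / e - c.
  by move=> c1; have [[h ->]|[_ ->]//] := pospart_cases (s / e - c); lra.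
have -> : pospart (s / e - 1) = s / e - 1 by apply: p0; lra.
have -> : pospart (s / e - 3 / 2) = s / e - 3 / 2 by apply: p0; lra.
have -> := p0 2 (lexx 2).
by split; field; rewrite gt_eqF.
Qed.

Lemma cutoff_bounds e s : 0 < e -> 0 <= cutoff e s <= 1 /\ 0 <= dcutoff e s.
Proof.
move=> e0; rewrite /cutoff /dcutoff; set t := s / e; clearbody t.
have ei : 0 <= e^-1 by rewrite invr_ge0 ltW.
have [[a ->]|[a ->]] := pospart_cases (t - 1);
have [[b ->]|[b ->]] := pospart_cases (t - 3 / 2);
have [[c ->]|[c ->]] := pospart_cases (t - 2);
(split; [apply/andP; split; nra | apply: mulr_ge0 => //; lra]).
Qed.

End cutoff.

(** * A divergence theorem without boundary terms *)

Section divergence.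
Variables (R : realType) (N : nat).
Implicit Types (f u : 'rV[R]_N -> R) (x y z v w p : 'rV[R]_N) (K Omega : set 'rV[R]_N).

Local Notation e_ i := (delta_mx (0 : 'I_1) i : 'rV[R]_N).

Lemma row_tuple_set (t : N.-tuple R) i (r : R) :
  row_of_tuple (tuple_set t i r) = r *: e_ i + row_of_tuple (tuple_set t i 0).
Proof.
apply/rowP => j; rewrite !mxE !tnth_tuple_set eqxx/=.
by case: eqP => _; rewrite ?mulr1 ?mulr0 ?addr0 ?add0r.
Qed.

Lemma continuous_row_line x i : continuous (fun r : R => r *: e_ i + x).
Proof.
move=> r; suff : s *: e_ i + x @[s --> r] --> r *: e_ i + x by [].
by apply: cvgD; [exact: scalel_continuous|exact: cvg_cst].
Qed.

Lemma compact_box (L : R) :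
  compact [set x : 'rV[R]_N | forall i, `|x 0 i| <= L].
Proof.
have -> : [set x : 'rV[R]_N | forall i, `|x 0 i| <= L] =
    [set v : 'rV[R]_N | forall i, [set` `[- L, L]] (v ord0 i)].
  by apply/seteqP; split=> x /= h i; have := h i; rewrite in_itv/= ler_norml.
by apply: (@rV_compact _ _ (fun=> [set` `[- L, L]])) => _; exact: segment_compact.
Qed.

Lemma bounded_of_support f (L : R) : continuous f ->
  (forall x, (exists j, L <= `|x 0 j|) -> f x = 0) ->
  exists M : R, forall x, `|f x| <= M.
Proof.
move=> cf supp; have := @compact_box L.
move=> /(continuous_compact (continuous_subspaceT cf))/compact_bounded.
move=> /ex_strict_bound_gt0[M M0 hM]; exists M => x.
have [h|] := pselect (exists j, L <= `|x 0 j|).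
  by rewrite supp// normr0 ltW.
move=> /forallNP h; apply/ltW/hM; exists x => //= i.
by have /negP := h i; rewrite -ltNge => /ltW.
Qed.

Lemma integrable_of_support f (L : R) : 0 < L -> continuous f ->
  (forall x, (exists j, L <= `|x 0 j|) -> f x = 0) ->
  (lebesgue_tuple R N).-integrable setT (EFin \o (f \o @row_of_tuple R N)).
Proof.
move=> L0 cf supp; have [M hM] := bounded_of_support cf supp.
have LL : - L < L by rewrite gtrN.
apply: (@bounded_support_integrable R _ _ _
  [set t : N.-tuple R | forall i, - L < tnth t i < L] _ M).
- exact: (measurable_tuple_box (fun=> - L) (fun=> L)).
- by rewrite (@lebesgue_tuple_boxE R N (fun=> - L) (fun=> L)) ?ltry.
- exact: measurable_row_continuous.
- by move=> t; exact: hM.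
- move=> t nt; apply: supp; apply: contrapT => /forallNP h; apply: nt => j.
  by have /negP := h j; rewrite mxE -ltNge ltr_norml.
Qed.

Lemma integral_partial_eq0 i (F dF : 'rV[R]_N -> R) (L : R) : 0 < L ->
  continuous dF -> (forall x, is_derive x (e_ i) F (dF x)) ->
  (forall x, (exists j, L <= `|x 0 j|) -> F x = 0 /\ dF x = 0) ->
  (\int[lebesgue_tuple R N]_t (dF (row_of_tuple t))%:E = 0)%E.
Proof.
move=> L0 cdF dFF supp.
have [M hM] : exists M : R, forall x, `|dF x| <= M.
  by apply: (bounded_of_support (L := L) cdF) => x /supp[].
apply: (@integral_tuple_derivative_eq0 R N i (F \o @row_of_tuple R N)
  (dF \o @row_of_tuple R N) L M) => //.
- exact: measurable_row_continuous.
- by move=> t; exact: hM.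
- by move=> t [j Lj]; apply: supp; exists j; rewrite mxE.
- move=> t s; rewrite /= row_tuple_set.
  have -> : (fun r => F (row_of_tuple (tuple_set t i r))) =
      (fun r => F (r *: e_ i + row_of_tuple (tuple_set t i 0))).
    by apply/funext => r; rewrite row_tuple_set.
  exact/is_derive_lineP.
- move=> t.
  have -> : (fun r => (dF \o @row_of_tuple R N) (tuple_set t i r)) =
      dF \o (fun r => r *: e_ i + row_of_tuple (tuple_set t i 0)).
    by apply/funext => r; rewrite /= row_tuple_set.
  move=> r; apply: continuous_comp; [exact: continuous_row_line|exact: cdF].
Qed.

Lemma bounded_set_coord Omega : bounded_set Omega ->
  exists2 L : R, 0 < L & forall x, Omega x -> forall i, `|x 0 i| < L.
Proof.
move=> /ex_strict_bound_gt0[L L0 h]; exists L => // x Ox i.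
apply: le_lt_trans (h _ Ox).
by rewrite /Num.Def.normr/= mx_normrE; apply/bigmax_geP; right => /=; exists (0, i).
Qed.

(* [G] is the divergence of [cutoff e (u x) *: X x], which vanishes near the
   boundary because [u] does, so that its extension by 0 is C^1. *)
Lemma integral_divergence_cutoff Omega u (X dX : 'I_N -> 'rV[R]_N -> R) (e : R) :
  open Omega -> bounded_set Omega -> C2_on Omega u ->
  {within closure Omega, continuous u} ->
  (forall x, boundary Omega x -> u x = 0) -> 0 < e ->
  (forall x, Omega x -> forall i, [/\ is_derive x (e_ i) (X i) (dX i x),
    {for x, continuous (X i)} & {for x, continuous (dX i)}]) ->
  let G x := if `[< Omega x >] then
    cutoff e (u x) * (\sum_i dX i x) + dcutoff e (u x) * (\sum_i partial i u x * X i x)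
    else 0 in
  (lebesgue_tuple R N).-integrable setT (EFin \o (G \o @row_of_tuple R N)) /\
  (\int[lebesgue_tuple R N]_t (G (row_of_tuple t))%:E = 0)%E.
Proof.
move=> oO bO C2 cu ubd e0 hX G.
have [L L0 hL] := bounded_set_coord bO.
pose F i x := if `[< Omega x >] then cutoff e (u x) * X i x else 0.
pose dF i x := if `[< Omega x >] then
  cutoff e (u x) * dX i x + X i x * (dcutoff e (u x) * partial i u x) else 0.
(* Only points of [Omega] are constrained, because nothing is known about [u] outside the closure. A
   boundary point uses continuity on the closure; any other point has a neighbourhood that misses
   [Omega]. *)
have outside x : ~ Omega x -> \forall z \near x, Omega z -> u z <= e.
  move=> nOx; have [xO|nxO] := pselect (closure Omega x).
    have bx : boundary Omega x by exact/open_boundaryE.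
    apply: filterS (within_continuous_near cu xO e0) => z h Oz.
    have := h (subset_closure Oz); rewrite ubd// sub0r normrN.
    by apply: le_trans; exact: ler_norm.
  have oC : open (~` closure Omega) by apply: closed_openC; exact: closed_closure.
  by apply: filterS (open_near oC nxO) => z nz Oz; case: nz; exact: subset_closure.
have GE x i : \forall z \near x, Omega x -> `[< Omega z >] = true.
  have [Ox|nOx] := pselect (Omega x); last by near=> z.
  by apply: filterS (open_near oO Ox) => z Oz _; exact/asboolP.
have out0 x (f : 'rV[R]_N -> R) : ~ Omega x ->
    (forall z, Omega z -> u z <= e -> f z = 0) ->
    \forall z \near x, (if `[< Omega z >] then f z else 0) = 0.
  move=> nOx h; apply: filterS (outside x nOx) => z hz.
  by case: asboolP => // Oz; rewrite h//; exact: hz.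
have in_eq x (f : 'rV[R]_N -> R) : Omega x ->
    \forall z \near x, f z = (if `[< Omega z >] then f z else 0).
  by move=> Ox; apply: filterS (open_near oO Ox) => z Oz; rewrite asboolT.
have F0 i x : Omega x -> u x <= e -> cutoff e (u x) * X i x = 0.
  by move=> _ /(cutoff_eq0 e0)[-> _]; rewrite mul0r.
have dF0 i x : Omega x -> u x <= e ->
    cutoff e (u x) * dX i x + X i x * (dcutoff e (u x) * partial i u x) = 0.
  by move=> _ /(cutoff_eq0 e0)[-> ->]; rewrite !mul0r mulr0 addr0.
have dFF i x : is_derive x (e_ i) (F i) (dF i x).
  have [Ox|nOx] := pselect (Omega x).
    rewrite /dF asboolT//; apply: near_eq_is_derive (in_eq x _ Ox) _.
    have [dXi _ _] := hX x Ox i; have [_ du _ _] := C2_onP i C2 Ox.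
    have dc := is_derive_chain du (is_derive_cutoff e (u x)).
    exact: is_deriveM dc dXi.
  rewrite /dF asboolF//.
  have nF : \forall z \near x, cst 0 z = F i z.
    by apply: filterS (out0 x _ nOx (F0 i)) => z; rewrite /F => ->.
  exact: (near_eq_is_derive nF (is_derive_cst 0 x (e_ i))).
have cdF i : continuous (dF i).
  move=> x; have [Ox|nOx] := pselect (Omega x).
    apply: continuous_near_eq (in_eq x _ Ox) _.
    have [_ cX cdX] := hX x Ox i; have [cux _ cdu _] := C2_onP i C2 Ox.
    have c1 : {for x, continuous (cutoff e \o u)}.
      apply: continuous_comp => //; apply/differentiable_continuous.
      by apply/derivable1_diffP; case: (is_derive_cutoff e (u x)).
    have c2 : {for x, continuous (dcutoff e \o u)}.
      by apply: continuous_comp => //; exact: continuous_dcutoff.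
    apply: (@continuousD _ _ _ (fun z => cutoff e (u z) * dX i z)).
      exact: (@continuousM _ _ (cutoff e \o u)).
    apply: (@continuousM _ _ (X i) (fun z => dcutoff e (u z) * partial i u z)) => //.
    exact: (@continuousM _ _ (dcutoff e \o u)).
  apply: (@continuous_near_eq _ _ _ (cst 0)); last exact: cst_continuous.
  by apply: filterS (out0 x _ nOx (dF0 i)) => z; rewrite /dF => ->.
have supp i x : (exists j, L <= `|x 0 j|) -> F i x = 0 /\ dF i x = 0.
  move=> [j Lj]; have nOx : ~ Omega x by move=> /hL/(_ j); rewrite ltNge Lj.
  by rewrite /F /dF !asboolF.
have Gsum x : G x = \sum_i dF i x.
  rewrite /G /dF; case: asboolP => _; last by rewrite big1.
  rewrite !mulr_sumr -big_split; apply: eq_bigr => i _ /=; ring.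
have intdF i : (lebesgue_tuple R N).-integrable setT
    (EFin \o (dF i \o @row_of_tuple R N)).
  by apply: (integrable_of_support L0 (cdF i)) => x /(supp i)[].
have -> : EFin \o (G \o @row_of_tuple R N) =
    (fun t => \sum_(i < N) (dF i (row_of_tuple t))%:E)%E.
  by apply/funext => t; rewrite /= Gsum sumEFin.
have E0 : (\int[lebesgue_tuple R N]_t (G (row_of_tuple t))%:E =
   \int[lebesgue_tuple R N]_t (\sum_(i < N) (dF i (row_of_tuple t))%:E))%E.
  by apply: eq_integral => t _; rewrite Gsum sumEFin.
split; first by apply: integrable_sum => // i _; exact: intdF.
rewrite E0 integral_sum//.
by apply: big1 => i _; exact: (integral_partial_eq0 L0 (cdF i) (dFF i) (supp i)).
Unshelve. all: by end_near. Qed.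

(** The only form in which the vanishing integral is used: [g] is bounded below by a gain on [B]
    minus a small loss on [Q], and the pointwise inequality becomes one between measures. *)
Lemma integral_zero_lower_bound d (T : measurableType d)
    (mu : {measure set T -> \bar R}) (g : T -> R) (B Q : set T) (k1 k2 : R) :
  measurable B -> measurable Q -> (mu B < +oo)%E -> (mu Q < +oo)%E ->
  mu.-integrable setT (EFin \o g) -> (\int[mu]_t (g t)%:E = 0)%E ->
  0 <= k1 -> 0 <= k2 ->
  (forall t, k1 * \1_B t <= g t + k2 * \1_Q t) ->
  (k1%:E * mu B <= k2%:E * mu Q)%E.
Proof.
move=> mB mQ fB fQ ig g0 k10 k20 h.
have mind k (A : set T) : measurable A -> measurable_fun setT (fun t => k * \1_A t : R).
  by move=> mA; apply: measurable_funM => //; exact: measurable_indic.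
have iQ : mu.-integrable setT (EFin \o (fun t => k2 * \1_Q t)).
  apply: (@bounded_support_integrable R _ _ _ Q _ k2) => //; first exact: mind.
    by move=> t; rewrite normrM ger0_norm// indicE; case: (_ \in _);
      rewrite ?normr1 ?normr0 ?mulr1 ?mulr0.
  by move=> t Qt; rewrite indicE memNset// mulr0.
have Eind k (A : set T) : measurable A -> 0 <= k ->
    (\int[mu]_t (k * \1_A t)%:E = k%:E * mu A)%E.
  move=> mA k0; under eq_integral do rewrite EFinM.
  rewrite ge0_integralZl//; last by apply/measurable_EFinP; exact: measurable_indic.
  by rewrite integral_indic// setIT.
rewrite -(Eind k1 B)// -(Eind k2 Q)// -[leRHS]add0e -g0 -integralD//.
apply: ge0_le_integral => //.
- by move=> t _; rewrite lee_fin mulr_ge0.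
- by apply/measurable_EFinP; exact: mind.
- by apply: emeasurable_funD; [exact: measurable_int ig|exact: measurable_int iQ].
- by move=> t _; rewrite -EFinD lee_fin.
Qed.

End divergence.

(** * Locally constant functions, balls and convexity *)

Section locally_constant.
Variables (R : realType) (N : nat).
Implicit Types (f : 'rV[R]_N -> R) (x y z p : 'rV[R]_N) (Omega : set 'rV[R]_N).

Local Notation e_ i := (delta_mx (0 : 'I_1) i : 'rV[R]_N).

(** Any condition on the value of [f] cuts out an open subset of [Omega], so the level set of [f x]
    is both open and closed in it. *)
Lemma zero_partials_constant Omega f : open Omega -> connected Omega ->
  (forall x, Omega x -> forall i, is_derive x (e_ i) f 0) ->
  forall x y, Omega x -> Omega y -> f x = f y.
Proof.
move=> oO conn df x y Ox Oy.
have loc z : Omega z -> \forall w \near z, Omega w /\ f w = f z.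
  move=> Oz; have [r r0 hr] := near_ball_rV (open_near oO Oz).
  apply: filterS (nbhsx_ballx z r r0) => w wB; split; first exact: hr.
  have pf v i : ball z r v -> partial i f v = 0.
    by move=> /hr Ov; have [_] := df v Ov i.
  have := @box_mean_value R N f z r 0 0 z w _ _ (ballxx z r0) wB.
  rewrite dot0l subr0 mul0r normr_le0 subr_eq0 => h; apply/eqP/h.
    by move=> v i /hr Ov; have [] := df v Ov i.
  by move=> v i vB; rewrite pf// mxE subrr normr0.
have oB (P : R -> Prop) : open [set z | Omega z /\ P (f z)].
  rewrite openE => z [Oz Pz]; apply: filterS (loc z Oz) => w [Ow fw].
  by split=> //; rewrite fw.
suff : [set z | Omega z /\ f z = f x] = Omega.
  by move=> E; have : Omega y by []; rewrite -E => -[_ ->].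
apply: conn.
- by exists x.
- exists [set z | Omega z /\ f z = f x]; first exact: (oB (fun v => v = f x)).
  by apply/seteqP; split=> z; [case=> ? ?; split|case=> _ []].
- exists (~` [set z | Omega z /\ f z <> f x]).
    by apply: open_closedC; exact: (oB (fun v => v <> f x)).
  apply/seteqP; split=> z; first by case=> Oz fz; split=> //; case.
  move=> [Oz /= h]; split=> //; apply: contrapT => fz; exact: h.
Qed.

Lemma continuous_sqdist p : continuous (fun x => dot (x - p) (x - p)).
Proof.
move=> x; have c i : {for x, continuous (fun y => (y - p) 0 i)}.
  have -> : (fun y => (y - p) 0 i) = (fun y => y 0 i - p 0 i).
    by apply/funext => y; rewrite !mxE.
  apply: (@continuousB _ _ _ (fun y : 'rV[R]_N => y 0 i) (cst (p 0 i))).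
    exact: coord_continuous.
  exact: cst_continuous.
exact: (@continuous_dot R N _ (fun y => y - p) (fun y => y - p) x c c).
Qed.

Lemma open_eball p (r : R) : 0 < r -> open (eball p r).
Proof.
move=> r0.
have -> : eball p r = (fun x => dot (x - p) (x - p)) @^-1` [set s | s < r ^+ 2].
  by apply/seteqP; split=> x /eballE; apply.
apply: open_comp; last exact: open_lt.
by move=> x _; exact: continuous_sqdist.
Qed.

Lemma closed_sqdist_le p (s : R) : closed [set x | dot (x - p) (x - p) <= s].
Proof.
apply: (@closed_comp _ _ (fun x => dot (x - p) (x - p)) [set t | t <= s]).
  by move=> x _; exact: continuous_sqdist.
exact: closed_le.
Qed.

Lemma sqdist_convex p x y (r t : R) : 0 <= t <= 1 ->
  dot (x - p) (x - p) < r -> dot (y - p) (y - p) < r ->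
  dot (t *: (y - x) + x - p) (t *: (y - x) + x - p) < r.
Proof.
move=> /andP[t0 t1] hx hy.
have -> : t *: (y - x) + x - p = t *: (y - p) + (1 - t) *: (x - p).
  by apply/rowP => i; rewrite !mxE; ring.
have := dot_ge0 ((y - p) - (x - p)).
move: hx hy; set v := y - p; set w := x - p; clearbody v w.
rewrite !dotE (dotC w v); move: (dot v v) (dot w w) (dot v w) => A B C hB hA.
move=> h.
(* The last factor is |v - w|^2, so the squared norm of the combination is at most t A + (1 - t)
   B. *)
rewrite [X in X < r](_ : _ = t * A + (1 - t) * B - t * (1 - t) * (A - C - (C - B)));
  last by ring.
have : 0 <= t * (1 - t) * (A - C - (C - B)).
  apply: mulr_ge0; last by move: h; lra.
  by apply: mulr_ge0 => //; rewrite subr_ge0.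
(* Strictness needs a weight bounded away from 0: one of t and 1 - t is at least 1/2. *)
have [|] := leP t (1 / 2) => tt; nra.
Qed.

End locally_constant.

(** * Serrin's theorem *)

Section p_function.
Variables (R : realType) (N : nat) (Omega : set 'rV[R]_N) (u : 'rV[R]_N -> R).
Variables (a c : R).
Hypotheses (N_gt0 : (0 < N)%N) (dOmega : bounded_domain Omega)
  (C2bd : C2_boundary Omega) (C2u : C2_closure Omega u)
  (lapu : forall x, Omega x -> laplacian u x = - (N%:R * a)) (a_gt0 : 0 < a)
  (ubd : forall x, boundary Omega x -> u x = 0)
  (unu : forall x nu, boundary Omega x -> outer_unit_normal Omega x nu ->
    has_normal_derivative Omega u x nu c).
Implicit Types (x y z v w p : 'rV[R]_N).

Local Notation e_ i := (delta_mx (0 : 'I_1) i : 'rV[R]_N).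

Let oO : open Omega. Proof. by case: dOmega. Qed.
Let cK : compact (closure Omega).
Proof. by apply: bounded_closure; case: dOmega. Qed.
Let C2 : C2_on Omega u. Proof. by case: C2u. Qed.
Let cu : {within closure Omega, continuous u}. Proof. by case: C2u. Qed.
Let N0 : 0 < N%:R :> R. Proof. by rewrite ltr0n. Qed.

Lemma torsion_ge0 x : closure Omega x -> 0 <= u x.
Proof.
move=> xO; rewrite -oppr_le0.
apply: (@maximum_principle R N (closure Omega) (fun z => - u z) 0) xO => //.
  by move=> z; apply: continuousN; exact: cu.
move=> z /(closure_cases oO)[Oz|/ubd ->]; [right|by left; rewrite oppr0].
split; first exact: subset_interior_closure.
have := has_laplacianZ (-1) (C2_on_has_laplacian oO C2 Oz).
rewrite lapu// mulN1r opprK => l; exists (N%:R * a).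
  by rewrite mulr_ge0// ltW.
by move: l; congr (has_laplacian _ _ _); apply/funext => y; rewrite mulN1r.
Qed.

(** An interior zero would be a minimum of [u], where the Laplacian cannot be negative. *)
Lemma torsion_gt0 x : Omega x -> 0 < u x.
Proof.
move=> Ox; rewrite lt_def torsion_ge0 ?andbT; last exact: subset_closure.
apply/eqP => ux.
have := has_laplacianZ (-1) (C2_on_has_laplacian oO C2 Ox).
rewrite lapu// mulN1r opprK => /laplacian_at_max.
have nmax : \forall z \near x, -1 * u z <= -1 * u x.
  apply: filterS (open_near oO Ox) => z Oz.
  by rewrite ux mulr0 mulN1r oppr_le0 torsion_ge0//; exact: subset_closure.
by move=> /(_ nmax); apply/negP; rewrite -ltNge mulr_gt0.
Qed.

(** The partial derivatives have limits at [x], which form a vector [G]. Its products with inward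
    directions are nonnegative because [u >= 0], so [G] is normal, and the overdetermined condition
    says G = c nu. *)
Lemma sqgrad_boundary x : boundary Omega x ->
  dot (grad u y) (grad u y) @[y --> within Omega (nbhs x)] --> c ^+ 2.
Proof.
move=> bx; have [V [phi dphi]] := C2bd bx.
have [xO _] := (open_boundaryE x oO).1 bx.
have PF : ProperFilter (within Omega (nbhs x)) by exact: within_nbhs_proper.
have /choice[g cg] : forall i, exists l : R,
    partial i u y @[y --> within Omega (nbhs x)] --> l.
  move=> i; case: C2u => _ _ /(_ i)[g [cg ug]] _; exists (g x).
  apply/cvgrPdist_le => e e0.
  apply: filterS2 (open_near openT I) (within_continuous_near cg xO e0).
  move=> y _ h Oy; rewrite ug ?inE//; apply: h; exact: subset_closure.
pose G : 'rV[R]_N := \row_i g i.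
have cdot w : dot (grad u y) w @[y --> within Omega (nbhs x)] --> dot G w.
  apply: cvg_sum_ord => i; apply: cvgMl; rewrite mxE.
  by under eq_fun do rewrite mxE; exact: cg.
have cdot2 : dot (grad u y) (grad u y) @[y --> within Omega (nbhs x)] --> dot G G.
  apply: cvg_sum_ord => i; apply: cvgM; rewrite mxE;
    by under eq_fun do rewrite mxE; exact: cg.
have [_ _ _ gphi _] := dphi.
set nphi := enorm (grad phi x).
have nphi0 : 0 < nphi by rewrite sqrtr_gt0 dot_gt0.
set nu := nphi^-1 *: grad phi x.
have nu1 : dot nu nu = 1.
  by rewrite /nu !dotE -enorm_sqr -/nphi expr2 mulKf ?mulVf// gt_eqF.
have cnu : dot (grad u y) nu @[y --> within Omega (nbhs x)] --> c.
  by apply: unu => //; exists V, phi.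
have Gc : dot G nu = c by apply: cvg_unique (cdot nu) cnu; exact: Rhausdorff.
have [] := @halfspace_parallel R N nu (- G) nu1.
  move=> w; rewrite /nu dotZr pmulr_rlt0 ?invr_gt0// => wphi.
  rewrite dotNr oppr_le0 dotC.
  apply: (@boundary_gradient_sign R N Omega u x V phi w G) => //; last exact: ubd.
  by move=> y Oy; apply: torsion_ge0; exact: subset_closure.
rewrite dotNl Gc scaleNr => /oppr_inj Gnu _.
by move: cdot2; rewrite Gnu dotZl dotZr nu1 mulr1 -expr2.
Qed.

(** Nearness to the boundary is measured by the size of [u], as a cutoff of [u] requires.
    Compactness makes it uniform: near an interior point, where [u] is positive, the premise
    [u x < d] fails for small [d]. *)
Lemma sqgrad_near_boundary (e : R) : 0 < e -> exists2 d : R, 0 < d &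
  forall x, Omega x -> u x < d -> `|c ^+ 2 - dot (grad u x) (grad u x)| <= e.
Proof.
move=> e0.
have : \forall t \near (0 : R)^'+, closure Omega `<=` (fun x =>
    Omega x -> u x < t -> `|c ^+ 2 - dot (grad u x) (grad u x)| <= e).
  apply: ((compact_near_coveringP _).1 cK) => x /(closure_cases oO)[Ox|bx].
    have ux := torsion_gt0 Ox; have ux2 : 0 < u x / 2 by rewrite divr_gt0.
    have [cux _ _ _] := C2_onP (Ordinal N_gt0) C2 Ox.
    exists ([set z | `|u x - u z| <= u x / 2], [set t | t < u x / 2]) => /=.
      split; first exact: near_le_of_continuous.
      exact: nbhs_right_lt.
    by move=> [z t] /= [+ tx] Oz ut; rewrite ler_norml => /andP[_]; lra.
  have /cvgrPdist_le/(_ _ e0) := sqgrad_boundary bx => h.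
  exists ([set z | Omega z -> `|c ^+ 2 - dot (grad u z) (grad u z)| <= e], setT).
    by split; [exact: h|exact: filterT].
  by move=> [z t] /= [+ _] Oz _; apply.
move=> /(filterI (nbhs_right_gt 0))/filter_ex[d [/= d0 hd]]; exists d => // x Ox.
by apply: hd => //; exact: subset_closure.
Qed.

Definition harmonic_part x : R := u x + a / 2 * dot x x.

Lemma harmonic_partP :
  [/\ C2_on Omega harmonic_part,
     forall x, Omega x -> grad harmonic_part x = grad u x + a *: x
   & forall x, Omega x -> laplacian harmonic_part x = 0].
Proof.
have [||||||h1 h2 h3] := @C2_on_explicit R N Omega harmonic_part
  (fun i x => partial i u x + a * x 0 i)
  (fun i j x => partial j (partial i u) x + a * (i == j)%:R).
- by [].
- move=> x Ox i; have [_ du _ _] := C2_onP i C2 Ox.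
  apply: is_deriveD du _.
  apply: (@is_derive_quadratic _ _ _ _ _ (a / 2) _ (a / 2 * dot x x)) => t.
  by rewrite !dotE (dotC (e_ i)) !dot_delta !mxE !eqxx /=; field.
- move=> x Ox i j; have [_ _ _ /(_ j)[du _]] := C2_onP i C2 Ox.
  apply: is_deriveD du _.
  apply: (@is_derive_quadratic _ _ _ _ _ 0 _ (a * x 0 i)) => t.
  by rewrite !mxE eqxx/=; ring.
- move=> x Ox; have [cux _ _ _] := C2_onP (Ordinal N_gt0) C2 Ox.
  apply: (@continuousD _ _ _ u) => //.
  apply: (@continuousM _ _ (cst (a / 2))); first exact: cst_continuous.
  by apply: continuous_dot => i; exact: coord_continuous.
- move=> x Ox i; have [_ _ cdu _] := C2_onP i C2 Ox.
  apply: (@continuousD _ _ _ (partial i u)) => //.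
  apply: (@continuousM _ _ (cst a)); first exact: cst_continuous.
  exact: coord_continuous.
- move=> x Ox i j; have [_ _ _ /(_ j)[_ cddu]] := C2_onP i C2 Ox.
  apply: (@continuousD _ _ _ (partial j (partial i u))) => //.
  exact: cst_continuous.
split=> // x Ox; first by apply/rowP => i; rewrite !mxE h2.
rewrite /laplacian; under eq_bigr => i _ do rewrite h3// eqxx mulr1.
rewrite big_split/= sumr_const card_ord -[X in _ + X]mulr_natl.
by have := lapu Ox; rewrite /laplacian => ->; rewrite addNr.
Qed.

Definition P_function x : R := dot (grad u x) (grad u x) + 2 * a * u x.

(* The last square vanishes at [x] for [y = x + a^-1 *: grad u x]: this is how the
   nonlinear [P] is bounded through functions that are linear in [h]. *)
Lemma euler_mean_P y x : Omega x ->
  2 * a * euler_mean harmonic_part y x =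
  P_function x + a ^+ 2 * dot y y -
  dot (grad u x + a *: (x - y)) (grad u x + a *: (x - y)).
Proof.
move=> Ox; have [_ gh _] := harmonic_partP.
rewrite /euler_mean gh// /P_function /harmonic_part !dotE.
rewrite (dotC (grad u x) x) (dotC (grad u x) y) (dotC y x).
by field.
Qed.

Lemma P_function_le x0 : Omega x0 -> P_function x0 <= c ^+ 2.
Proof.
move=> Ox0; apply/ler_addgt0Pr => e e0.
have e20 : 0 < e / 2 by rewrite divr_gt0.
have [d d0 hd] := sqgrad_near_boundary e20.
(* The three bounds ensure that |grad u|^2 is close to c^2 on the level set u = m, that [x0] lies in
   [K], and that the term 2 a u of [P] is at most e / 2 on that level set. *)
pose m := Num.min (d / 2) (Num.min (u x0) (e / 2 / (2 * a))).
have m0 : 0 < m by rewrite !lt_min !divr_gt0 ?mulr_gt0// torsion_gt0.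
have md : m < d.
  have : m <= d / 2 by rewrite ge_min lexx.
  by move: d0; clearbody m; lra.
have mu : m <= u x0 by rewrite !ge_min lexx !orbT.
have me : m * (2 * a) <= e / 2.
  by rewrite -ler_pdivlMr ?mulr_gt0// !ge_min lexx !orbT.
pose K := [set x | closure Omega x /\ m <= u x].
have KO : K `<=` Omega.
  move=> x [/(closure_cases oO)[//|/ubd ->]].
  by rewrite leNgt m0.
have cKK : compact K.
  apply: subclosed_compact cK _; last by move=> x [].
  move=> x xK; have xO : closure Omega x.
    exact: closureS KO _ xK.
  split=> //; rewrite leNgt; apply/negP => um.
  have em : 0 < (m - u x) / 2 by rewrite divr_gt0// subr_gt0.
  have [z [[zO uz] /(_ zO)]] := xK _ (within_continuous_near cu xO em).
  by rewrite ler_norml => /andP[+ _]; move: uz um; clearbody m; lra.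
pose y := x0 + a^-1 *: grad u x0.
have [hC2 _ hlap] := harmonic_partP.
have := @euler_mean_maximum R N Omega harmonic_part y K (fun=> 0)
  ((c ^+ 2 + e + a ^+ 2 * dot y y) / (2 * a)) N_gt0 oO hC2 hlap cKK KO.
have a20 : 0 < 2 * a by rewrite mulr_gt0.
have sqge0 x := dot_ge0 (grad u x + a *: (x - y)).
move=> /(_ (@cst_continuous _ _ 0)) h.
have {}h := h (fun x => ex_intro2 _ _ 0 (lexx 0) (has_laplacian_cst 0 x)).
have {h} : euler_mean harmonic_part y x0 + 0 <=
    (c ^+ 2 + e + a ^+ 2 * dot y y) / (2 * a).
  apply: h; last by split=> //; exact: subset_closure.
  move=> x Kx; have Ox := KO _ Kx; have [_] := Kx.
  rewrite le_eqVlt => /predU1P[um|um]; [left|right].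
    rewrite addr0 ler_pdivlMr// mulrC euler_mean_P//.
    have := hd x Ox; rewrite -um => /(_ md).
    rewrite ler_norml /P_function -um => /andP[+ _].
    move: (sqge0 x) me; clearbody m; lra.
  have [cux _ _ _] := C2_onP (Ordinal N_gt0) C2 Ox.
  have /cvgr_gt/(_ _ um) nu : u z @[z --> x] --> u x by exact: cux.
  apply: filterS2 nu (open_near oO Ox) => z mz Oz.
  by split; [exact: subset_closure|exact: ltW].
rewrite addr0 ler_pdivlMr// mulrC euler_mean_P//.
have -> : grad u x0 + a *: (x0 - y) = 0.
  rewrite /y opprD addNKr scalerN scalerA mulfV ?gt_eqF// scale1r.
  by rewrite subrr.
by rewrite dot0l subr0 lerD2r.
Qed.

(** Here [p] is the gradient, [y] the position, [H] the Hessian and [l] = N a. The Hessian terms [T]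
    of the first two summands cancel by symmetry, and the trace replaces the others by [l]. *)
Lemma pohozaev_algebra n (p y : 'I_n -> R) (H : 'I_n -> 'I_n -> R)
    (g A B k l : R) : (forall i j, H i j = H j i) -> \sum_i H i i = - l ->
  \sum_i (- (g * H i i + p i * \sum_j (y j * H i j + p j * (j == i)%:R))
    + (A + y i * ((\sum_j (p j * H i j + p j * H i j)) / 2 - l * p i))
    + (B * H i i + p i * - (k * p i))) =
  g * l + n%:R * A - l * (\sum_i y i * p i) - B * l - (1 + k) * \sum_i p i * p i.
Proof.
move=> HC lE; rewrite !big_split/=.
pose T := \sum_i \sum_j y j * (p i * H i j).
have T1 : \sum_i - (g * H i i + p i * \sum_j (y j * H i j + p j * (j == i)%:R)) =
    g * l - T - \sum_i p i * p i.
  rewrite sumrN big_split/= -mulr_sumr lE /T.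
  rewrite (eq_bigr (fun i => \sum_j y j * (p i * H i j) + p i * p i)); last first.
    move=> i _; rewrite big_split/= mulrDr mulr_sumr; congr (_ + _).
      by apply: eq_bigr => j _; rewrite mulrCA.
    congr (_ * _); rewrite (bigD1 i)//= eqxx mulr1 big1 ?addr0// => j ji.
    by rewrite (negbTE ji) mulr0.
  by rewrite big_split/=; ring.
have T2 : \sum_i y i * ((\sum_j (p j * H i j + p j * H i j)) / 2 - l * p i) =
    T - l * \sum_i y i * p i.
  rewrite /T exchange_big/= mulr_sumr -sumrB; apply: eq_bigr => i _.
  rewrite mulrBr; congr (_ - _); last by ring.
  have -> : \sum_j (p j * H i j + p j * H i j) = (\sum_j p j * H i j) * 2.
    by rewrite mulr_suml; apply: eq_bigr => j _; rewrite mulr_natr mulr2n.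
  rewrite mulfK ?pnatr_eq0// mulr_sumr; apply: eq_bigr => j _.
  by rewrite (HC i j).
have T3 : \sum_(i < n) A = n%:R * A by rewrite sumr_const card_ord mulr_natl.
have T4 : \sum_i B * H i i = B * - l by rewrite -mulr_sumr lE.
have T5 : \sum_i p i * - (k * p i) = - (k * \sum_i p i * p i).
  by rewrite mulr_sumr -sumrN; apply: eq_bigr => i _; ring.
by rewrite T1 T2 T3 T4 T5; ring.
Qed.

Lemma is_derive_sum_fun n (h : 'I_n -> 'rV[R]_N -> R) (d : 'I_n -> R) x v :
  (forall j, is_derive x v (h j) (d j)) ->
  is_derive x v (fun y => \sum_j h j y) (\sum_j d j).
Proof.
move=> hd; have := @is_derive_sum _ _ _ n h x v d hd.
by congr (is_derive _ _ _ _); apply/funext => y; rewrite fct_sumE.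
Qed.

Lemma is_derive_coord i j x : is_derive x (e_ j) (fun y => y 0 i) ((i == j)%:R : R).
Proof.
apply: (@is_derive_quadratic _ _ _ _ _ 0 _ (x 0 i)) => t.
by rewrite !mxE eqxx/=; ring.
Qed.

(** This takes the place of the Hopf lemma: [P] is positive inside and bounded by c^2. *)
Lemma c_sqr_gt0 : 0 < c ^+ 2.
Proof.
have [[x Ox] _ _ _] := dOmega; apply: lt_le_trans (P_function_le Ox).
by rewrite ltr_wpDl ?dot_ge0// !mulr_gt0// torsion_gt0.
Qed.

Let gu x := \sum_j x 0 j * partial j u x.
Let gg x := \sum_j partial j u x * partial j u x.

(* Minus the Pohozaev field, plus multiples of [u grad u] and [grad u] that turn
   its divergence into [N / 2 * (c^2 - P) - delta * N * a]. *)
Definition pohozaev (delta : R) i x : R :=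
  - (gu x * partial i u x) + (gg x / 2 - N%:R * a * u x + c ^+ 2 / 2) * x 0 i
  + (delta - (N%:R - 1) * u x) * partial i u x.

(** The terms are left as the Leibniz rule produces them, to match [pohozaev_algebra]. *)
Definition dpohozaev (delta : R) i x : R :=
  - (gu x * partial i (partial i u) x +
     partial i u x * \sum_j (x 0 j * partial i (partial j u) x +
                             partial j u x * (j == i)%:R))
  + ((gg x / 2 - N%:R * a * u x + c ^+ 2 / 2) +
     x 0 i * ((\sum_j (partial j u x * partial i (partial j u) x +
                       partial j u x * partial i (partial j u) x)) / 2
              - N%:R * a * partial i u x))
  + ((delta - (N%:R - 1) * u x) * partial i (partial i u) x +
     partial i u x * (- ((N%:R - 1) * partial i u x))).

Lemma pohozaev_derive delta x i : Omega x ->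
  [/\ is_derive x (e_ i) (pohozaev delta i) (dpohozaev delta i x),
    {for x, continuous (pohozaev delta i)} & {for x, continuous (dpohozaev delta i)}].
Proof.
move=> Ox; have hu j := C2_onP j C2 Ox.
have du : is_derive x (e_ i) u (partial i u x) by have [] := hu i.
have ddu j : is_derive x (e_ i) (partial j u) (partial i (partial j u) x).
  by have [_ _ _ /(_ i)[]] := hu j.
have cux : {for x, continuous u} by have [] := hu i.
have cdu j : {for x, continuous (partial j u)} by have [] := hu j.
have cddu j : {for x, continuous (partial i (partial j u))}.
  by have [_ _ _ /(_ i)[]] := hu j.
have cx j : {for x, continuous (fun y : 'rV[R]_N => y 0 j)} by exact: coord_continuous.
have dgu : is_derive x (e_ i) gu (\sum_j (x 0 j * partial i (partial j u) x +
    partial j u x * (j == i)%:R)).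
  apply: is_derive_sum_fun => j; exact: is_deriveM (is_derive_coord j i x) (ddu j).
have dgg : is_derive x (e_ i) gg (\sum_j (partial j u x * partial i (partial j u) x +
    partial j u x * partial i (partial j u) x)).
  apply: is_derive_sum_fun => j; exact: is_deriveM (ddu j) (ddu j).
have cgu : {for x, continuous gu}.
  by apply: continuous_sum_ord => j; apply: continuousM.
have cgg : {for x, continuous gg}.
  by apply: continuous_sum_ord => j; apply: continuousM.
have cc k : {for x, continuous (cst k : 'rV[R]_N -> R)} by exact: cst_continuous.
(* The rules are restated for pointwise operations, so that the proofs below are terms that follow
   the shape of the formulas. *)
have cM (f g : 'rV[R]_N -> R) : {for x, continuous f} -> {for x, continuous g} ->
  {for x, continuous (fun y => f y * g y)} by exact: continuousM.
have cD (f g : 'rV[R]_N -> R) : {for x, continuous f} -> {for x, continuous g} ->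
  {for x, continuous (fun y => f y + g y)} by exact: continuousD.
have cN (f : 'rV[R]_N -> R) : {for x, continuous f} ->
  {for x, continuous (fun y => - f y)} by exact: continuousN.
have cS (h : 'I_N -> 'rV[R]_N -> R) : (forall j, {for x, continuous (h j)}) ->
  {for x, continuous (fun y => \sum_j h j y)} by exact: continuous_sum_ord.
have dM (f g : 'rV[R]_N -> R) df dg : is_derive x (e_ i) f df ->
    is_derive x (e_ i) g dg ->
    is_derive x (e_ i) (fun y => f y * g y) (f x * dg + g x * df).
  by move=> hf hg; exact: (is_deriveM hf hg).
have dD (f g : 'rV[R]_N -> R) df dg : is_derive x (e_ i) f df ->
    is_derive x (e_ i) g dg -> is_derive x (e_ i) (fun y => f y + g y) (df + dg).
  by move=> hf hg; exact: (is_deriveD hf hg).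
have dN (f : 'rV[R]_N -> R) df : is_derive x (e_ i) f df ->
    is_derive x (e_ i) (fun y => - f y) (- df).
  by move=> hf; exact: (is_deriveN hf).
have dC k : is_derive x (e_ i) (fun=> k : R) 0 by exact: is_derive_cst.
have cA := cD _ _ (cD _ _ (cM _ _ cgg (cc 2^-1)) (cN _ (cM _ _ (cc (N%:R * a)) cux)))
  (cc (c ^+ 2 / 2)).
have cB := cD _ _ (cc delta) (cN _ (cM _ _ (cc (N%:R - 1)) cux)).
split.
- have h1 := dN _ _ (dM _ _ _ _ dgu (ddu i)).
  have h2 := dM _ _ _ _ (dD _ _ _ _ (dD _ _ _ _ (dM _ _ _ _ dgg (dC 2^-1))
    (dN _ _ (dM _ _ _ _ (dC (N%:R * a)) du))) (dC (c ^+ 2 / 2)))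
    (is_derive_coord i i x).
  have h3 := dM _ _ _ _ (dD _ _ _ _ (dC delta)
    (dN _ _ (dM _ _ _ _ (dC (N%:R - 1)) du))) (ddu i).
  apply: (is_derive_eq (dD _ _ _ _ (dD _ _ _ _ h1 h2) h3)).
  rewrite /dpohozaev eqxx /=; set s1 := \sum_j _; set s2 := \sum_j _.
  set g1 := gu x; set g2 := gg x; set h := partial i _ x; set p := partial i u x.
  by clearbody s1 s2 g1 g2 h p; field.
- exact: (cD _ _ (cD _ _ (cN _ (cM _ _ cgu (cdu i))) (cM _ _ cA (cx i)))
    (cM _ _ cB (cdu i))).
- have cs1 := cS _ (fun j => cD _ _ (cM _ _ (cx j) (cddu j))
    (cM _ _ (cdu j) (cc (j == i)%:R))).
  have cs2 := cS _ (fun j => cD _ _ (cM _ _ (cdu j) (cddu j))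
    (cM _ _ (cdu j) (cddu j))).
  have k1 := cN _ (cD _ _ (cM _ _ cgu (cddu i)) (cM _ _ (cdu i) cs1)).
  have k2 := cD _ _ cA (cM _ _ (cx i) (cD _ _ (cM _ _ cs2 (cc 2^-1))
    (cN _ (cM _ _ (cc (N%:R * a)) (cdu i))))).
  have k3 := cD _ _ (cM _ _ cB (cddu i))
    (cM _ _ (cdu i) (cN _ (cM _ _ (cc (N%:R - 1)) (cdu i)))).
  exact: (cD _ _ (cD _ _ k1 k2) k3).
Qed.

Let HC i j x : Omega x -> partial i (partial j u) x = partial j (partial i u) x.
Proof. by move=> Ox; rewrite (partialC _ _ oO C2 Ox). Qed.

Lemma divergence_pohozaev delta x : Omega x ->
  \sum_i dpohozaev delta i x =
  N%:R / 2 * (c ^+ 2 - P_function x) - delta * (N%:R * a).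
Proof.
move=> Ox; rewrite /dpohozaev.
rewrite (@pohozaev_algebra N (fun i => partial i u x) (fun i => x 0 i)
  (fun i j => partial i (partial j u) x) (gu x)
  (gg x / 2 - N%:R * a * u x + c ^+ 2 / 2) (delta - (N%:R - 1) * u x)
  (N%:R - 1) (N%:R * a)); first last.
- exact: lapu.
- by move=> i j; exact: HC.
have ggE : dot (grad u x) (grad u x) = gg x.
  by apply: eq_bigr => i _; rewrite mxE.
rewrite /P_function ggE -/(gu x) -/(gg x).
by move: (gu x) (gg x) (u x) => s1 s2 s3; field.
Qed.

(** Where u = 0 and |grad u|^2 = c^2, the right-hand side reduces to delta * c^2. *)
Lemma pohozaev_dot_grad delta x :
  \sum_i partial i u x * pohozaev delta i x =
  - (gu x * (gg x + 2 * (N%:R * a) * u x - c ^+ 2)) / 2 +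
  (delta - (N%:R - 1) * u x) * gg x.
Proof.
rewrite /pohozaev.
rewrite (eq_bigr (fun i => - gu x * (partial i u x * partial i u x) +
  (gg x / 2 - N%:R * a * u x + c ^+ 2 / 2) * (x 0 i * partial i u x) +
  (delta - (N%:R - 1) * u x) * (partial i u x * partial i u x))); last first.
  move=> i _; move: (gu x) (gg x) => s1 s2; ring.
rewrite !big_split/= -!mulr_sumr -/(gg x) -/(gu x).
by move: (gu x) (gg x) => s1 s2; field.
Qed.

Lemma pohozaev_dot_grad_ge0 delta : 0 < delta -> exists2 tau : R, 0 < tau &
  forall x, Omega x -> u x < tau ->
    0 <= \sum_i partial i u x * pohozaev delta i x.
Proof.
move=> d0; have c0 := c_sqr_gt0; have [D D0 hD] := compact_dot_bounded cK.
(* From |x . grad u| <= (|x|^2 + |grad u|^2) / 2, |x|^2 <= D and |grad u|^2 >= c^2 / 2 it follows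
   that |x . grad u| <= C |grad u|^2. *)
pose C := (2 * D / c ^+ 2 + 1) / 2.
have q0 : 0 < 2 * D / c ^+ 2 by apply: divr_gt0 => //; exact: mulr_gt0.
have C0 : 0 < C by apply: divr_gt0 => //; exact: addr_gt0.
(* All unwanted terms together are at most t k |grad u|^2, where [t] bounds both [u] and the
   deviation of |grad u|^2 from c^2; hence the requirement t k <= delta. *)
pose k := C / 2 * (1 + 2 * (N%:R * a)) + N%:R.
have Na0 : 0 < N%:R * a by rewrite mulr_gt0.
have k0 : 0 < k.
  by apply: addr_gt0 => //; apply: mulr_gt0; [exact: divr_gt0|rewrite addr_gt0// mulr_gt0].
pose t := Num.min (c ^+ 2 / 2) (delta / k).
have t0 : 0 < t by rewrite lt_min; apply/andP; split; exact: divr_gt0.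
have tc : t <= c ^+ 2 / 2 by rewrite ge_min lexx.
have tk : t * k <= delta by rewrite -ler_pdivlMr// ge_min lexx orbT.
have [d dd0 hd] := sqgrad_near_boundary t0.
exists (Num.min d t) => [|x Ox]; first by rewrite lt_min dd0.
rewrite lt_min => /andP[ud ut].
have u0 : 0 < u x := torsion_gt0 Ox.
have ggE : dot (grad u x) (grad u x) = gg x.
  by apply: eq_bigr => i _; rewrite mxE.
have guE : dot x (grad u x) = gu x by apply: eq_bigr => i _; rewrite mxE.
have := hd x Ox ud; rewrite ggE ler_norml => /andP[g1 g2].
have xD := hD x (subset_closure Ox).
have p1 := dot_ge0 (x - grad u x); have p2 := dot_ge0 (x + grad u x).
move: p1 p2; rewrite !dotE (dotC (grad u x) x) ggE guE => p1 p2.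
rewrite pohozaev_dot_grad.
have gC : `|gu x| <= C * gg x.
  have h1 : D <= 2 * D / c ^+ 2 * gg x.
    rewrite mulrAC ler_pdivlMr//; nra.
  have h2 : D + gg x <= 2 * (C * gg x).
    by rewrite /C; move: h1; set q := 2 * D / c ^+ 2; clearbody q; lra.
  by rewrite ler_norml; apply/andP; split; lra.
have N1 : 1 <= N%:R :> R by rewrite ler1n.
have b1 : `|gg x + 2 * (N%:R * a) * u x - c ^+ 2| <= t * (1 + 2 * (N%:R * a)).
  rewrite ler_norml; move: (N%:R * a) Na0 => n n0.
  by apply/andP; split; nra.
have b2 : `|gu x * (gg x + 2 * (N%:R * a) * u x - c ^+ 2)| <=
    C * gg x * (t * (1 + 2 * (N%:R * a))).
  by rewrite normrM ler_pM.
have b3 : (N%:R - 1) * u x <= N%:R * t by nra.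
have gg0 : 0 <= gg x by rewrite -ggE dot_ge0.
move: b2; rewrite ler_norml => /andP[_ b2].
have b4 : 0 <= gg x * (delta - t * k) by rewrite mulr_ge0// subr_ge0.
have b5 : 0 <= gg x * (N%:R * t - (N%:R - 1) * u x) by rewrite mulr_ge0// subr_ge0.
move: b2 b4 b5; rewrite /k.
set w := gu x * _; set n := N%:R; clearbody w.
move: (gg x) (u x) => s1 s2 b2 b4 b5.
clearbody n C t; nra.
Qed.

Lemma continuous_P_function x : Omega x -> {for x, continuous P_function}.
Proof.
move=> Ox; have [cux _ _ _] := C2_onP (Ordinal N_gt0) C2 Ox.
apply: (@continuousD _ _ _ (fun y => dot (grad u y) (grad u y))).
  apply: continuous_dot => i.
    have -> : (fun y => grad u y 0 i) = partial i u by apply/funext => y; rewrite mxE.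
    by have [] := C2_onP i C2 Ox.
  have -> : (fun y => grad u y 0 i) = partial i u by apply/funext => y; rewrite mxE.
  by have [] := C2_onP i C2 Ox.
by apply: (@continuousM _ _ (cst (2 * a))) => //; exact: cst_continuous.
Qed.

(** A strict inequality at [x] persists on a box [B], and there the divergence of the field gains a
    fixed amount. The loss due to delta over the enclosing box [Q] is made half as large, while the
    weighted divergence integrates to 0. *)
Lemma P_function_eq x : Omega x -> P_function x = c ^+ 2.
Proof.
move=> Ox; apply/eqP; rewrite eq_le P_function_le//= leNgt; apply/negP => Pc.
have bO : bounded_set Omega by case: dOmega.
pose k0 := (c ^+ 2 - P_function x) / 2; have k00 : 0 < k0 by rewrite divr_gt0 ?subr_gt0.
have u0 := torsion_gt0 Ox; have u20 : 0 < u x / 2 by rewrite divr_gt0.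
have [cux _ _ _] := C2_onP (Ordinal N_gt0) C2 Ox.
have [r r0 hr] : exists2 r : R, 0 < r & forall z, ball x r z ->
    [/\ Omega z, k0 <= c ^+ 2 - P_function z & u x / 2 <= u z].
  apply: near_ball_rV; have := near_le_of_continuous (continuous_P_function Ox) k00.
  move=> nP; apply: filterS3 (open_near oO Ox) nP (near_le_of_continuous cux u20).
  move=> z Oz Pz uz; split=> //.
    by move: Pz; rewrite ler_norml /k0 => /andP[+ _]; lra.
  by move: uz; rewrite ler_norml => /andP[_]; lra.
have [L L0 hL] := bounded_set_coord bO.
pose B := [set t : N.-tuple R | forall i, x 0 i - r < tnth t i < x 0 i + r].
pose Q := [set t : N.-tuple R | forall i, - L < tnth t i < L].
have EB : lebesgue_tuple R N B = (\prod_(i < N) (x 0 i + r - (x 0 i - r)))%:E.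
  by apply: (@lebesgue_tuple_boxE R N (fun i => x 0 i - r) (fun i => x 0 i + r)) => i; lra.
have EQ : lebesgue_tuple R N Q = (\prod_(i < N) (L - - L))%:E.
  by apply: (@lebesgue_tuple_boxE R N (fun i => - L) (fun i => L)) => i; lra.
have mB : measurable B by exact: measurable_tuple_box.
have mQ : measurable Q by exact: (measurable_tuple_box (fun=> - L) (fun=> L)).
set vB := \prod_i _ in EB; set vQ := \prod_i _ in EQ.
have vB0 : 0 < vB by apply: prodr_gt0 => i _; lra.
have vQ0 : 0 < vQ by apply: prodr_gt0 => i _; lra.
clearbody vB vQ.
pose k1 := N%:R / 2 * k0; have k10 : 0 < k1 by rewrite mulr_gt0// divr_gt0.
have Na0 : 0 < N%:R * a by rewrite mulr_gt0.
(* Chosen so that the loss over [Q] is exactly half of the gain k1 vB. *)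
pose delta := k1 * vB / 2 / (N%:R * a * vQ).
have d0 : 0 < delta.
  by apply: divr_gt0; [apply: divr_gt0 => //|]; exact: mulr_gt0.
have dE : delta * (N%:R * a) * vQ = k1 * vB / 2.
  by rewrite /delta -mulrA divfK// mulf_neq0// gt_eqF.
have [tau tau0 htau] := pohozaev_dot_grad_ge0 d0.
(* The first bound confines the support of [dcutoff] to the region where the sign of grad u . X is
   known; the second makes the cutoff equal to 1 on [B]. *)
pose e := Num.min (tau / 2) (u x / 4).
have e0 : 0 < e by rewrite lt_min; apply/andP; split; exact: divr_gt0.
have etau : 2 * e <= tau.
  have : e <= tau / 2 by rewrite ge_min lexx.
  by clearbody e; lra.
have eux : 2 * e <= u x / 2.
  have : e <= u x / 4 by rewrite ge_min lexx orbT.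
  by clearbody e; lra.
have [intG G0] := integral_divergence_cutoff oO bO C2 cu ubd e0
  (fun x Ox i => pohozaev_derive delta i Ox).
have := integral_zero_lower_bound mB mQ _ _ intG G0 (ltW k10)
  (ltW (mulr_gt0 d0 Na0)).
rewrite EB EQ !ltry -!EFinM lee_fin dE => /(_ isT isT) h.
suff : k1 * vB <= k1 * vB / 2 by have := mulr_gt0 k10 vB0; lra.
apply: h => t; rewrite !indicE /=.
have tB : t \in B -> ball x r (row_of_tuple t).
  rewrite inE => h; apply/(ball_rVP _ _ r0) => i; rewrite mxE.
  by have := h i => /andP[? ?]; rewrite ltr_norml; apply/andP; split; lra.
have [Ot|nOt] := asboolP (Omega (row_of_tuple t)); last first.
  have -> : (t \in B) = false by apply/negP => /tB/hr[].
  by rewrite mulr0 add0r mulr_ge0// mulr_ge0// ltW.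
have -> : t \in Q.
  rewrite inE => i; have := hL _ Ot i; rewrite mxE ltr_norml; exact.
rewrite divergence_pohozaev// !mulr1.
have [/andP[c0 c1] dc0] := cutoff_bounds (u (row_of_tuple t)) e0.
have Ple := P_function_le Ot.
have S0 : 0 <= dcutoff e (u (row_of_tuple t)) *
    \sum_i partial i u (row_of_tuple t) * pohozaev delta i (row_of_tuple t).
  have [ue|ue] := leP (2 * e) (u (row_of_tuple t)).
    by have [_ ->] := cutoff_eq1 e0 ue; rewrite mul0r.
  by apply: mulr_ge0 => //; apply: htau => //; exact: lt_le_trans etau.
have key : k1 * (t \in B)%:R <= cutoff e (u (row_of_tuple t)) *
    (N%:R / 2 * (c ^+ 2 - P_function (row_of_tuple t))).
  have [/tB/hr[_ Pk uu]|_] := boolP (t \in B); last first.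
    rewrite mulr0 mulr_ge0// mulr_ge0 ?subr_ge0// ltW// divr_gt0//.
  have [-> _] := cutoff_eq1 e0 (le_trans eux uu).
  by rewrite mulr1 mul1r ler_wpM2l// ltW// divr_gt0.
have dNa : 0 < delta * (N%:R * a) by exact: mulr_gt0.
move: key S0 c0 c1 dNa; set A := N%:R / 2 * _; set S := dcutoff _ _ * _.
set w := cutoff _ _; set b := k1 * _; set D := delta * _.
by clearbody A S w b D => key S0 c0 c1 dNa; nra.
Qed.

(* If [m], the gradient of [partial i h] at [x0], were nonzero, then near [x0] the
   limit of harmonic functions [euler_mean h y] would lie below
   [C - (m . z)^2 / 2 + k |z|^2], up to the factor [(2 a)^-1] and with
   [z = x - x0], while attaining [C] at [x0]. Adding the subharmonic
   [(m . z)^2 / 2 - 2 k |z|^2] contradicts the maximum principle. *)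
Lemma hessian_harmonic_eq0 x0 i j : Omega x0 ->
  partial j (partial i harmonic_part) x0 = 0.
Proof.
move=> Ox0; have [hC2 gh hlap] := harmonic_partP.
set h := harmonic_part in hC2 gh hlap *.
suff : grad (partial i h) x0 = 0 by move=> /rowP/(_ j); rewrite !mxE.
apply: contrapT => /eqP m0; set m := grad (partial i h) x0 in m0.
have dm := dot_gt0 m0.
have N30 : 0 < 4 * N%:R ^+ 3 :> R by rewrite mulr_gt0// exprn_gt0.
(* The Laplacian of [W] is nonnegative when 4 N k <= |m|^2. In N^3, two factors come from bounding
   the l^1 norm in [k] and one from the Laplacian of |z|^2; eps <= 1 reduces eps^2 to eps. *)
pose eps := Num.min 1 (dot m m / (4 * N%:R ^+ 3)).
have eps0 : 0 < eps by rewrite lt_min ltr01/=; exact: divr_gt0.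
have eps1 : eps <= 1 by rewrite ge_min lexx.
have epsm : eps * (4 * N%:R ^+ 3) <= dot m m.
  by rewrite -ler_pdivlMr// ge_min lexx orbT.
pose k := eps ^+ 2 * N%:R ^+ 2.
have k0 : 0 < k by rewrite mulr_gt0// exprn_gt0.
have km : 4 * N%:R * k <= dot m m.
  apply: le_trans epsm; rewrite /k.
  have -> : 4 * N%:R * (eps ^+ 2 * N%:R ^+ 2) = eps * (eps * (4 * N%:R ^+ 3)) by ring.
  by rewrite ler_piMl// mulr_ge0 ?ltW.
have [r1 r10 h1] := C1_expansion (C2_on_C1_at_partial i oO hC2 Ox0) eps0.
have [r2 r20 h2] := near_ball_rV (open_near oO Ox0).
have r0 : 0 < Num.min r1 r2 by rewrite lt_min r10.
have rr1 : Num.min r1 r2 <= r1 by rewrite ge_min lexx.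
have rr2 : Num.min r1 r2 <= r2 by rewrite ge_min lexx orbT.
set r := Num.min r1 r2 in r0 rr1 rr2.
pose rho := r / 2; have rho0 : 0 < rho by rewrite divr_gt0.
have rhor : rho < r by rewrite /rho; clearbody r; lra.
pose K := [set x | dot (x - x0) (x - x0) <= rho ^+ 2].
have KB x : K x -> ball x0 r x.
  move=> Kx; apply/(ball_rVP _ _ r0) => l; apply: le_lt_trans rhor.
  rewrite -(@ler_pXn2r _ 2)// ?nnegrE ?(ltW rho0)// real_normK ?num_real//.
  have Kx' : dot (x - x0) (x - x0) <= rho ^+ 2 := Kx.
  by apply: le_trans Kx'; have := dot_coord_le (x - x0) l; rewrite !mxE -sqrrN opprB.
have KO : K `<=` Omega by move=> x /KB xB; apply: h2; exact: le_ball xB.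
have cKK : compact K.
  apply: subclosed_compact cK _; first exact: closed_sqdist_le.
  by move=> x /KO; exact: subset_closure.
pose y := x0 + a^-1 *: grad u x0.
have ay : a *: y = a *: x0 + grad u x0.
  by rewrite /y scalerDr scalerA mulfV ?gt_eqF// scale1r.
pose W x := (2 * a)^-1 * (2^-1 * dot m (x - x0) ^+ 2 + - (2 * k) * dot (x - x0) (x - x0)).
pose C := (c ^+ 2 + a ^+ 2 * dot y y) / (2 * a).
have a20 : 0 < 2 * a by rewrite mulr_gt0.
have Elow x : K x -> euler_mean h y x + W x <= C - (2 * a)^-1 * (k * dot (x - x0) (x - x0)).
  move=> Kx; have Ox := KO _ Kx.
  have EP := euler_mean_P y Ox; rewrite (P_function_eq Ox) -/h in EP.
  have gE : grad u x + a *: (x - y) = grad h x - grad h x0.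
    by rewrite !gh// scalerBr ay opprD [- (a *: x0) - _]addrC addrA opprD addrA addrAC.
  rewrite gE in EP.
  have vi : (partial i h x - partial i h x0) ^+ 2 <=
      dot (grad h x - grad h x0) (grad h x - grad h x0).
    by have := dot_coord_le (grad h x - grad h x0) i; rewrite !mxE.
  have := h1 x0 x (ballxx x0 r10) (le_ball rr1 (KB _ Kx)); rewrite -/m.
  set s := dot m (x - x0); set v := partial i h x - partial i h x0 in vi *.
  set z2 := dot (x - x0) (x - x0).
  have z20 : 0 <= z2 by exact: dot_ge0.
  have sumz : \sum_l `|x 0 l - x0 0 l| <= N%:R * enorm (x - x0).
    apply: (@le_trans _ _ (\sum_(l < N) enorm (x - x0))).
      apply: ler_sum => l _; rewrite -(@ler_pXn2r _ 2)// ?nnegrE ?enorm_ge0//.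
      rewrite real_normK ?num_real// enorm_sqr.
      by have := dot_coord_le (x - x0) l; rewrite !mxE.
    by rewrite sumr_const card_ord [leRHS]mulr_natl.
  move=> vs; have vs2 : (v - s) ^+ 2 <= k * z2.
    rewrite -[_ ^+ 2]real_normK ?num_real// /k /z2 -enorm_sqr -!exprMn.
    rewrite ler_pXn2r ?nnegrE// ?mulr_ge0 ?enorm_ge0 ?(ltW eps0)//.
    by apply: le_trans vs _; rewrite -mulrA ler_wpM2l// ltW.
  have EC : euler_mean h y x = C -
      (2 * a)^-1 * dot (grad h x - grad h x0) (grad h x - grad h x0).
    apply: (mulfI (lt0r_neq0 a20)); rewrite EP /C.
    set D := dot (_ - _) _; set yy := dot y y; clearbody D yy.
    by field; rewrite gt_eqF.
  rewrite EC /W -/s -/z2.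
  have i20 : 0 < (2 * a)^-1 by rewrite invr_gt0.
  move: vi vs2 i20; set D := dot (_ - _) (_ - _); set b := (2 * a)^-1.
  clearbody D b s v z2 k => vi vs2 i20.
  rewrite -addrA lerD2l -mulrN -mulrDr -[leRHS]mulrN ler_pM2l//.
  (* This square is twice v^2 + (v - s)^2 - s^2 / 2, so s^2 / 2 <= D + k z2. *)
  have := sqr_ge0 (2 * v - s); nra.
have := @euler_mean_maximum R N Omega h y K W (C - (2 * a)^-1 * (k * rho ^+ 2))
  N_gt0 oO hC2 hlap cKK KO.
have cW : continuous W.
  move=> x; suff : {for x, continuous W} by [].
  rewrite /W.
  apply: (@continuousM _ _ (cst (2 * a)^-1)); first exact: cst_continuous.
  have cz l : {for x, continuous (fun y => (y - x0) 0 l)}.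
    have -> : (fun y => (y - x0) 0 l) = (fun y => y 0 l - x0 0 l).
      by apply/funext => z; rewrite !mxE.
    apply: (@continuousB _ _ _ (fun y : 'rV[R]_N => y 0 l) (cst (x0 0 l))).
      exact: coord_continuous.
    exact: cst_continuous.
  have cm : {for x, continuous (fun y => dot m (y - x0))}.
    apply: (@continuous_dot R N _ (fun=> m) (fun y => y - x0)) => // l.
    exact: cst_continuous.
  apply: (@continuousD _ _ _ (fun y => 2^-1 * dot m (y - x0) ^+ 2)).
    apply: (@continuousM _ _ (cst 2^-1)); first exact: cst_continuous.
    exact: (@continuousM _ _ (fun y => dot m (y - x0)) (fun y => dot m (y - x0))).
  apply: (@continuousM _ _ (cst (- (2 * k)))); first exact: cst_continuous.
  exact: continuous_sqdist.
have lW x : exists2 l, 0 <= l & has_laplacian W x l.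
  exists ((2 * a)^-1 * (2^-1 * (2 * dot m m) + - (2 * k) * (2 * N%:R))); last first.
    apply: has_laplacianZ; apply: has_laplacianD; apply: has_laplacianZ.
      exact: has_laplacian_sqdot.
    exact: has_laplacian_sqdist.
  apply: mulr_ge0; first by rewrite invr_ge0 ltW.
  by rewrite mulKf// mulNr subr_ge0; apply: le_trans km; clearbody k; lra.
have i20 : 0 < (2 * a)^-1 by rewrite invr_gt0.
move=> /(_ cW lW) hmax.
have : euler_mean h y x0 + W x0 <= C - (2 * a)^-1 * (k * rho ^+ 2).
  apply: hmax; last by rewrite /K /= subrr dot0l exprn_ge0// ltW.
  move=> x Kx; have := Kx; rewrite {1}/K /= le_eqVlt => /predU1P[xr|xr]; [left|right].
    by have := Elow x Kx; rewrite xr.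
  have /cvgr_lt/(_ _ xr) nx : dot (z - x0) (z - x0) @[z --> x] --> dot (x - x0) (x - x0).
    exact: continuous_sqdist.
  by apply: filterS nx => z; exact: ltW.
rewrite {1}/W subrr dot0l dotC dot0l expr0n !mulr0 addr0 mulr0 addr0.
have -> : euler_mean h y x0 = C.
  apply: (mulfI (lt0r_neq0 a20)); rewrite euler_mean_P// P_function_eq//.
  have -> : grad u x0 + a *: (x0 - y) = 0 by rewrite scalerBr ay opprD addNKr subrr.
  by rewrite dot0l subr0 /C [RHS]mulrC divfK ?gt_eqF.
rewrite lerBrDr gerDl => hle.
have : 0 < (2 * a)^-1 * (k * rho ^+ 2) by rewrite !mulr_gt0// exprn_gt0.
by rewrite ltNge hle.
Qed.

Lemma torsion_quadratic : exists (p : 'rV[R]_N) (s : R), forall x,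
  closure Omega x -> u x = a / 2 * (s - dot (x - p) (x - p)).
Proof.
have [hC2 gh _] := harmonic_partP; have [[x0 Ox0] _ conn _] := dOmega.
set h := harmonic_part in hC2 gh.
have ch i x : Omega x -> partial i h x = partial i h x0.
  move=> Ox; apply: (zero_partials_constant oO conn) Ox Ox0 => z Oz j.
  have [_ _ _ /(_ j)[dh _]] := C2_onP i hC2 Oz.
  by move: dh; rewrite /h hessian_harmonic_eq0.
pose b := grad h x0.
have hE x : Omega x -> h x - dot b x = h x0 - dot b x0.
  move=> Ox; apply: (@zero_partials_constant R N Omega (fun z => h z - dot b z) oO conn) => //.
  move=> z Oz i; have [_ dh _ _] := C2_onP i hC2 Oz.
  have := is_deriveB dh (is_derive_dot b z (e_ i)).
  by rewrite dot_delta mxE ch// subrr.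
(* [harmonic_part] is now affine with slope [b], so [u] is an affine function minus (a / 2) |x|^2;
   [p] and [s] complete the square. *)
have [p pE] : exists p, p = a^-1 *: b by eexists.
pose s := 2 / a * (h x0 - dot b x0) + dot p p.
exists p, s => x xO; set q := a / 2 * _.
have qE z : Omega z -> u z = a / 2 * (s - dot (z - p) (z - p)).
  move=> Oz; have := hE z Oz; rewrite {1}/h /harmonic_part.
  move=> /eqP; rewrite subr_eq => /eqP E; rewrite /s.
  have bp : dot b z = a * dot p z.
    by rewrite pE dotZl mulrA mulfV ?gt_eqF// mul1r.
  rewrite !dotE (dotC z p); move: E; rewrite bp.
  set k := h x0 - _; clearbody k => E.
  have -> : u z = k + a * dot p z - a / 2 * dot z z by rewrite -E addrK.
  move: (dot p z) (dot z z) (dot p p) => A B C.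
  by field; rewrite gt_eqF.
apply/eqP; rewrite -subr_eq0 -normr_le0; apply/ler_addgt0Pr => e e0; rewrite add0r.
have e20 : 0 < e / 2 by rewrite divr_gt0.
have cq : {for x, continuous (fun z => a / 2 * (s - dot (z - p) (z - p)))}.
  apply: (@continuousM _ _ (cst (a / 2))); first exact: cst_continuous.
  apply: (@continuousB _ _ _ (cst s)); first exact: cst_continuous.
  exact: continuous_sqdist.
have nu := within_continuous_near cu xO e20.
have nq := near_le_of_continuous cq e20.
have [z [Oz [uz qz]]] := xO _ (filterI nu nq).
have {}uz := uz (subset_closure Oz); rewrite (qE z Oz) in uz.
rewrite -/q in qz; move: uz qz; set v := a / 2 * _; clearbody v q.
move=> uz qz; have -> : u x - q = (u x - v) - (q - v) by ring.
by apply: le_trans (ler_normB _ _) _; lra.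
Qed.

(** Positivity of [u] puts [Omega] inside the ball. Conversely, a segment from a point of [Omega] to
    a point of the ball cannot leave [Omega], since it would have to cross the boundary, where the
    quadratic vanishes. *)
Lemma serrin_ball : exists (p : 'rV[R]_N) (r : R),
  [/\ 0 < r, Omega = eball p r & radially_symmetric Omega p u].
Proof.
have [p [s uE]] := torsion_quadratic; have [[x0 Ox0] _ _ _] := dOmega.
have a20 : 0 < a / 2 by rewrite divr_gt0.
have inb x : Omega x -> dot (x - p) (x - p) < s.
  move=> Ox; have := torsion_gt0 Ox; rewrite uE ?pmulr_rgt0 ?subr_gt0//.
  exact: subset_closure.
have s0 : 0 < s by apply: le_lt_trans (inb _ Ox0); exact: dot_ge0.
have r0 : 0 < Num.sqrt s by rewrite sqrtr_gt0.
have rs : Num.sqrt s ^+ 2 = s by rewrite sqr_sqrtr// ltW.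
exists p, (Num.sqrt s); split=> //; last first.
  move=> x y xO yO xy; rewrite !uE// -!enorm_sqr xy//.
apply/seteqP; split=> [x Ox|x /eballE]; first by apply/eballE => //; rewrite rs inb.
rewrite rs => /(_ r0) xb.
(* Boundary points lie on the sphere, so [Omega] is relatively closed in the open ball. *)
have cl z : closure Omega z -> dot (z - p) (z - p) < s -> Omega z.
  move=> zO zb; have [//|/ubd] := closure_cases oO zO.
  rewrite uE// => /eqP; rewrite mulf_eq0 gt_eqF//= subr_eq0 => /eqP E.
  by rewrite E ltxx in zb.
pose w t := t *: (x - x0) + x0.
have cw : continuous (fun t : R => w t).
  move=> t; suff : w r @[r --> t] --> w t by [].
  by apply: cvgD; [exact: scalel_continuous|exact: cvg_cst].
have wb t : 0 <= t <= 1 -> dot (w t - p) (w t - p) < s.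
  by move=> t01; apply: sqdist_convex => //; exact: inb.
have E : [set t : R | t \in `[0, 1]%R /\ Omega (w t)] = [set` `[0, 1]%R].
  apply: (@segment_connected R 0 1).
  - by exists 0; split; [rewrite in_itv/= lexx ler01|rewrite /w scale0r add0r].
  - exists (w @^-1` Omega); first by apply: open_comp => // t _; exact: cw.
    by apply/seteqP; split=> t [].
  - exists (w @^-1` closure Omega).
      by apply: closed_comp; [move=> t _; exact: cw|exact: closed_closure].
    apply/seteqP; split=> t [t01 h]; split=> //; first exact: subset_closure.
    by apply: cl => //; apply: wb; move: t01; rewrite /= in_itv.
have : [set` `[0, 1]%R] (1 : R) by rewrite /= in_itv/= ler01 lexx.
by rewrite -E => -[_]; rewrite /w scale1r subrK.
Qed.

End p_function.

(** * Solutions on a ball *)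

Section lp_norms.
Variables (R : realType) (N : nat) (Omega : set 'rV[R]_N) (p : R).
Hypotheses (oO : open Omega) (bO : bounded_set Omega) (p_gt0 : 0 < p).
Implicit Types (f g : 'rV[R]_N -> R) (x : 'rV[R]_N).

Local Notation mu := (lebesgue_tuple R N).
Local Notation D := (@row_of_tuple R N @^-1` Omega).

Let mD : measurable D. Proof. exact: measurable_row_open. Qed.

Lemma lebesgue_bounded_lty : (mu D < +oo)%E.
Proof.
have [L L0 hL] := bounded_set_coord bO.
have LL : - L < L by rewrite gtrN.
apply: (@le_lt_trans _ _ (mu [set t | forall i, - L < tnth t i < L])).
  apply: le_measure; rewrite ?inE//.
    exact: (measurable_tuple_box (fun=> - L) (fun=> L)).
  by move=> t Dt i; have := hL _ Dt i; rewrite mxE ltr_norml.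
by rewrite (@lebesgue_tuple_boxE R N (fun=> - L) (fun=> L)) ?ltry.
Qed.

Lemma lpnorm_ext f g : (forall x, Omega x -> f x = g x) ->
  lpnorm p Omega f = lpnorm p Omega g.
Proof.
move=> fg; rewrite /lpnorm; congr (_ `^ _); apply: eq_Rintegral => t.
by rewrite inE => /fg ->.
Qed.

Lemma integrable_powR_norm f : continuous f ->
  mu.-integrable D (EFin \o (fun t => `|f (row_of_tuple t)| `^ p)).
Proof.
move=> cf; have cK := bounded_closure bO.
have [M M0 hM] : exists2 M : R, 0 < M & forall x, Omega x -> `|f x| < M.
  have := continuous_compact (continuous_subspaceT cf) cK.
  move=> /compact_bounded/ex_strict_bound_gt0[M M0 hM]; exists M => // x Ox.
  by apply: hM; exists x => //; exact: subset_closure.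
apply: measurable_bounded_integrable => //; first exact: lebesgue_bounded_lty.
  apply: measurable_funTS.
  apply: (@measurableT_comp _ _ _ _ _ _ (fun s : R => s `^ p) _
    (fun t => `|f (row_of_tuple t)|)); first exact: measurable_powR.
  apply: (@measurableT_comp _ _ _ _ _ _ (fun s : R => `|s|) _ (f \o @row_of_tuple R N)) => //.
  exact: measurable_row_continuous.
exists (M `^ p); split; first exact: num_real.
move=> r Mr t Dt; apply: le_trans (ltW Mr).
rewrite ger0_norm ?powR_ge0// ge0_ler_powR ?nnegrE ?(ltW M0)//.
  exact: ltW.
by apply: ltW; exact: hM.
Qed.

Lemma lpnormZ (k : R) f : 0 <= k -> continuous f ->
  lpnorm p Omega (fun x => k * f x) = k * lpnorm p Omega f.
Proof.
move=> k0 cf; rewrite /lpnorm.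
have -> : \int[mu]_(t in D) (`|k * f (row_of_tuple t)| `^ p) =
    k `^ p * \int[mu]_(t in D) (`|f (row_of_tuple t)| `^ p).
  rewrite -RintegralZl//; last exact: integrable_powR_norm.
  by apply: eq_Rintegral => t _; rewrite normrM (ger0_norm k0) powRM.
rewrite powRM ?powR_ge0//; last by apply: Rintegral_ge0 => t _; exact: powR_ge0.
by rewrite -powRrM mulfV ?gt_eqF// powRr1.
Qed.

(** |f| stays above |f x| / 2 on a box around [x]; the integral is compared with that of a multiple
    of its indicator. *)
Lemma lpnorm_gt0 f x : continuous f -> Omega x -> f x != 0 ->
  0 < lpnorm p Omega f.
Proof.
move=> cf Ox fx; apply: powR_gt0.
have fx0 : 0 < `|f x| by rewrite normr_gt0.
have fx20 : 0 < `|f x| / 2 by rewrite divr_gt0.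
have [r r0 hr] : exists2 r : R, 0 < r & forall z, ball x r z ->
    Omega z /\ `|f x| / 2 <= `|f z|.
  apply: near_ball_rV.
  apply: filterS2 (open_near oO Ox) (near_le_of_continuous (cf x) fx20).
  move=> z Oz fz; split=> //; have := ler_normD (f x - f z) (f z).
  by rewrite subrK; lra.
pose B := [set t : N.-tuple R | forall i, x 0 i - r < tnth t i < x 0 i + r].
have mB : measurable B by exact: measurable_tuple_box.
have EB : mu B = (\prod_(i < N) (x 0 i + r - (x 0 i - r)))%:E.
  by apply: (@lebesgue_tuple_boxE R N (fun i => x 0 i - r) (fun i => x 0 i + r)) => i; lra.
have vB0 : 0 < \prod_(i < N) (x 0 i + r - (x 0 i - r)).
  by apply: prodr_gt0 => i _; lra.
have tB t : B t -> ball x r (row_of_tuple t).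
  move=> h; apply/(ball_rVP _ _ r0) => i; rewrite mxE.
  by have := h i => /andP[? ?]; rewrite ltr_norml; apply/andP; split; lra.
pose k := (`|f x| / 2) `^ p; have k0 : 0 < k by exact: powR_gt0.
have iB : mu.-integrable D (EFin \o (fun t => k * \1_B t)).
  apply: measurable_bounded_integrable => //; first exact: lebesgue_bounded_lty.
    by apply: measurable_funTS; apply: measurable_funM => //; exact: measurable_indic.
  exists k; split; first exact: num_real.
  move=> s ks t _; apply: le_trans (ltW ks).
  by rewrite normrM gtr0_norm// indicE; case: (_ \in _);
    rewrite ?normr1 ?normr0 ?mulr1 ?mulr0// ltW.
apply: (@lt_le_trans _ _ (\int[mu]_(t in D) (k * \1_B t))); last first.
  apply: le_Rintegral => //; first exact: integrable_powR_norm.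
  move=> t Dt; rewrite indicE; have [|_] := boolP (t \in B); last first.
    by rewrite mulr0 powR_ge0.
  rewrite inE => /tB/hr[_ h]; rewrite mulr1.
  by rewrite ge0_ler_powR ?nnegrE ?(ltW p_gt0) ?(ltW fx20).
have -> : \int[mu]_(t in D) (k * \1_B t) = k * fine (mu B).
  transitivity (fine (k%:E * mu B)); last by rewrite EB.
  rewrite /Rintegral; congr fine.
  under eq_integral do rewrite EFinM.
  rewrite ge0_integralZl//; last 2 first.
  - by apply/measurable_EFinP; apply: measurable_funTS; exact: measurable_indic.
  - by rewrite lee_fin ltW.
  rewrite integral_indic// (_ : B `&` D = B) ?EB//.
  by apply: setIidl => t /tB/hr[].
by rewrite EB mulr_gt0.
Qed.

End lp_norms.

(** * The torsion function of a ball *)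

Section torsion_ball.
Variables (R : realType) (N : nat) (N_gt0 : (0 < N)%N).
Variables (x0 : 'rV[R]_N) (r : R) (r_gt0 : 0 < r).
Implicit Types (f u : 'rV[R]_N -> R) (x y z w nu : 'rV[R]_N).

Local Notation e_ i := (delta_mx (0 : 'I_1) i : 'rV[R]_N).
Local Notation Omega := (eball x0 r).
Local Notation U := (torsion x0 r).

Let N0 : 0 < N%:R :> R. Proof. by rewrite ltr0n. Qed.

Lemma eball_center : Omega x0.
Proof. by apply/eballE => //; rewrite subrr dot0l exprn_gt0. Qed.

Lemma torsionE x : U x = (r ^+ 2 - dot (x - x0) (x - x0)) / (2 * N%:R).
Proof. by rewrite /torsion enorm_sqr. Qed.

Lemma torsion_scaleP V (k : R) : open V -> let u x := k * U x in
  [/\ C2_on V u, forall x, V x -> grad u x = - (k / N%:R) *: (x - x0)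
    & forall x, V x -> laplacian u x = - k].
Proof.
move=> oV u; have NN : N%:R != 0 :> R by rewrite gt_eqF.
have cc (b : R) x : {for x, continuous (cst b : 'rV[R]_N -> R)}.
  exact: cst_continuous.
have [||||||h1 h2 h3] := @C2_on_explicit R N V u
  (fun i x => - (k / N%:R) * (x 0 i - x0 0 i))
  (fun i j x => - (k / N%:R) * (i == j)%:R).
- by [].
- move=> x _ i; apply: (@is_derive_quadratic _ _ _ _ _ (- (k / (2 * N%:R))) _ (u x)) => t.
  have [z zE] : exists z, z = x - x0 by eexists.
  have -> : x 0 i - x0 0 i = z 0 i by rewrite zE !mxE.
  rewrite /u !torsionE -addrA -zE !dotE (dotC (e_ i) z) !dot_delta !mxE !eqxx/=.
  by move: (dot z z) => q; field.
- move=> x _ i j.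
  apply: (@is_derive_quadratic _ _ _ _ _ 0 _ (- (k / N%:R) * (x 0 i - x0 0 i))) => t.
  by rewrite !mxE eqxx/=; ring.
- move=> x _; have -> : u = (fun x => k * ((r ^+ 2 - dot (x - x0) (x - x0)) / (2 * N%:R))).
    by apply/funext => z; rewrite /u torsionE.
  apply: (@continuousM _ _ (cst k)); first exact: cc.
  apply: (@continuousM _ _ _ (cst (2 * N%:R)^-1)); last exact: cc.
  apply: (@continuousB _ _ _ (cst (r ^+ 2))); first exact: cc.
  exact: continuous_sqdist.
- move=> x _ i; apply: (@continuousM _ _ (cst (- (k / N%:R)))); first exact: cc.
  apply: (@continuousB _ _ _ (fun y : 'rV[R]_N => y 0 i) (cst (x0 0 i))).
    exact: coord_continuous.
  exact: cc.
- by move=> x _ i j; exact: cc.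
split=> // x Vx; first by apply/rowP => i; rewrite !mxE h2.
rewrite /laplacian; under eq_bigr => i _ do rewrite h3// eqxx mulr1.
by rewrite sumr_const card_ord -[LHS]mulr_natr mulNr divfK.
Qed.

Lemma continuous_torsion : continuous U.
Proof.
move=> x; have [[cU _] _ _] := torsion_scaleP 1 openT.
have := cU x; rewrite inE => /(_ I).
by have -> : (fun x => 1 * U x) = U by apply/funext => z; rewrite mul1r.
Qed.

Lemma grad_torsion_scale (k : R) x :
  grad (fun x => k * U x) x = - (k / N%:R) *: (x - x0).
Proof. by have [_ + _] := torsion_scaleP k openT; apply. Qed.

Lemma grad_torsion x : grad U x = - N%:R^-1 *: (x - x0).
Proof.
have := grad_torsion_scale 1 x; rewrite div1r => <-.
by congr (grad _ _); apply/funext => z; rewrite mul1r.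
Qed.

Lemma continuous_enorm_grad_torsion : continuous (fun x => enorm (grad U x)).
Proof.
have -> : (fun x => enorm (grad U x)) =
    Num.sqrt \o (fun x => N%:R^-1 ^+ 2 * dot (x - x0) (x - x0)).
  apply/funext => x; rewrite /= grad_torsion /enorm !dotZl !dotZr.
  by congr Num.sqrt; move: (dot _ _) => q; ring.
move=> x; suff : {for x, continuous (Num.sqrt \o
    (fun x => N%:R^-1 ^+ 2 * dot (x - x0) (x - x0)))} by [].
apply: continuous_comp; last exact: sqrt_continuous.
apply: (@continuousM _ _ (cst (N%:R^-1 ^+ 2))); first exact: cst_continuous.
exact: continuous_sqdist.
Qed.

Lemma bounded_eball : bounded_set Omega.
Proof.
have [M [_ hM]] := compact_bounded (@compact_box R N (`|r| + \sum_i `|x0 0 i|)).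
exists M; split; first exact: num_real.
move=> s Ms x /eballE => /(_ r_gt0) xr; apply: hM => //= i.
have : (x 0 i - x0 0 i) ^+ 2 < r ^+ 2.
  by apply: le_lt_trans xr; have := dot_coord_le (x - x0) i; rewrite !mxE.
rewrite -[X in X < _]real_normK ?num_real// ltr_pXn2r ?nnegrE ?(ltW r_gt0)// => h.
rewrite -(subrK (x0 0 i) (x 0 i)); apply: le_trans (ler_normD _ _) _.
apply: lerD; first by rewrite (gtr0_norm r_gt0) ltW.
by rewrite (bigD1 i)//= lerDl; exact: sumr_ge0.
Qed.

Lemma boundary_eball x : boundary Omega x -> dot (x - x0) (x - x0) = r ^+ 2.
Proof.
move=> /(open_boundaryE x (@open_eball R N x0 r r_gt0))[xO nOx]; apply/eqP; rewrite eq_le.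
apply/andP; split; last first.
  by rewrite leNgt; apply/negP => h; apply: nOx; exact/eballE.
have cl := @closed_sqdist_le R N x0 (r ^+ 2).
apply: cl; apply: closureS xO => z /eballE => /(_ r_gt0); exact: ltW.
Qed.

Lemma torsion_center_gt0 : 0 < U x0.
Proof. by rewrite torsionE subrr dot0l subr0 divr_gt0 ?exprn_gt0// mulr_gt0. Qed.

Lemma boundary_torsion x : boundary Omega x -> U x = 0.
Proof. by move=> /boundary_eball h; rewrite torsionE h subrr mul0r. Qed.

(** The normal comes from an arbitrary defining function. Its inward directions enter the ball,
    hence have nonpositive product with x - x0, so x - x0 is a nonnegative multiple of [nu], of
    length [r]. *)
Lemma outer_normal_eball x nu : boundary Omega x -> outer_unit_normal Omega x nu ->
  dot (x - x0) nu = r.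
Proof.
move=> bx [V [phi [dphi nuE]]]; have [_ _ _ gphi _] := dphi.
set n := enorm (grad phi x) in nuE.
have n0 : 0 < n by rewrite sqrtr_gt0 dot_gt0.
have nu1 : dot nu nu = 1.
  by rewrite nuE dotZl dotZr -enorm_sqr -/n expr2 mulKf ?mulVf// gt_eqF.
have xr := boundary_eball bx.
have [|zE z0] := @halfspace_parallel R N nu (x - x0) nu1.
  move=> w; rewrite nuE dotZr pmulr_rlt0 ?invr_gt0// => wphi.
  have [d d0 hd] := boundary_cone (@open_eball R N x0 r r_gt0) bx dphi wphi.
  have d20 : 0 < d / 2 < d by rewrite divr_gt0//= ltr_pdivrMr// ltr_pMr// ltr1n.
  have := (eballE x0 _ r_gt0).1 (hd _ d20); rewrite -addrA.
  have [z zE] : exists z, z = x - x0 by eexists.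
  rewrite -zE in xr *; rewrite !dotE (dotC z w) xr.
  have := dot_ge0 w; have := d0; move: (dot w w) (dot w z) => A B; nra.
move: xr; have [q qE] : exists q, q = dot (x - x0) nu by eexists.
rewrite -qE in zE z0 *; rewrite zE dotZl dotZr nu1 mulr1 -expr2 => /eqP.
by rewrite eqrXn2 ?(ltW r_gt0)// => /eqP.
Qed.

End torsion_ball.

(** * Correspondence between solutions, the system and the scalar equation *)

Section solutions_on_ball.
Variables (R : realType) (N : nat) (p1 p2 q1 q2 lambda : R) (A B : R * R -> R).
Hypotheses (N_gt0 : (0 < N)%N) (p1_gt0 : 0 < p1) (p2_gt0 : 0 < p2)
  (q1_gt0 : 0 < q1) (q2_gt0 : 0 < q2) (lambda_gt0 : 0 < lambda)
  (A_gt0 : forall z, quadrant z -> 0 < A z) (B_gt0 : forall z, quadrant z -> 0 < B z).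
Variables (x0 : 'rV[R]_N) (r : R).
Hypothesis r_gt0 : 0 < r.
Implicit Types (u : 'rV[R]_N -> R) (x y z w nu : 'rV[R]_N).

Local Notation e_ i := (delta_mx (0 : 'I_1) i : 'rV[R]_N).
Local Notation Omega := (eball x0 r).
Local Notation U := (torsion x0 r).
Local Notation normU p := (lpnorm p (eball x0 r) (torsion x0 r)).
Local Notation normDU q := (grad_lpnorm q (eball x0 r) (torsion x0 r)).
Local Notation is_sol := (is_solution p1 p2 q1 q2 lambda A B Omega).

Let N0 : 0 < N%:R :> R. Proof. by rewrite ltr0n. Qed.
Let oO : open Omega. Proof. exact: open_eball. Qed.
Let bO : bounded_set Omega. Proof. exact: bounded_eball. Qed.

Lemma normU_gt0 p : 0 < p -> 0 < normU p.
Proof.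
move=> p0; apply: (lpnorm_gt0 oO bO p0 (@continuous_torsion R N N_gt0 x0 r)
  (eball_center x0 r_gt0)).
by rewrite gt_eqF// torsion_center_gt0.
Qed.

Lemma normDU_gt0 q : 0 < q -> 0 < normDU q.
Proof.
(* The gradient vanishes at the centre, so a point off the centre is needed. *)
move=> q0; pose x := (r / 2) *: e_ (Ordinal N_gt0) + x0.
have xx0 : dot (x - x0) (x - x0) = (r / 2) ^+ 2.
  by rewrite /x addrK dotZl dotZr dot_delta mxE !eqxx mulr1 expr2.
have Ox : Omega x.
  by apply/eballE => //; rewrite xx0 ltr_pXn2r ?nnegrE ?divr_ge0 ?ltW//; move: r_gt0; lra.
apply: (lpnorm_gt0 oO bO q0 (@continuous_enorm_grad_torsion R N N_gt0 x0 r) Ox).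
rewrite grad_torsion// /enorm dotZl dotZr xx0 gt_eqF// sqrtr_gt0.
by rewrite mulrA -expr2 sqrrN mulr_gt0// exprn_gt0 ?invr_gt0 ?divr_gt0.
Qed.

Lemma lpnorm_torsion_scale (k p : R) : 0 < p -> 0 <= k ->
  lpnorm p Omega (fun x => k * U x) = k * normU p.
Proof.
by move=> p0 k0; apply: lpnormZ => //; exact: (@continuous_torsion R N N_gt0 x0 r).
Qed.

Lemma grad_lpnorm_torsion_scale (k q : R) : 0 < q -> 0 <= k ->
  grad_lpnorm q Omega (fun x => k * U x) = k * normDU q.
Proof.
move=> q0 k0; have cg := @continuous_enorm_grad_torsion R N N_gt0 x0 r.
transitivity (lpnorm q Omega (fun x => k * enorm (grad U x))); last first.
  exact: (lpnormZ oO bO q0 k0 cg).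
rewrite /grad_lpnorm; congr (lpnorm _ _ _); apply/funext => x.
rewrite (@grad_torsion_scale R N N_gt0 x0 r) (@grad_torsion R N N_gt0 x0 r).
by rewrite -[k / _]/(k * _) -mulrN -scalerA /enorm dotZl dotZr mulrA -expr2
  sqrtrM ?sqr_ge0// sqrtr_sqr ger0_norm.
Qed.

(** The norms of [u] are mere numbers once [u] is given, so the equation reads - Delta u = k, and u
    - k U is harmonic with zero boundary values. *)
Lemma solution_torsion u : is_sol u -> let k := lambda *
    (B (lpnorm p2 Omega u, grad_lpnorm q2 Omega u) /
     A (lpnorm p1 Omega u, grad_lpnorm q1 Omega u)) in
  0 < k /\ forall x, closure Omega x -> u x = k * U x.
Proof.
move=> [C2c [Q1 Q2] eqn ubd _] k; have [C2 cu _ _] := C2c.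
have A0 := A_gt0 Q1; have B0 := B_gt0 Q2.
have k0 : 0 < k by rewrite mulr_gt0// divr_gt0.
split=> // x xO.
have lapu z : Omega z -> laplacian u z = - k.
  move=> /eqn; rewrite /k; move: A0; set a := A _; set b := B _; set l := laplacian _ _.
  clearbody a b l => a0 E; rewrite mulrA -E.
  by field; rewrite gt_eqF.
have [C2U _ lapU] := @torsion_scaleP R N N_gt0 x0 r Omega k oO.
have cU : continuous (fun x => k * U x).
  move=> z; apply: (@continuousM _ _ (cst k) U); first exact: cst_continuous.
  exact: (@continuous_torsion R N N_gt0 x0 r).
(* Used with s = 1 and s = -1 to obtain both inequalities. *)
have le0 (s : R) : forall z, closure Omega z -> s * (u z - k * U z) <= 0.
  apply: (@maximum_principle R N (closure Omega) (fun z => s * (u z - k * U z)) 0) => //.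
  - exact: bounded_closure.
  - move=> z; apply: cvgMr; apply: cvgB; first exact: cu.
    exact: (continuous_subspaceT cU).
  - move=> z /(closure_cases oO)[Oz|bz]; [right|left]; last first.
      by rewrite ubd// boundary_torsion// mulr0 subr0 mulr0.
    split; first exact: subset_interior_closure.
    exists 0 => //.
    have l1 := C2_on_has_laplacian oO C2 Oz; rewrite lapu// in l1.
    have l2 := C2_on_has_laplacian oO C2U Oz; rewrite lapU// in l2.
    have := has_laplacianZ s (has_laplacianD l1 (has_laplacianZ (-1) l2)).
    rewrite mulrN mulN1r opprK addNr mulr0; congr (has_laplacian _ _ _).
    by apply/funext => w; rewrite mulN1r.
apply/eqP; rewrite -subr_eq0 eq_le.
have := le0 1 x xO; have := le0 (-1) x xO; rewrite mul1r mulN1r oppr_le0.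
by move=> -> ->.
Qed.

Lemma solution_system u : is_sol u -> let k := lambda *
    (B (lpnorm p2 Omega u, grad_lpnorm q2 Omega u) /
     A (lpnorm p1 Omega u, grad_lpnorm q1 Omega u)) in
  [/\ lpnorm p1 Omega u = k * normU p1, lpnorm p2 Omega u = k * normU p2,
    grad_lpnorm q1 Omega u = k * normDU q1 & grad_lpnorm q2 Omega u = k * normDU q2].
Proof.
move=> us k; have [k0 uE] := solution_torsion us; rewrite -/k in k0 uE.
have uO x : Omega x -> u x = k * U x by move=> Ox; apply: uE; exact: subset_closure.
have gu x : Omega x -> enorm (grad u x) = enorm (grad (fun z => k * U z) x).
  (* Gradients are compared only on the open ball, where u = k U holds in a neighbourhood of each
     point. *)
  move=> Ox; congr enorm; apply/rowP => i; rewrite !mxE; apply: near_eq_derive.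
  by apply: filterS (open_near oO Ox) => z; exact: uO.
clearbody k; have k1 := ltW k0; split.
- by rewrite (lpnorm_ext p1 uO) (lpnorm_torsion_scale p1_gt0 k1).
- by rewrite (lpnorm_ext p2 uO) (lpnorm_torsion_scale p2_gt0 k1).
- transitivity (grad_lpnorm q1 Omega (fun x => k * U x)); first exact: lpnorm_ext.
  exact: grad_lpnorm_torsion_scale.
- transitivity (grad_lpnorm q2 Omega (fun x => k * U x)); first exact: lpnorm_ext.
  exact: grad_lpnorm_torsion_scale.
Qed.

Lemma torsion_scale_solution (s1 s2 t1 t2 : R) :
  system_set p1 p2 q1 q2 lambda A B x0 r (s1, s2, t1, t2) ->
  is_sol (fun x => s1 * (U x / normU p1)).
Proof.
move=> [[s10 s20 t10 t20] [s1E s2E t1E t2E]].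
have n1 := normU_gt0 p1_gt0.
set k := lambda * _ in s1E s2E t1E t2E.
have k0 : 0 < k by rewrite -(pmulr_lgt0 _ n1) -s1E.
have -> : (fun x => s1 * (U x / normU p1)) = (fun x => k * U x).
  apply/funext => x; rewrite s1E; move: n1; set n := normU p1; clearbody n => n1.
  by field; rewrite gt_eqF.
have k1 := ltW k0; pose u x := k * U x.
have [C2U gU lapU] := @torsion_scaleP R N N_gt0 x0 r Omega k oO.
have [C2T gT _] := @torsion_scaleP R N N_gt0 x0 r setT k openT.
have cT x : C1_at u x by apply: C2_on_C1_at C2T _ => //; exact: openT.
have f1 : lpnorm p1 Omega u = s1 by rewrite s1E; exact: lpnorm_torsion_scale.
have f2 : lpnorm p2 Omega u = s2 by rewrite s2E; exact: lpnorm_torsion_scale.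
have f3 : grad_lpnorm q1 Omega u = t1 by rewrite t1E; exact: grad_lpnorm_torsion_scale.
have f4 : grad_lpnorm q2 Omega u = t2 by rewrite t2E; exact: grad_lpnorm_torsion_scale.
have kE : k = lambda * (B (s2, t2) / A (s1, t1)) by [].
clearbody k; rewrite -/u /is_solution f1 f2 f3 f4; split.
- split=> //.
  + by apply: continuous_subspaceT => x; exact: C1_continuous.
  + move=> i; exists (partial i u); split=> //.
    by apply: continuous_subspaceT => x; have [_] := cT x; exact.
  + move=> i j; exists (partial j (partial i u)); split=> //.
    apply: continuous_subspaceT => x.
    by have [_ _ _ /(_ j)[]] := @C2_onP R N setT u x i C2T I.
- by [].
- move=> x Ox; rewrite lapU// mulrNN kE.
  have A0 : 0 < A (s1, t1) by apply: A_gt0.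
  move: A0; set a := A _; set b := B _; clearbody a b => a0.
  by field; rewrite gt_eqF.
- by move=> x bx; rewrite /u boundary_torsion// mulr0.
(* The gradient of k U is - (k / N) (x - x0), and (x - x0) . nu = r on the sphere. *)
exists (- (k / N%:R) * r) => x nu bx nun.
have E y : dot (grad u y) nu = - (k / N%:R) * dot nu (y - x0).
  by rewrite gT// dotZl dotC.
rewrite -(outer_normal_eball r_gt0 bx nun) dotC -E.
have cg : {for x, continuous (fun y => dot (grad u y) nu)}.
  have -> : (fun y => dot (grad u y) nu) = (fun y => - (k / N%:R) * dot nu (y - x0)).
    by apply/funext.
  apply: (@continuousM _ _ (cst (- (k / N%:R)))); first exact: cst_continuous.
  have -> : (fun y => dot nu (y - x0)) = (fun y => - dot nu (x0 - y)).
    by apply/funext => y; rewrite -dotNr opprB.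
  by apply: continuousN; exact: continuous_dot_sub.
apply/cvgrPdist_le => e e0.
by apply: filterS (near_le_of_continuous cg e0) => y h _.
Qed.

(** The four unknowns are multiples of four norms by one common factor, so the first determines the
    others. *)
Lemma system_g (s1 s2 t1 t2 : R) :
  system_set p1 p2 q1 q2 lambda A B x0 r (s1, s2, t1, t2) ->
  [/\ g_set p1 p2 q1 q2 lambda A B x0 r s1, s2 = normU p2 / normU p1 * s1,
    t1 = normDU q1 / normU p1 * s1 & t2 = normDU q2 / normU p1 * s1].
Proof.
move=> [[s10 s20 t10 t20]].
have n1 := normU_gt0 p1_gt0.
have A0 : 0 < A (s1, t1) by apply: A_gt0.
have B0 : 0 < B (s2, t2) by apply: B_gt0.
move: n1 A0 B0; rewrite /g_set /g_fun /=.
set m1 := normU p1; set m2 := normU p2; set d1 := normDU q1; set d2 := normDU q2.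
clearbody m1 m2 d1 d2 => n1 A0 B0 [].
set k := lambda * _ => s1E s2E t1E t2E.
have e2 : s2 = m2 / m1 * s1 by rewrite s1E s2E; field; rewrite gt_eqF.
have e3 : t1 = d1 / m1 * s1 by rewrite s1E t1E; field; rewrite gt_eqF.
have e4 : t2 = d2 / m1 * s1 by rewrite s1E t2E; field; rewrite gt_eqF.
split=> //; split=> //; rewrite -e2 -e3 -e4 {1}s1E /k.
move: A0 B0; set a := A _; set b := B _; clearbody a b => a0 b0.
by field; rewrite !gt_eqF.
Qed.

Lemma g_system (s : R) : g_set p1 p2 q1 q2 lambda A B x0 r s ->
  system_set p1 p2 q1 q2 lambda A B x0 r
    (s, normU p2 / normU p1 * s, normDU q1 / normU p1 * s, normDU q2 / normU p1 * s).
Proof.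
move=> [s0]; have n1 := normU_gt0 p1_gt0; have n2 := normU_gt0 p2_gt0.
have d10 := normDU_gt0 q1_gt0; have d20 := normDU_gt0 q2_gt0.
move: n1 n2 d10 d20; rewrite /g_fun /system_set /=.
set m1 := normU p1; set m2 := normU p2; set d1 := normDU q1; set d2 := normDU q2.
clearbody m1 m2 d1 d2 => n1 n2 d10 d20.
have i1 : 0 < m1^-1 by rewrite invr_gt0.
have S2 : 0 < m2 / m1 * s by apply: mulr_gt0 => //; exact: mulr_gt0.
have T1 : 0 < d1 / m1 * s by apply: mulr_gt0 => //; exact: mulr_gt0.
have T2 : 0 < d2 / m1 * s by apply: mulr_gt0 => //; exact: mulr_gt0.
have A0 : 0 < A (s, d1 / m1 * s) by apply: A_gt0.
have B0 : 0 < B (m2 / m1 * s, d2 / m1 * s) by apply: B_gt0.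
move: A0 B0; set a := A _; set b := B _; clearbody a b => a0 b0 gE.
have ks : lambda * (b / a) = s / m1.
  have : lambda * m1 * b = s * a by rewrite -gE divfK ?gt_eqF.
  move=> E; have -> : lambda * (b / a) = lambda * m1 * b / (a * m1).
    by field; rewrite !gt_eqF.
  by rewrite E; field; rewrite !gt_eqF.
by split=> //; rewrite !ks; split; field; rewrite gt_eqF.
Qed.

(** Only the first entry [s1] enters; it is the L^p1 norm of the function obtained. *)
Let solution_of (z : R * R * R * R) : closure Omega -> R :=
  sigL (closure Omega) (fun x => z.1.1.1 * (U x / normU p1)).

Lemma solution_setE : solution_set p1 p2 q1 q2 lambda A B Omega =
  solution_of @` system_set p1 p2 q1 q2 lambda A B x0 r.
Proof.
apply/seteqP; split=> [_ [u us <-]|_ [[[[s1 s2] t1] t2] zs <-]]; last first.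
  by exists (fun x => s1 * (U x / normU p1)) => //; exact: torsion_scale_solution zs.
have [k0 uE] := solution_torsion us; have [e1 e2 e3 e4] := solution_system us.
have [_ [[Q1 Q2] [Q3 Q4]] _ _ _] := us.
exists (lpnorm p1 Omega u, lpnorm p2 Omega u, grad_lpnorm q1 Omega u, grad_lpnorm q2 Omega u).
  exact: (conj (And4 Q1 Q3 Q2 Q4) (And4 e1 e2 e3 e4)).
apply/eq_sigLP => x; rewrite inE => xO /=; rewrite (uE x xO).
move: e1 (normU_gt0 p1_gt0); set k := lambda * _; clearbody k => ->.
by set n := normU p1; clearbody n => n0; field; rewrite gt_eqF.
Qed.

(** Evaluation at the centre, where [U] is positive, recovers [s1] and with it the whole
    quadruple. *)
Lemma solution_of_inj :
  {in system_set p1 p2 q1 q2 lambda A B x0 r &, injective solution_of}.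
Proof.
move=> [[[s1 s2] t1] t2] [[[s1' s2'] t1'] t2'] /set_mem zs /set_mem zs' /eq_sigLP.
move=> /(_ x0); rewrite inE => /(_ (subset_closure (eball_center x0 r_gt0))) /=.
have n1 := normU_gt0 p1_gt0.
have Ux0 := @torsion_center_gt0 R N N_gt0 x0 r r_gt0.
have q0 : U x0 / normU p1 != 0 by rewrite gt_eqF// divr_gt0.
move=> /(mulIf q0) E.
have [_ -> -> ->] := system_g zs; have [_ -> -> ->] := system_g zs'.
by rewrite E.
Qed.

Lemma g_setE : g_set p1 p2 q1 q2 lambda A B x0 r =
  (fun z : R * R * R * R => z.1.1.1) @` system_set p1 p2 q1 q2 lambda A B x0 r.
Proof.
apply/seteqP; split=> [s /g_system zs|_ [[[[s1 s2] t1] t2] zs <-]].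
  by eexists; first exact: zs.
by have [] := system_g zs.
Qed.

Lemma solution_set_card :
  solution_set p1 p2 q1 q2 lambda A B Omega #= system_set p1 p2 q1 q2 lambda A B x0 r.
Proof. by rewrite solution_setE; exact: inj_card_eq solution_of_inj. Qed.

Lemma system_set_card :
  system_set p1 p2 q1 q2 lambda A B x0 r #= g_set p1 p2 q1 q2 lambda A B x0 r.
Proof.
rewrite card_eq_sym g_setE; apply: inj_card_eq.
move=> [[[s1 s2] t1] t2] [[[s1' s2'] t1'] t2'] /set_mem zs /set_mem zs' /= E.
by have [_ -> -> ->] := system_g zs; have [_ -> -> ->] := system_g zs'; rewrite E.
Qed.

Lemma solution_form u : is_sol u -> exists s1 : R,
  [/\ 0 < s1, g_fun p1 p2 q1 q2 A B x0 r s1 = lambda * normU p1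
    & forall x, closure Omega x -> u x = s1 * (U x / normU p1)].
Proof.
move=> us; have : solution_set p1 p2 q1 q2 lambda A B Omega (sigL (closure Omega) u).
  by exists u.
rewrite solution_setE => -[[[[s1 s2] t1] t2] zs] /esym/eq_sigLP uE.
have [[s10 gs] _ _ _] := system_g zs; exists s1; split=> // x xO.
by apply: uE; rewrite inE.
Qed.

End solutions_on_ball.

Theorem theorem1 (R : realType) (N : nat) (p1 p2 q1 q2 lambda : R)
    (A B : R * R -> R)
    (N_gt0 : (0 < N)%N)
    (p1_gt0 : 0 < p1) (p2_gt0 : 0 < p2) (q1_gt0 : 0 < q1) (q2_gt0 : 0 < q2)
    (lambda_gt0 : 0 < lambda)
    (A_cont : {within @quadrant R, continuous A})
    (B_cont : {within @quadrant R, continuous B})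
    (A_gt0 : forall z, quadrant z -> 0 < A z)
    (B_gt0 : forall z, quadrant z -> 0 < B z) :
  (forall (Omega : set 'rV[R]_N) (u : 'rV[R]_N -> R),
     bounded_domain Omega -> C2_boundary Omega ->
     is_solution p1 p2 q1 q2 lambda A B Omega u ->
     exists (x0 : 'rV[R]_N) (r : R),
       [/\ 0 < r, Omega = eball x0 r & radially_symmetric Omega x0 u]) /\
  (forall (x0 : 'rV[R]_N) (r : R), 0 < r ->
     (solution_set p1 p2 q1 q2 lambda A B (eball x0 r) #=
        system_set p1 p2 q1 q2 lambda A B x0 r) /\
     (system_set p1 p2 q1 q2 lambda A B x0 r #=
        g_set p1 p2 q1 q2 lambda A B x0 r) /\
     (forall u : 'rV[R]_N -> R,
        is_solution p1 p2 q1 q2 lambda A B (eball x0 r) u ->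
        exists s1 : R,
          [/\ 0 < s1,
              g_fun p1 p2 q1 q2 A B x0 r s1 =
                lambda * lpnorm p1 (eball x0 r) (torsion x0 r)
            & forall x, closure (eball x0 r) x ->
                u x = s1 * (torsion x0 r x /
                              lpnorm p1 (eball x0 r) (torsion x0 r))])).
Proof.
split; last first.
  move=> x0 r r0; split; last split.
  - exact: solution_set_card.
  - exact: system_set_card.
  - exact: solution_form.
move=> Omega u dOmega C2bd [C2u [Q1 Q2] eqn ubd [c unu]].
set kA := A _ in eqn; set kB := B _ in eqn.
have A0 : 0 < kA by exact: A_gt0.
have B0 : 0 < kB by exact: B_gt0.
have N0 : 0 < N%:R :> R by rewrite ltr0n.
(* This is the [a] of the normalised equation Delta u = - N a, with the nonlocal coefficients frozen
   at the given [u]. *)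
have a0 : 0 < lambda * kB / kA / N%:R by rewrite !divr_gt0// mulr_gt0.
apply: (serrin_ball N_gt0 dOmega C2bd C2u _ a0 ubd unu) => x /eqn E.
rewrite -E; move: (laplacian u x) A0 N0 => l; clearbody kA kB => A0 N0.
by field; rewrite !gt_eqF.
Qed.
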